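(* Let $\mathcal U$ be a full rank, primitive upper cluster algebra (of geometric type, with coefficient semifield $\mathrm{Trop}(Z_1,\ldots,Z_m)$) with initial seed $t_0$, and let $$M=\frac{P_M(A_{1;t_0},\ldots,A_{n;t_0})}{A_{1;t_0}^{d_1}\cdots A_{n;t_0}^{d_n}}$$ be a non-initial cluster variable of $\mathcal U$ (i.e. a cluster variable not in $\{A_{1;t_0},\ldots,A_{n;t_0}\}$), where $(d_1,\ldots,d_n)^{\rm T}$ is the $d$-vector and $P_M$ the numerator polynomial of $M$ with respect to $t_0$. Then (i) $\mathcal U$ is factorial; (ii) the numerator polynomial $P_M$ of $M$ is irreducible in $\mathbb K[Z_1,\ldots,Z_m][A_{1;t_0},\ldots,A_{n;t_0}]$.
   Context: Throughout, $\mathbb K$ is a factorial domain (UFD) of characteristic $0$. A semifield $(\mathbb P,\oplus,\cdot)$ is an abelian multiplicative group with a commutative, associative operation $\oplus$ over which multiplication distributes; $\mathbb{KP}$ is its group ring over $\mathbb K$, and $\mathcal F$ is the field of rational functions in $n$ independent variables with coefficients in $\mathbb{KP}$. An integer $n\times n$ matrix $B$ is skew-symmetrizable if $SB$ is skew-symmetric for some integer diagonal matrix $S$ with positive diagonal entries. A (labeled) $\mathscr A$-seed over $\mathbb P$ is a triple $(B,X,A)$ with $B=(b_{ij})$ an $n\times n$ skew-symmetrizable integer matrix, $X=(X_1,\ldots,X_n)\in\mathbb P^n$, and $A=(A_1,\ldots,A_n)$ a free generating set of $\mathcal F$ over $\mathbb{KP}$. Its $k$-th exchange binomial is $P_k=\frac{X_k}{1\oplus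 X_k}\prod_{b_{jk}>0}A_j^{b_{jk}}+\frac{1}{1\oplus X_k}\prod_{b_{jk}<0}A_j^{-b_{jk}}$. The mutation $\mu_k(B,X,A)=(B',X',A')$ is: $b'_{ij}=-b_{ij}$ if $i=k$ or $j=k$, else $b'_{ij}=b_{ij}+\mathrm{sgn}(b_{ik})\max(b_{ik}b_{kj},0)$; $X'_k=X_k^{-1}$ and $X'_i=X_iX_k^{\max(b_{ki},0)}(1\oplus X_k)^{-b_{ki}}$ for $i\ne k$; $A'_i=A_i$ for $i\neq k$ and $A'_k=A_k^{-1}P_k$. Let $\mathbb T_n$ be the $n$-regular tree with edges labeled $1,\ldots,n$ so that edges at each vertex have distinct labels. An $\mathscr A$-seed pattern assigns to each vertex $t$ a seed $(B_t,X_t,A_t)$, $B_t=(b^t_{ij})$, $X_t=(X_{1;t},\ldots,X_{n;t})$, $A_t=(A_{1;t},\ldots,A_{n;t})$, such that seeds at vertices joined by an edge labeled $k$ are related by $\mu_k$. A vertex and its seed are denoted by the same letter; one vertex $t_0$ is chosen as initial. The upper cluster algebra is $\mathcal U=\bigcap_{t}\mathcal L(t)$ with $\mathcal L(t)=\mathbb{KP}[A_{1;t}^{\pm1},\ldots,A_{n;t}^{\pm1}]$. The $A_{k;t}$ are the cluster variables (they lie in $\mathcal U$). Standing assumption: no exchange binomial of $\mathcal U$ is invertible in $\mathbb{KP}$. Geometric type: $\mathbb P=\mathrm{Trop}(Z_1,\ldots,Z_m)$, the free abelian group on $Z_1,\ldots,Z_m$ with $\prod Z_i^{a_i}\oplus\prod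 Z_i^{b_i}=\prod Z_i^{\min(a_i,b_i)}$. Writing $X_{k;t}=\prod_i Z_i^{c_{ik}^t}$, $C_t=(c_{ij}^t)_{m\times n}$, the extended exchange matrix is the $(n+m)\times n$ matrix $\widetilde B_t=\begin{pmatrix}B_t\\C_t\end{pmatrix}$. $\mathcal U$ is full rank if it is of geometric type and $\widetilde B_{t_0}$ has full rank $n$; it is primitive if it is of geometric type and each column of $\widetilde B_{t_0}$ is primitive (the gcd of its entries is $1$). (Both properties are then shared by every $\widetilde B_t$.) $d$-vector: any non-zero $M\in\mathcal L(t_0)$ is uniquely $M=P_M(A_{1;t_0},\ldots,A_{n;t_0})/(A_{1;t_0}^{d_1}\cdots A_{n;t_0}^{d_n})$ with $d_i\in\mathbb Z$ and $P_M\in\mathbb{KP}[A_{1;t_0},\ldots,A_{n;t_0}]$ not divisible by any $A_{j;t_0}$; $(d_1,\ldots,d_n)^{\rm T}$ is the $d$-vector and $P_M$ the numerator polynomial of $M$ with respect to $t_0$. (In geometric type, cluster variables lie in $\mathbb Z[Z_1,\ldots,Z_m][A_{1;t_0}^{\pm1},\ldots,A_{n;t_0}^{\pm1}]$, a known result, so that for $M$ a cluster variable $P_M$ has coefficients in $\mathbb Z[Z_1,\ldots,Z_m]$.) *)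

(* Defs.v *)
From HB Require Import structures.
From mathcomp Require Import all_boot all_order all_algebra.
From mathcomp.multinomials Require Import mpoly.

Set Implicit Arguments.
Unset Strict Implicit.
Unset Printing Implicit Defensive.

Import Order.TTheory GRing.Theory Num.Theory.
Local Open Scope ring_scope.

(* Divisibility theory of a subring D of an integral domain R, the subring
   being given as a predicate; all notions are internal to D. *)
Section Subdomains.
Variable R : idomainType.
Implicit Types D : R -> Prop.

Definition is_subring D :=
  D 1 /\ forall x y, D x -> D y -> D (x - y) /\ D (x * y).

Definition invertible_in D x := D x /\ exists2 y, D y & x * y = 1.

Definition associated_in D x y := exists2 u, invertible_in D u & y = u * x.

Definition irreducible_in D x :=
  [/\ D x, x != 0, ~ invertible_in D x
    & forall y z, D y -> D z -> x = y * z ->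
        invertible_in D y \/ invertible_in D z].

Definition factorial_domain D :=
  [/\ is_subring D,
      forall x, D x -> x != 0 -> ~ invertible_in D x ->
        exists2 s : seq R, (forall y, y \in s -> irreducible_in D y)
                         & x = \prod_(y <- s) y
    & forall s s' : seq R,
        (forall y, y \in s -> irreducible_in D y) ->
        (forall y, y \in s' -> irreducible_in D y) ->
        \prod_(y <- s) y = \prod_(y <- s') y ->
        exists s'' : seq R,
          [/\ perm_eq s'' s', size s'' = size s
            & forall i, (i < size s)%N ->
                associated_in D (nth 0 s i) (nth 0 s'' i)]].

End Subdomains.

Section Adjunction.
Variable F : fieldType.
Implicit Type S : F -> Prop.

(* S[x_1, ..., x_k] *)
Definition adjoin S (k : nat) (x : 'I_k -> F) (f : F) :=
  exists2 p : {mpoly F[k]}, (forall e, S p@_e) & f = p.@[x].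

(* S[x_1^{+-1}, ..., x_k^{+-1}], for non-zero x_i: a polynomial divided by a
   monomial. *)
Definition adjoin_laurent S (k : nat) (x : 'I_k -> F) (f : F) :=
  exists2 p : F, adjoin S x p
               & exists e : 'I_k -> nat, f = p / \prod_i x i ^+ e i.

Definition free_generating_set S (k : nat) (x : 'I_k -> F) :=
  (forall p : {mpoly F[k]}, (forall e, S p@_e) -> p.@[x] = 0 -> p = 0) /\
  (forall f : F, exists a b : F,
     [/\ adjoin S x a, adjoin S x b, b != 0 & f = a / b]).

End Adjunction.

(* The tropical semifield Trop(Z_1, ..., Z_m): the row vector a stands for the
   monomial Z_1^{a_1} ... Z_m^{a_m}, so the group law is written additively
   (product +, inverse -, unit 0, powers *~). *)
Definition trop (m : nat) : zmodType := 'rV[int]_m.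

Definition tplus m (a b : trop m) : trop m :=
  \row_i Num.min (a 0 i) (b 0 i).

(* Since KP = K[Z_1^{+-1}, ..., Z_m^{+-1}] is a localization of K[Z_1, ..., Z_m],
   the field of rational functions in n variables over KP is the field of
   fractions of K[Z_1, ..., Z_m][x_1, ..., x_n]. *)
Definition ambient (K : idomainType) (m n : nat) : fieldType :=
  {fraction {mpoly {mpoly K[m]}[n]}}.

Section ClusterAlgebras.
Variables (K : idomainType) (m n : nat).
Local Notation F := (ambient K m n).

Definition scalar_embed (c : K) : F := tofrac (c%:MP_[m])%:MP_[n].

Definition Zvar (i : 'I_m) : F := tofrac ('X_i : {mpoly K[m]})%:MP_[n].

Definition is_scalar (f : F) := exists c : K, f = scalar_embed c.

Definition KZ : F -> Prop := adjoin is_scalar Zvar.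

(* The group ring of Trop(Z_1, ..., Z_m) over K. *)
Definition KP : F -> Prop := adjoin_laurent is_scalar Zvar.

Definition trop_embed (a : trop m) : F := \prod_i Zvar i ^ a 0 i.

Record seed := Seed {
  exchange_matrix : 'M[int]_n;
  coefficients : {ffun 'I_n -> trop m};
  cluster : {ffun 'I_n -> F}
}.

Definition skew_symmetrizable (B : 'M[int]_n) :=
  exists2 s : 'rV[int]_n, (forall i, 0 < s 0 i)
    & (diag_mx s *m B)^T = - (diag_mx s *m B).

Definition is_Aseed (t : seed) :=
  skew_symmetrizable (exchange_matrix t) /\ free_generating_set KP (cluster t).

Definition exchange_binomial (t : seed) (k : 'I_n) : F :=
  let: Seed B X A := t in
  trop_embed (X k - tplus 0 (X k)) * \prod_(j | 0 < B j k) A j ^ B j k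
  + trop_embed (- tplus 0 (X k)) * \prod_(j | B j k < 0) A j ^ (- B j k).

Definition mutate_matrix (k : 'I_n) (B : 'M[int]_n) : 'M[int]_n :=
  \matrix_(i, j)
    if (i == k) || (j == k) then - B i j
    else B i j + Num.sg (B i k) * Num.max (B i k * B k j) 0.

Definition mutate (k : 'I_n) (t : seed) : seed :=
  let: Seed B X A := t in
  Seed (mutate_matrix k B)
    [ffun i => if i == k then - X k
               else X i + X k *~ Num.max (B k i) 0
                        + tplus 0 (X k) *~ (- B k i)]
    [ffun i => if i == k then (A k)^-1 * exchange_binomial t k else A i].

(* The n-regular tree T_n: its vertices are the words in the labels without
   two equal consecutive letters, and the edge labeled k joins w to k :: w. *)
Definition reduced_word (w : seq 'I_n) := sorted (fun i j => i != j) w.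

Definition tree_vertex := {w : seq 'I_n | reduced_word w}.

Definition tree_edge (k : 'I_n) (t t' : tree_vertex) :=
  (val t' == k :: val t) || (val t == k :: val t').

Definition is_seed_pattern (Sigma : tree_vertex -> seed) :=
  (forall t, is_Aseed (Sigma t)) /\
  (forall k t t', tree_edge k t t' -> Sigma t' = mutate k (Sigma t)).

Definition laurent_ring (t : seed) : F -> Prop := adjoin_laurent KP (cluster t).

Definition upper_cluster_algebra (Sigma : tree_vertex -> seed) (f : F) :=
  forall t, laurent_ring (Sigma t) f.

Definition is_cluster_variable (Sigma : tree_vertex -> seed) (M : F) :=
  exists t k, M = cluster (Sigma t) k.

Definition extended_exchange_matrix (t : seed) : 'M[int]_(n + m, n) :=
  col_mx (exchange_matrix t) (\matrix_(i, k) coefficients t k 0 i).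

Definition full_rank (t : seed) :=
  \rank (map_mx intr (extended_exchange_matrix t) : 'M[rat]_(n + m, n)) = n.

Definition primitive (t : seed) :=
  forall k, \big[gcdn/0%N]_i `|extended_exchange_matrix t i k|%N = 1%N.

(* P is the numerator polynomial (evaluated at the cluster of t) and d the
   d-vector of M with respect to t. *)
Definition is_numerator_dvector (t : seed) (M P : F) (d : 'cV[int]_n) :=
  [/\ adjoin KP (cluster t) P,
      forall j, ~ exists2 Q, adjoin KP (cluster t) Q & P = Q * cluster t j
    & M = P / \prod_i cluster t i ^ d i 0].

End ClusterAlgebras.

(* Main.v *)
(** The Laurent ring of a seed is factorial by the lemmas of Gauss and Nagata. As
    the columns of the extended exchange matrix are primitive, every exchange
    binomial is a monomial times 1 + x with x a member of a basis of the lattice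
    of Laurent monomials; it is thus prime in the Laurent ring, and the full rank
    keeps two exchange binomials of a seed from being associated. Comparing
    localizations at such primes shows that the upper cluster algebra U is the
    intersection of the Laurent rings of any seed t and of its neighbours
    (starfish lemma), over any ring of scalars.

    A cluster variable A of t, exchanged along k, is an exchange binomial up to a
    unit in the Laurent ring of the k-th neighbour and a unit in the other rings
    of that intersection; hence A is prime in U. Inverting the cluster of t0
    turns U into the Laurent ring of t0, and Nagata's criterion makes U factorial.

    A cluster variable M is then prime or invertible in the Laurent ring of t0. In
    the latter case M is associated in U to an initial cluster variable, and
    integrality together with positivity turns this into an equality. Otherwise
    the numerator of M is prime up to Laurent monomials, and it is divisible by no
    Z_i because the multiplicity of Z_i is the same with respect to all seeds. *)

Require Import Defs.
From mathcomp Require Import all_boot all_order all_algebra.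
From mathcomp.multinomials Require Import mpoly.
From mathcomp Require Import ring zify.
From Stdlib Require Import Classical ClassicalEpsilon.
From Stdlib Require Import FunctionalExtensionality PropExtensionality.

Set Implicit Arguments.
Unset Strict Implicit.
Unset Printing Implicit Defensive.
Import Order.TTheory GRing.Theory Num.Theory.
Local Open Scope ring_scope.

(** * Factoriality *)

(** All rings are predicates on one ring, later the ambient field, and nearly all of them are spans
    of Laurent monomials whose exponents obey some condition. Primitivity supplies an integer weight
    with value 1 at the exponent a of an exchange binomial. The Laurent ring then becomes W[y, 1/y],
    where y = x^a and W is the part of weight 0, and 1 + y is linear in y: questions of divisibility
    turn into the vanishing of a polynomial at y = -1. Two obstacles shape the end of the proof. A
    unit relating two cluster variables could be any unit of K times a monomial in the Z_i, so
    expansions over the integers are needed besides those over K. And the definition of the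
    numerator excludes only the factors A_j, while irreducibility over K[Z_1, ..., Z_m] also has to
    exclude factors and denominators Z_i. The hypotheses on the initial seed are needed at every
    vertex. They are therefore kept as Bezout relations and as the absence of integral relations
    between columns, two forms that mutation transforms explicitly. *)

Section Factoriality.
Variable R : idomainType.
Implicit Types D E : R -> Prop.

Section Subring.
Variable D : R -> Prop.
Hypothesis Dring : is_subring D.

Lemma subring1 : D 1. Proof. by case: Dring. Qed.
Lemma subringB x y : D x -> D y -> D (x - y).
Proof. by move=> dx dy; case: Dring => _ /(_ x y dx dy) []. Qed.
Lemma subringM x y : D x -> D y -> D (x * y).
Proof. by move=> dx dy; case: Dring => _ /(_ x y dx dy) []. Qed.
Lemma subring0 : D 0.
Proof. by rewrite -(subrr 1); apply: subringB; exact: subring1. Qed.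
Lemma subringN x : D x -> D (- x).
Proof. by move=> dx; rewrite -sub0r; apply: subringB => //; exact: subring0. Qed.
Lemma subringD x y : D x -> D y -> D (x + y).
Proof. by move=> dx dy; rewrite -(opprK y); apply: subringB => //; exact: subringN. Qed.
Lemma subringX x k : D x -> D (x ^+ k).
Proof.
move=> dx; elim: k => [|k IH]; rewrite ?expr0 ?exprS; first exact: subring1.
exact: subringM.
Qed.
Lemma subring_prod (I : Type) (s : seq I) (P : pred I) (f : I -> R) :
  (forall i, P i -> D (f i)) -> D (\prod_(i <- s | P i) f i).
Proof.
by move=> df; apply: big_ind => //; [exact: subring1 | exact: subringM].
Qed.
Lemma subring_sum (I : Type) (s : seq I) (P : pred I) (f : I -> R) :
  (forall i, P i -> D (f i)) -> D (\sum_(i <- s | P i) f i).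
Proof.
by move=> df; apply: big_ind => //; [exact: subring0 | exact: subringD].
Qed.
Lemma subring_nat k : D k%:R.
Proof.
elim: k => [|k IH]; first exact: subring0.
by rewrite -addn1 natrD; apply: subringD => //; exact: subring1.
Qed.

End Subring.

Definition divides_in D x y := exists2 q, D q & y = x * q.

Definition prime_in D p :=
  [/\ D p, p != 0, ~ invertible_in D p
    & forall a b, D a -> D b -> divides_in D p (a * b) ->
        divides_in D p a \/ divides_in D p b].

Definition prime_product D x :=
  exists u (l : seq R), [/\ invertible_in D u,
    forall p, p \in l -> prime_in D p & x = u * \prod_(p <- l) p].

(* Kaplansky's characterization of the factorial domains. *)
Definition prime_factorial D :=
  is_subring D /\ forall x, D x -> x != 0 -> prime_product D x.

Section Primes.
Variable D : R -> Prop.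
Hypothesis Dring : is_subring D.
Let D1 := subring1 Dring.
Let DM := subringM Dring.

Lemma invertible1 : invertible_in D 1.
Proof. by split=> //; exists 1; rewrite ?mulr1. Qed.

Lemma invertibleM u v :
  invertible_in D u -> invertible_in D v -> invertible_in D (u * v).
Proof.
move=> [du [u' du' uu']] [dv [v' dv' vv']]; split; first exact: DM.
by exists (u' * v'); [exact: DM | rewrite mulrACA uu' vv' mulr1].
Qed.

Lemma invertible_factor u v : D u -> D v ->
  invertible_in D (u * v) -> invertible_in D u.
Proof.
move=> du dv [_ [w dw e]]; split=> //; exists (v * w); first exact: DM.
by rewrite mulrA.
Qed.

Lemma invertible_neq0 u : invertible_in D u -> u != 0.
Proof.
by move=> [_ [v _ e]]; apply/eqP=> u0; move/eqP: e; rewrite u0 mul0r eq_sym oner_eq0.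
Qed.

Lemma divides_mulr x y z : D z -> divides_in D x y -> divides_in D x (y * z).
Proof. by move=> dz [q dq ->]; exists (q * z); [exact: DM | rewrite mulrA]. Qed.

Lemma divides_mull x y z : D z -> divides_in D x y -> divides_in D x (z * y).
Proof. by rewrite mulrC; exact: divides_mulr. Qed.

Lemma divides_invertible p u : D p -> divides_in D p u ->
  invertible_in D u -> invertible_in D p.
Proof. by move=> dp [q dq ->] /invertible_factor; apply. Qed.

Lemma prime_divides_prod p (l : seq R) : prime_in D p ->
  (forall x, x \in l -> D x) -> divides_in D p (\prod_(x <- l) x) ->
  exists2 x, x \in l & divides_in D p x.
Proof.
move=> pp; have [dp p0 np hp] := pp.
elim: l => [|x l IH] dl.
  by rewrite big_nil => /divides_invertible /(_ invertible1) h; case: np; apply: h.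
have dx : D x by apply: dl; rewrite inE eqxx.
have dp' : D (\prod_(y <- l) y).
  rewrite big_seq; apply: subring_prod => // y yl.
  by apply: dl; rewrite inE yl orbT.
rewrite big_cons => /(hp _ _ dx dp') [h|h].
- by exists x; rewrite ?inE ?eqxx.
- have [|y yl py] := IH _ h.
    by move=> y yl; apply: dl; rewrite inE yl orbT.
  by exists y; rewrite ?inE ?yl ?orbT.
Qed.

Lemma prime_not_dividesX p x k : prime_in D p -> D x ->
  ~ divides_in D p x -> ~ divides_in D p (x ^+ k).
Proof.
move=> [dp _ np hp] dx npx; elim: k => [|k IH] h.
  by apply: np; apply: divides_invertible h _; rewrite ?expr0; [exact: dp | exact: invertible1].
by move: h; rewrite exprS => /hp [] //; exact: subringX.
Qed.

Lemma prime_irreducible p : prime_in D p -> irreducible_in D p.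
Proof.
move=> [dp p0 np hp]; split=> // y z dy dz e.
have: divides_in D p (y * z) by exists 1; rewrite ?mulr1.
have aux v w : D v -> D w -> p = v * w -> divides_in D p v -> invertible_in D w.
  move=> dv dw evw [q dq eq]; split=> //; exists q => //.
  by apply: (mulfI p0); rewrite mulr1 [RHS]evw eq; ring.
case/hp => // h; last by left; apply: aux h => //; rewrite e mulrC.
by right; apply: aux h.
Qed.

Lemma prime_product_invertible u : invertible_in D u -> prime_product D u.
Proof. by move=> hu; exists u, [::]; rewrite big_nil mulr1. Qed.

Lemma prime_product_prime p : prime_in D p -> prime_product D p.
Proof.
move=> hp; exists 1, [:: p]; split; first exact: invertible1.
  by move=> q; rewrite inE => /eqP ->.
by rewrite big_seq1 mul1r.
Qed.

Lemma prime_productM x y :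
  prime_product D x -> prime_product D y -> prime_product D (x * y).
Proof.
move=> [u [l [hu hl ->]]] [v [l' [hv hl' ->]]]; exists (u * v), (l ++ l').
split; first exact: invertibleM.
  by move=> p; rewrite mem_cat => /orP []; [exact: hl | exact: hl'].
by rewrite big_cat mulrACA.
Qed.

Lemma prime_product_prod (l : seq R) :
  (forall p, p \in l -> prime_product D p) -> prime_product D (\prod_(p <- l) p).
Proof.
elim: l => [|p l IH] h; first by rewrite big_nil; apply: prime_product_invertible;
  exact: invertible1.
rewrite big_cons; apply: prime_productM; first by apply: h; rewrite inE eqxx.
by apply: IH => q ql; apply: h; rewrite inE ql orbT.
Qed.

(** Each prime of the factorization divides a or b and is cancelled there, until a divides a unit.
    With b a denominator, this brings a factorization of a b back to one of a. *)
Lemma prime_product_factor a b : D a -> D b ->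
  prime_product D (a * b) -> prime_product D a.
Proof.
move=> da db [u [l [hu hl e]]].
elim: l a b da db e hl => [|p l IH] a b da db e hl.
  apply: prime_product_invertible; apply: (invertible_factor da db).
  by rewrite e big_nil mulr1.
have [dp p0 _ hp] : prime_in D p by apply: hl; rewrite inE eqxx.
have hl' q : q \in l -> prime_in D q by move=> ql; apply: hl; rewrite inE ql orbT.
have pab : divides_in D p (a * b).
  exists (u * \prod_(q <- l) q); last by rewrite e big_cons; ring.
  apply: DM; first by case: hu.
  by rewrite big_seq; apply: subring_prod => // q /hl' [].
case: (hp _ _ da db pab) => [] [c dc ec].
  rewrite ec; apply: prime_productM; first by apply: prime_product_prime; apply: hl;
    rewrite inE eqxx.
  apply: (IH c b) => //; apply: (mulfI p0).
  by rewrite mulrA -ec e big_cons; ring.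
apply: (IH a c) => //; apply: (mulfI p0).
by rewrite mulrCA -ec e big_cons; ring.
Qed.

(* The multiplicity of p in x is at most the number of prime factors of x. *)
Lemma prime_multiplicity x p : prime_product D x -> x != 0 -> prime_in D p ->
  exists k g, [/\ D g, x = p ^+ k * g & ~ divides_in D p g].
Proof.
move=> [u [l [hu hl ex]]] x0 hp; have [dp p0 np hp2] := hp.
move: {2}(size l) (erefl (size l)) => k;
  elim: k u l x hu hl ex x0 => [|k IH] u l x hu hl ex x0 sl.
  exists 0%N, x; rewrite expr0 mul1r; split=> //.
    by rewrite ex (size0nil sl) big_nil mulr1; case: hu.
  move=> h; apply: np; apply: divides_invertible h _ => //.
  by rewrite ex (size0nil sl) big_nil mulr1.
have dl y : y \in l -> D y by move=> /hl [].
have dx : D x.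
  by rewrite ex; apply: DM; [case: hu | rewrite big_seq; exact: subring_prod].
case: (classic (divides_in D p x)) => [px|npx]; last first.
  by exists 0%N, x; rewrite expr0 mul1r.
have : divides_in D p (\prod_(y <- l) y).
  move: px; rewrite ex => /hp2 [] //; first by case: hu.
    by rewrite big_seq; exact: subring_prod.
  by move=> h; case: np; apply: divides_invertible h hu.
case/(prime_divides_prod hp dl) => q ql pq.
have [dq q0 nq _] := hl q ql.
case: pq => r dr er.
have hr : invertible_in D r.
  by have [_ _ _ /(_ p r dp dr er) []] := prime_irreducible (hl q ql).
have exq : x = p * (u * r * \prod_(y <- rem q l) y).
  rewrite ex (perm_big _ (perm_to_rem ql)) big_cons; set P := \prod_(j <- _) j.
  by rewrite er /=; ring.
have [|||||k' [g [dg eg ng]]] := IH (u * r) (rem q l) (u * r * \prod_(y <- rem q l) y).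
- exact: invertibleM.
- by move=> y /mem_rem /hl.
- by [].
- by apply: contraNneq x0 => h; rewrite exq h mulr0.
- by rewrite size_rem // sl.
by exists k'.+1, g; split=> //; rewrite exprS -mulrA -eg.
Qed.

End Primes.

Section FactorialDomains.
Variable D : R -> Prop.

(** Uniqueness is applied to p c = a b. Factorizations are provided for non-zero non-units only, so
    the other values of a, b, c are treated apart. *)
Lemma irreducible_prime p : factorial_domain D -> irreducible_in D p ->
  prime_in D p.
Proof.
move=> [Dring Dfact Duniq] irr; have [dp p0 np hp] := irr.
split=> // a b da db [c dc e].
have [a0|a0] := eqVneq a 0; first by left; exists 0; [exact: subring0 | rewrite a0 mulr0].
have [b0|b0] := eqVneq b 0; first by right; exists 0; [exact: subring0 | rewrite b0 mulr0].
have c0 : c != 0 by apply: contraNneq a0 => c0; move/eqP: e;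
  rewrite c0 mulr0 mulf_eq0 (negbTE b0) orbF.
have unitcase x y : D y -> invertible_in D x -> x * y = p * c -> divides_in D p y.
  move=> dy [dx [x' dx' ex']] exy; exists (x' * c); first exact: subringM.
  by rewrite mulrCA -exy mulrA mulrC [x' * x]mulrC ex' mulr1.
case: (classic (invertible_in D a)) => [ia|nia]; first by right; apply: unitcase ia e.
case: (classic (invertible_in D b)) => [ib|nib]; first by left; apply: unitcase ib _ => //;
  rewrite mulrC.
case: (classic (invertible_in D c)) => [ic|nic].
  have [_ [c' dc' ec']] := ic.
  have ep : p = a * (b * c') by rewrite mulrA e -mulrA ec' mulr1.
  case: (hp _ _ da (subringM Dring db dc') ep) => // /(invertible_factor Dring db dc').
  by [].
have [sa ha ea] := Dfact a da a0 nia.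
have [sb hb eb] := Dfact b db b0 nib.
have [sc hc ec] := Dfact c dc c0 nic.
have h1 y : y \in p :: sc -> irreducible_in D y.
  by rewrite inE => /orP [/eqP ->|/hc].
have h2 y : y \in sa ++ sb -> irreducible_in D y.
  by rewrite mem_cat => /orP [/ha|/hb].
have [|s [sp _ hs]] := Duniq _ _ h1 h2; first by rewrite big_cons big_cat /= -ea -eb -ec.
have [u [du _] eu] := hs 0%N isT.
(* The index 0 is in range: an empty [s] would make [sa] empty and a = 1. *)
have : nth 0 s 0 \in sa ++ sb.
  rewrite -(perm_mem sp) mem_nth // (perm_size sp) -(perm_size sp).
  case: (s) sp => // /perm_size /=; rewrite size_cat => h.
  have a1 : sa = [::] by apply: size0nil; lia.
  by case: nia; rewrite ea a1 big_nil; exact: invertible1.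
move: eu => /= ->; rewrite mem_cat => /orP [h|h]; [left|right].
  rewrite ea (perm_big _ (perm_to_rem h)) big_cons /=;
    exists (u * \prod_(j <- rem (u * p) sa) j).
    apply: subringM => //; rewrite big_seq; apply: subring_prod => // y /mem_rem.
    by case/ha.
  ring.
rewrite eb (perm_big _ (perm_to_rem h)) big_cons /=; exists (u * \prod_(j <- rem (u * p) sb) j).
  apply: subringM => //; rewrite big_seq; apply: subring_prod => // y /mem_rem.
  by case/hb.
ring.
Qed.

Lemma factorial_prime_factorial : factorial_domain D -> prime_factorial D.
Proof.
move=> fD; have [Dring Dfact _] := fD; split=> // x dx x0.
case: (classic (invertible_in D x)) => [|nx]; first exact: prime_product_invertible.
have [s hs ->] := Dfact x dx x0 nx.
apply: prime_product_prod => // p /hs /(irreducible_prime fD).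
exact: prime_product_prime.
Qed.

Lemma prime_factorial_irreducible p : prime_factorial D ->
  irreducible_in D p -> prime_in D p.
Proof.
move=> [Dring Dpf] [dp p0 np hp].
have [u [l [hu hl e]]] := Dpf p dp p0; have [du [u' du' uu']] := hu.
case: l hl e => [|q l] hl e; first by case: np; rewrite e big_nil mulr1.
have hq : prime_in D q by apply: hl; rewrite inE eqxx.
have [dq q0 nq hq2] := hq.
have dl : D (\prod_(j <- l) j).
  rewrite big_seq; apply: subring_prod => // y yl.
  by have [] : prime_in D y by apply: hl; rewrite inE yl orbT.
have ep : p = q * (u * \prod_(j <- l) j) by rewrite e big_cons; ring.
have [|//|[dv [v' dv' vv']]] := hp _ _ dq _ ep; first exact: subringM.
split=> // a b da db [c dc ec].
have: divides_in D q (a * b).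
  by rewrite ec ep -mulrA; eexists; [|reflexivity]; do 2?[apply: subringM => //].
have aux x : D x -> divides_in D q x -> divides_in D p x.
  move=> dx [r dr ->]; rewrite ep; exists (v' * r); first exact: subringM.
  rewrite [RHS](_ : _ = q * r * (u * \prod_(j <- l) j * v')); last by ring.
  by rewrite vv' mulr1.
by case/hq2 => // /aux h; [left|right]; exact: h.
Qed.

Lemma prime_factorial_factorial : prime_factorial D -> factorial_domain D.
Proof.
move=> fD; have [Dring Dpf] := fD; split=> //.
  move=> x dx x0 nx; have [u [l [hu hl e]]] := Dpf x dx x0.
  case: l hl e => [|q l] hl e; first by case: nx; rewrite e big_nil mulr1.
  (* [factorial_domain] has no unit in front of the product, so one prime absorbs it. *)
  exists (u * q :: l); last by rewrite e !big_cons; ring.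
  have hq : prime_in D q by apply: hl; rewrite inE eqxx.
  move=> y; rewrite inE => /orP [/eqP ->|yl]; last first.
    by apply: prime_irreducible => //; apply: hl; rewrite inE yl orbT.
  have [dq q0 nq iq] := prime_irreducible Dring hq.
  have [du [u' du' uu']] := hu.
  split; first exact: subringM.
  - by rewrite mulf_neq0 // (invertible_neq0 hu).
  - by rewrite mulrC => /(invertible_factor Dring dq du).
  - move=> y' z dy dz eyz.
    have e1 : q = (u' * y') * z by rewrite -mulrA -eyz mulrA [u' * u]mulrC uu' mul1r.
    case: (iq _ _ (subringM Dring du' dy) dz e1); last by right.
    by rewrite mulrC => /(invertible_factor Dring dy du'); left.
(* A unit is carried along because cancelling two associated factors leaves their quotient
   behind. *)
have uniq_unit (s s' : seq R) u : (forall y, y \in s -> irreducible_in D y) ->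
    (forall y, y \in s' -> irreducible_in D y) -> invertible_in D u ->
    \prod_(y <- s) y = u * \prod_(y <- s') y ->
    exists s'' : seq R, [/\ perm_eq s'' s', size s'' = size s
      & forall i, (i < size s)%N -> associated_in D (nth 0 s i) (nth 0 s'' i)].
  elim: s s' u => [|p s IH] s' u hs hs' hu e.
    exists s'; split=> //; case: s' hs' e => [|q s'] hs' //.
    rewrite big_nil big_cons => e.
    have [dq _ nq _] : irreducible_in D q by apply: hs'; rewrite inE eqxx.
    case: nq; split=> //; exists (u * \prod_(j <- s') j); last by rewrite mulrCA -e.
    apply: subringM => //; first by case: hu.
    rewrite big_seq; apply: subring_prod => // y yl.
    by have [] : irreducible_in D y by apply: hs'; rewrite inE yl orbT.
  have ip : irreducible_in D p by apply: hs; rewrite inE eqxx.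
  have pp := prime_factorial_irreducible fD ip.
  have [dp p0 np hp] := pp.
  have ds : D (\prod_(j <- s) j).
    rewrite big_seq; apply: subring_prod => // y yl.
    by have [] : irreducible_in D y by apply: hs; rewrite inE yl orbT.
  have ds' : D (\prod_(j <- s') j).
    by rewrite big_seq; apply: subring_prod => // y /hs' [].
  have : divides_in D p (u * \prod_(y <- s') y) by rewrite -e big_cons;
    exists (\prod_(j <- s) j).
  case/(hp _ _ (proj1 hu) ds') => [/(divides_invertible Dring dp) /(_ hu) //|].
  case/(prime_divides_prod Dring pp) => [y /hs' [] //|q ql [r dr eq]].
  have [dq q0 nq iq] := hs' q ql.
  have hr : invertible_in D r by case: (iq p r).
  have [||||s'' [s1 s2 s3]] := IH (rem q s') (u * r).
  - by move=> y ys; apply: hs; rewrite inE ys orbT.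
  - by move=> y /mem_rem /hs'.
  - exact: invertibleM.
  - apply: (mulfI p0); move: e; rewrite big_cons (perm_big _ (perm_to_rem ql)) big_cons /= =>
    ->.
    by set P := \prod_(j <- _) j; rewrite eq; ring.
  exists (q :: s''); split.
  - by rewrite perm_sym; apply: perm_trans (perm_to_rem ql) _; rewrite perm_cons perm_sym.
  - by rewrite /= s2.
  - by case=> [_|i /s3 //]; exists r; rewrite // mulrC.
move=> s s' hs hs' e; apply: (uniq_unit s s' 1) => //; last by rewrite mul1r.
exact: invertible1.
Qed.

End FactorialDomains.

End Factoriality.


Section Localization.
Variables (R : idomainType) (D D' S : R -> Prop).

Definition localization_of :=
  [/\ is_subring D, is_subring D', forall x, D x -> D' x,
      forall s, S s -> D s /\ invertible_in D' s
    & forall x, D' x -> exists2 s, S s & D (x * s)].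

Hypothesis loc : localization_of.

(** A relation in D' becomes one in D after multiplication by denominators, and p divides none of
    these. *)
Lemma prime_localization p : prime_in D p ->
  (forall s, S s -> ~ divides_in D p s) -> prime_in D' p.
Proof.
have [Dr Dr' DD' hS hloc] := loc.
move=> [dp p0 np hp] npS; split; [exact: DD'|by []| |].
  move=> [_ [y dy e]]; have [s ss ds] := hloc y dy.
  by apply: (npS s ss); exists (y * s) => //; rewrite mulrA e mul1r.
move=> a b da db [c dc e].
have [s1 ss1 d1] := hloc a da; have [s2 ss2 d2] := hloc b db.
have [s3 ss3 d3] := hloc c dc.
have [ds1 [_ [t1 dt1 e1]]] := hS _ ss1; have [ds2 [_ [t2 dt2 e2]]] := hS _ ss2.
have [ds3 _] := hS _ ss3.
have : divides_in D p ((a * s1) * (b * s2) * s3).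
  exists (c * s3 * (s1 * s2)); first by do 2?[apply: subringM => //].
  by rewrite [LHS](_ : _ = a * b * (s1 * s2 * s3)); [rewrite e; ring | ring].
have aux x s t : D' t -> s * t = 1 -> divides_in D p (x * s) -> divides_in D' p x.
  move=> dt est [q dq eq]; exists (q * t); first by apply: subringM => //; exact: DD'.
  by rewrite mulrA -eq -mulrA est mulr1.
case/(hp _ _ (subringM Dr d1 d2) ds3); last by move=> /(npS _ ss3).
by case/(hp _ _ d1 d2); [left; apply: (aux a s1 t1)|right; apply: (aux b s2 t2)].
Qed.

(** A prime of D either divides an element of S and becomes a unit, or stays prime. *)
Lemma prime_factorial_localization : prime_factorial D -> prime_factorial D'.
Proof.
have [Dr Dr' DD' hS hloc] := loc => [] [_ Dpf]; split=> // x dx x0.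
have [s ss ds] := hloc x dx; have [ds1 isv] := hS s ss.
apply: (prime_product_factor Dr' dx (DD' _ ds1)).
have [|u [l [hu hl ->]]] := Dpf _ ds; first by rewrite mulf_neq0 // (invertible_neq0 isv).
apply: prime_productM => //.
  apply: prime_product_invertible => //; have [du [u' du' e]] := hu.
  by split; [exact: DD'|exists u' => //; exact: DD'].
apply: prime_product_prod => // p /hl hp.
case: (classic (exists2 s, S s & divides_in D p s)) => [[s' ss' [q dq e]]|h].
  apply: prime_product_invertible => //; apply: (@invertible_factor _ _ _ _ q) => //.
  - by apply: DD'; case: hp.
  - exact: DD'.
  - by rewrite -e; case: (hS _ ss').
apply: prime_product_prime => //; apply: prime_localization => // s' ss' h'.
by apply: h; exists s'.
Qed.

End Localization.

(** * Nagata's criterion *)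

Section Nagata.
Variables (R : idomainType) (D D' Sp : R -> Prop).

Definition product_of x := exists2 l : seq R, (forall p, p \in l ->
  Sp p) & x = \prod_(p <- l) p.

Hypothesis loc : localization_of D D' product_of.
Hypothesis Sprime : forall p, Sp p -> prime_in D p.
Hypothesis Sfactor : forall x, D x -> x != 0 ->
  exists s g, [/\ product_of s, D g, x = s * g & forall p, Sp p -> ~ divides_in D p g].

Let Dr : is_subring D. Proof. by case: loc. Qed.

Lemma product_of_prime_product s : product_of s -> prime_product D s.
Proof.
move=> [l hl ->]; apply: prime_product_prod => // p /hl /Sprime.
exact: prime_product_prime.
Qed.

(** If g divides a in D', then in D it divides a times a product of primes from [Sp]. None of these
    divides g, so each divides the cofactor and is cancelled. *)
Lemma prime_delocalization g : D g -> prime_in D' g ->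
  (forall p, Sp p -> ~ divides_in D p g) -> prime_in D g.
Proof.
have [_ Dr' DD' hS hloc] := loc.
move=> dg [_ g0 ng hg] npg.
have descend a : D a -> divides_in D' g a -> divides_in D g a.
  move=> da [q dq ea]; have [s [l hl es] ds] := hloc q dq.
  have : a * s = g * (q * s) by rewrite ea mulrA.
  move: (q * s) ds => r; rewrite es {es}.
  elim: l r hl => [|p l IH] r hl dr; first by rewrite big_nil mulr1 => e; exists r.
  have hp : prime_in D p by apply/Sprime/hl; rewrite inE eqxx.
  have [dp p0 np hp2] := hp.
  have hl' y : y \in l -> Sp y by move=> yl; apply: hl; rewrite inE yl orbT.
  have dP : D (\prod_(j <- l) j).
    by rewrite big_seq; apply: subring_prod => // y /hl' /Sprime [].
  rewrite big_cons => e.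
  have : divides_in D p (g * r).
    by exists (a * \prod_(j <- l) j); [exact: subringM | rewrite -e; ring].
  case/hp2 => // [|[r' dr' er]].
    by move/npg => []; apply: hl; rewrite inE eqxx.
  apply: (IH r') => //; apply: (mulfI p0).
  by rewrite [in RHS]mulrCA -er -e; ring.
split=> // [[_ [y dy e]]|a b da db [c dc e]].
  by apply: ng; split; [exact: DD' | exists y => //; exact: DD'].
have : divides_in D' g (a * b) by exists c => //; exact: DD'.
by case/(hg _ _ (DD' _ da) (DD' _ db)) => h; [left|right]; exact: descend.
Qed.

(** Up to factors from [Sp], every prime of D' has a representative in D without such factors, which
    is prime in D; hence x times suitable denominators is a product of primes. [Sfactor] takes the
    place of the chain condition in the usual statement. *)
Lemma nagata : prime_factorial D' -> prime_factorial D.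
Proof.
have [_ Dr' DD' hS hloc] := loc; move=> [_ Dpf']; split=> // x dx x0.
have punit u : invertible_in D' u -> exists2 s, product_of s & prime_product D (u * s).
  move=> [du [v dv e]]; have [s hs ds] := hloc u du; have [s' hs' ds'] := hloc v dv.
  exists s => //; apply: (prime_product_factor Dr ds ds').
  by rewrite mulrACA e mul1r; apply: prime_productM; rewrite //;
    exact: product_of_prime_product.
have pprime q : prime_in D' q -> exists2 s, product_of s & prime_product D (q * s).
  move=> [dq q0 nq hq]; have [s hs ds] := hloc q dq; exists s => //.
  have isv := proj2 (hS _ hs).
  have [|s' [g [hs' dg eg npg]]] := Sfactor ds;
    first by rewrite mulf_neq0 // (invertible_neq0 isv).
  rewrite eg; apply: prime_productM => //; first exact: product_of_prime_product.
  apply: prime_product_prime => //; apply: prime_delocalization => //.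
  have [ds' [_ [t' dt' et']]] := hS _ hs'.
  have [dss [t dt et]] := isv.
  have qg : q = g * (s' * t) by rewrite -[q]mulr1 -et mulrA eg; ring.
  split=> //; [exact: DD'| | |].
  - by apply: contraNneq q0 => g0; rewrite qg g0 mul0r.
  - move=> ig; apply: nq; rewrite qg; apply: invertibleM => //; apply: invertibleM => //.
      by split; [exact: DD'|exists t'].
    by split=> //; exists s => //; rewrite mulrC.
  - move=> a b da db [c dc e].
    have gq : g = q * (s * t').
      by rewrite mulrA eg mulrAC et' mul1r.
    have aux y : D' y -> divides_in D' q y -> divides_in D' g y.
      move=> dy [r dr ->]; rewrite qg; exists (s' * t * r); last by ring.
      by do 2?[apply: subringM => //]; exact: DD'.
    have /(hq a b da db) : divides_in D' q (a * b).
      exists (s * t' * c); last by rewrite e gq; ring.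
      by do 2?[apply: subringM => //].
    by case=> [/(aux _ da) h|/(aux _ db) h]; [left|right].
have [u [l [hu hl e]]] := Dpf' x (DD' _ dx) x0.
have [s0 hs0 h0] := punit u hu.
have [s1 hs1 h1] : exists2 s, product_of s & prime_product D ((\prod_(p <- l) p) * s).
  elim: l hl {e} => [|q l IH] hl.
    exists 1; first by exists [::] => //; rewrite big_nil.
    by rewrite big_nil mulr1; apply: prime_product_invertible => //; exact: invertible1.
  have [|s [l1 hl1 ->] hs] := IH; first by move=> y yl; apply: hl; rewrite inE yl orbT.
  have [|s' [l2 hl2 ->] hs'] := pprime q; first by apply: hl; rewrite inE eqxx.
  exists (\prod_(p <- l2 ++ l1) p).
    by exists (l2 ++ l1) => // y; rewrite mem_cat => /orP [/hl2|/hl1].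
  by rewrite big_cons big_cat /= mulrACA; exact: prime_productM.
have ds0 := proj1 (hS _ hs0); have ds1 := proj1 (hS _ hs1).
apply: (prime_product_factor Dr dx (subringM Dr ds0 ds1)).
by rewrite e mulrACA; exact: prime_productM.
Qed.

End Nagata.

(** * Transport along injective ring morphisms *)

Section Transport.
Variables (R R' : idomainType) (f : {rmorphism R -> R'}).
Hypothesis finj : injective f.
Variable D : R -> Prop.

Definition image_of (y : R') := exists2 x, D x & y = f x.

Lemma invertible_image x : D x -> invertible_in image_of (f x) <-> invertible_in D x.
Proof.
move=> dx; split=> [[_ [_ [y dy ->]]]|[_ [y dy e]]].
  by rewrite -rmorphM -(rmorph1 f) => /finj e; split=> //; exists y.
by split; [exists x | exists (f y); [exists y | rewrite -rmorphM e rmorph1]].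
Qed.

Lemma divides_image x y : divides_in image_of (f x) (f y) <-> divides_in D x y.
Proof.
split=> [[_ [q dq ->]]|[q dq ->]]; first by rewrite -rmorphM => /finj ->; exists q.
by exists (f q); [exists q | rewrite rmorphM].
Qed.

Lemma prime_image x : D x -> prime_in image_of (f x) <-> prime_in D x.
Proof.
move=> dx; have f0 y : (f y == 0) = (y == 0) by rewrite -(inj_eq finj) rmorph0.
split=> [[_ x0 nx hx]|[_ x0 nx hx]]; split=> //.
- by rewrite f0 in x0.
- by rewrite -invertible_image.
- move=> a b da db; rewrite -divides_image rmorphM => /hx; rewrite !divides_image.
  by apply; [exists a|exists b].
- by exists x.
- by rewrite f0.
- by rewrite invertible_image.
- by move=> _ _ [a da ->] [b db ->]; rewrite -rmorphM !divides_image; exact: hx.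
Qed.

Lemma subring_image : is_subring D <-> is_subring image_of.
Proof.
split=> Dr; split.
- by exists 1; rewrite ?rmorph1 //; exact: subring1.
- move=> _ _ [a da ->] [b db ->]; split.
    by exists (a - b); rewrite ?rmorphB //; exact: subringB.
  by exists (a * b); rewrite ?rmorphM //; exact: subringM.
- by have [x dx] := subring1 Dr; rewrite -(rmorph1 f) => /finj ->.
- move=> x y dx dy.
  have ix : image_of (f x) by exists x.
  have iy : image_of (f y) by exists y.
  split.
    by have [z dz] := subringB Dr ix iy; rewrite -rmorphB => /finj ->.
  by have [z dz] := subringM Dr ix iy; rewrite -rmorphM => /finj ->.
Qed.

Lemma prime_factorial_image : prime_factorial D <-> prime_factorial image_of.
Proof.
have f0 y : (f y == 0) = (y == 0) by rewrite -(inj_eq finj) rmorph0.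
split=> [] [Dr Dpf]; split; rewrite -?subring_image // ?subring_image //.
- move=> _ [x dx ->]; rewrite f0 => x0; have [u [l [hu hl ->]]] := Dpf x dx x0.
  exists (f u), [seq f p | p <- l]; split.
  + by rewrite invertible_image //; case: hu.
  + by move=> _ /mapP [p /hl hp ->]; rewrite prime_image //; case: hp.
  + by rewrite rmorphM rmorph_prod big_map.
- move=> x dx x0; have [||u [l [hu hl e]]] := Dpf (f x); rewrite ?f0 //; first by exists x.
  have [u' du' eu'] : image_of u by case: hu.
  have [l' hl' el'] : exists2 l', (forall p, p \in l' -> D p) & l = [seq f p | p <- l'].
    elim: l hl {e} => [|p l IH] hl; first by exists [::].
    have [|l' hl' ->] := IH; first by move=> y yl; apply: hl; rewrite inE yl orbT.
    have [[p' dp' ->] _ _ _] : prime_in image_of p by apply: hl; rewrite inE eqxx.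
    by exists (p' :: l') => // y; rewrite inE => /orP [/eqP ->|/hl'].
  exists u', l'; split.
  + by rewrite -invertible_image // -eu'.
  + by move=> p pl; rewrite -prime_image; [apply: hl; rewrite el' map_f | exact: hl'].
  + by apply: finj; rewrite e eu' el' big_map rmorphM rmorph_prod.
Qed.

End Transport.

(** * Gauss's lemma for polynomials over a factorial domain *)

Section GaussLemma.
Variable R : idomainType.
Implicit Types (p q : {poly R}) (a : R).

Local Notation all_of T := (fun _ : T => True).

Lemma subring_all (T : idomainType) : is_subring (all_of T).
Proof. by []. Qed.

Lemma prime_constant a : prime_in (all_of R) a -> prime_in (all_of {poly R}) a%:P.
Proof.
move=> [_ a0 na ha]; split=> //; first by rewrite polyC_eq0.
  move=> [_ [q _ e]]; apply: na; split=> //; exists q`_0 => //.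
  by move/(congr1 (fun p : {poly R} => p`_0)): e; rewrite coefCM coef1.
move=> p q _ _; have [n] := ubnP (size p + size q)%N.
elim: n p q => // n IH p q hn [r _ e].
have [->|p0] := eqVneq p 0; first by left; exists 0; rewrite ?mulr0.
have [->|q0] := eqVneq q 0; first by right; exists 0; rewrite ?mulr0.
have lt_drop (s : {poly R}) : s != 0 ->
    (size (s - (lead_coef s)%:P * 'X^((size s).-1))%R < size s)%N.
  rewrite -size_poly_gt0 => s0; rewrite -[X in (_ < X)%N](prednK s0).
  apply/leq_sizeP => j hj; rewrite coefB coefCM coefXn.
  have [->|ne] := eqVneq j (size s).-1; first by rewrite mulr1 subrr.
  by rewrite mulr0 nth_default ?subr0 // -(prednK s0) ltn_neqAle eq_sym ne.
have step (s t : {poly R}) : divides_in (all_of R) a (lead_coef s) -> a%:P * r = s * t ->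
    divides_in (all_of {poly R}) a%:P ((s - (lead_coef s)%:P * 'X^((size s).-1)) * t).
  move=> [b _ eb] est; exists (r - b%:P * 'X^((size s).-1) * t) => //.
  by rewrite mulrBl -est eb polyCM; ring.
have back (s : {poly R}) : divides_in (all_of R) a (lead_coef s) ->
    divides_in (all_of {poly R}) a%:P (s - (lead_coef s)%:P * 'X^((size s).-1)) ->
    divides_in (all_of {poly R}) a%:P s.
  move=> [b _ eb] [t _ et]; exists (t + b%:P * 'X^((size s).-1)) => //.
  by rewrite mulrDr -et mulrA -polyCM -eb subrK.
have : divides_in (all_of R) a (lead_coef p * lead_coef q).
  by exists (lead_coef r) => //; rewrite -lead_coefM e lead_coefM lead_coefC.
case/ha => // h.
  have [|||] := IH (p - (lead_coef p)%:P * 'X^((size p).-1)) q.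
  - by rewrite -ltnS; apply: leq_trans hn; rewrite ltnS ltn_add2r lt_drop.
  - exact: step.
  - by move/(back _ h); left.
  - by right.
have [|||] := IH p (q - (lead_coef q)%:P * 'X^((size q).-1)).
- by rewrite -ltnS; apply: leq_trans hn; rewrite ltnS ltn_add2l lt_drop.
- by rewrite mulrC; apply: step => //; rewrite -e mulrC.
- by left.
- by move/(back _ h); right.
Qed.

Hypothesis Rpf : prime_factorial (all_of R).

(** The extraction ends because a constant prime dividing p divides its leading coefficient, which
    loses a prime factor at each division. *)
Lemma primitive_part p : p != 0 -> exists (l : seq R) q,
  [/\ forall a, a \in l -> prime_in (all_of R) a, p = (\prod_(a <- l) a)%:P * q
    & forall a, prime_in (all_of R) a -> ~ divides_in (all_of {poly R}) a%:P q].
Proof.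
move=> p0; have lp0 : lead_coef p != 0 by rewrite lead_coef_eq0.
have [u [l [hu hl e]]] := proj2 Rpf (lead_coef p) I lp0.
have [n sl] := ubnP (size l).
elim: n => // n IH in p p0 lp0 u l hu hl e sl *.
case: (classic (exists2 a, prime_in (all_of R) a & divides_in (all_of {poly R}) a%:P p));
  last first.
  move=> h; exists [::], p; rewrite big_nil mul1r; split=> // a pa da.
  by apply: h; exists a.
move=> [a pa [q _ epq]]; have [_ a0 na ha] := pa.
have : divides_in (all_of R) a (u * \prod_(b <- l) b).
  by exists (lead_coef q) => //; rewrite -e epq lead_coefM lead_coefC.
case/ha => // [/(divides_invertible (subring_all R) I)/(_ hu) //|].
case/(prime_divides_prod (subring_all R) pa) => // b bl [c _ eb].
have pb := hl b bl.
have ic : invertible_in (all_of R) c.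
  by have [_ _ _ /(_ a c I I eb) []] := prime_irreducible (subring_all R) pb.
have q0 : q != 0 by apply: contraNneq p0 => q0; rewrite epq q0 mulr0.
have [|||||l' [r [hl' er nr]]] := IH q q0 _ (u * c) (rem b l).
- by rewrite lead_coef_eq0.
- exact: invertibleM.
- by move=> y /mem_rem /hl.
- apply: (mulfI a0); move: e.
  rewrite epq lead_coefM lead_coefC (perm_big _ (perm_to_rem bl)) big_cons /= => ->.
  by set P := \prod_(j <- _) j; rewrite eb; ring.
- by rewrite size_rem //; case: (l) bl sl.
exists (a :: l'), r; split=> //.
  by move=> y; rewrite inE => /orP [/eqP ->|/hl'].
by rewrite epq er big_cons polyCM mulrA.
Qed.

End GaussLemma.

Section FieldPolynomials.
Variable F : fieldType.
Implicit Types p q : {poly F}.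
Local Notation all_of T := (fun _ : T => True).

Lemma invertible_size1 p : size p = 1%N -> invertible_in (all_of {poly F}) p.
Proof.
move=> /eqP/size_poly1P [c c0 ->]; split=> //; exists (c^-1)%:P => //.
by rewrite -polyCM mulfV.
Qed.

Lemma irreducible_poly_prime p : irreducible_poly p -> prime_in (all_of {poly F}) p.
Proof.
move=> irr; have p0 := irredp_neq0 irr; split=> //.
  move=> [_ [q _ e]]; have := irr.1; have q0 : q != 0.
    by apply/eqP => q0; move/eqP: e; rewrite q0 mulr0 eq_sym oner_eq0.
  move/(congr1 (fun p : {poly F} => size p)): e; rewrite size_mul // size_poly1.
  by rewrite -size_poly_gt0 in q0; lia.
have dvd a : p %| a -> divides_in (all_of {poly F}) p a.
  by move=> /dvdpP [c ->]; exists c; rewrite // mulrC.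
move=> a b _ _ [c _ e].
have pab : p %| a * b by rewrite e dvdp_mulr.
case: (boolP (p %| a)) => [/dvd|npa]; first by left.
right; apply: dvd; rewrite -(Gauss_dvdpr _ (_ : coprimep p a)) //.
rewrite coprimep_def; apply/negPn/negP => h.
by move: npa; rewrite -(eqp_dvdl _ (irr.2 _ h (dvdp_gcdl p a))) dvdp_gcdr.
Qed.

Lemma field_poly_prime_factorial : prime_factorial (all_of {poly F}).
Proof.
split=> // p _; have [n] := ubnP (size p); elim: n p => // n IH p hn p0.
case: (classic (irreducible_poly p)) => [/irreducible_poly_prime|nirr].
  by apply: prime_product_prime.
have [s1|s1] := eqVneq (size p) 1%N.
  by apply: prime_product_invertible => //; exact: invertible_size1.
have [q [hq1 hq2 hq3]] : exists q, [/\ size q != 1%N, q %| p & ~~ (q %= p)].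
  apply: NNPP => h; apply: nirr; split.
    by rewrite -size_poly_gt0 in p0; lia.
  by move=> q q1 qp; apply/negPn/negP => nq; apply: h; exists q.
have /dvdpP [r er] := hq2.
move: p0; rewrite er mulf_eq0 negb_or => /andP [r0 q0].
have sz := size_mul r0 q0; rewrite -er in sz.
have r1 : size r != 1%N.
  apply: contra hq3 => /size_poly1P [c c0 ec].
  by rewrite er ec mul_polyC eqp_sym eqp_scale.
move: (r0) (q0); rewrite -!size_poly_gt0 => r2 q2.
have [h1 h2] : (size r < n /\ size q < n)%N.
  move: sz hn r1 hq1 r2 q2; move: (size p) (size q) (size r) => a b c; lia.
by apply: prime_productM => //; apply: IH.
Qed.

End FieldPolynomials.

Section Gauss.
Variable R : idomainType.
Local Notation all_of T := (fun _ : T => True).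
Local Notation frac := (@FracField.tofrac R : {rmorphism R -> {fraction R}}).

Lemma fraction_quotient (z : {fraction R}) : exists a b, b != 0 /\ z * frac b = frac a.
Proof.
elim/quotW: z => z; exists (fraction.frac z).1, (fraction.frac z).2.
have z0 : (fraction.frac z).2 != 0 by case: z.
split=> //; rewrite /=; unlock FracField.tofrac; rewrite -[LHS]FracField.pi_mul.
apply/eqmodP; rewrite /= FracField.equivfE /FracField.mulf.
by rewrite !fraction.numden_Ratio ?mulr1 ?mul1r ?oner_neq0 // mulrC.
Qed.

Hypothesis Rpf : prime_factorial (all_of R).

(** Nagata's criterion for R[X] inside Frac(R)[X]: inverting the primes of R inverts all non-zero
    constants, and [primitive_part] extracts the constant primes. *)
Lemma poly_prime_factorial : prime_factorial (all_of {poly R}).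
Proof.
have frac_inj : injective frac by move=> x y /eqP; rewrite tofrac_eq => /eqP.
pose mf : {rmorphism {poly R} -> {poly {fraction R}}} := map_poly frac.
have mf_inj : injective mf.
  by apply: map_inj_poly => //; rewrite rmorph0.
apply/(prime_factorial_image mf_inj).
pose Sp := image_of mf (fun p => exists2 a, prime_in (all_of R) a & p = a%:P).
apply: (@nagata _ _ (all_of _) Sp) (field_poly_prime_factorial _) => [||_ [p _ ->] p0].
- split=> //.
  + exact/(subring_image mf_inj).
  + move=> s [l hl ->]; split.
      rewrite big_seq; apply: subring_prod; first exact/(subring_image mf_inj).
      by move=> p /hl [q _ ->]; exists q.
    rewrite big_seq; apply: big_ind => //; [exact: invertible1|by move=> *;
      exact: invertibleM|].
    move=> p /hl [_ [a [_ a0 _ _] ->] ->]; apply: invertible_size1.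
    by rewrite /mf /= map_polyC size_polyC /= tofrac_eq0 a0.
  + move=> p _.
    have [d [d0 [q eq]]] : exists d, d != 0 /\ exists q, p * (frac d)%:P = mf q.
      elim/poly_ind: p => [|p c [d [d0 [q eq]]]].
        by exists 1; rewrite oner_neq0; split=> //; exists 0; rewrite mul0r rmorph0.
      have [a [b [b0 eab]]] := fraction_quotient c.
      exists (d * b); split; first by rewrite mulf_neq0.
      exists (q * b%:P * 'X + (a * d)%:P).
      have -> : mf (q * b%:P * 'X + (a * d)%:P) = mf q * mf b%:P * mf 'X + mf (a * d)%:P.
        by rewrite rmorphD; congr (_ + _); rewrite [LHS]rmorphM; congr (_ * _); exact: rmorphM.
      rewrite -eq /mf /= map_polyX !map_polyC /= !rmorphM /=.
      by rewrite -eab !polyCM; ring.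
    (* The denominator has to be a plain product of primes, so the unit part of d moves, as its
       inverse v, to the numerator. *)
    have [u [l [hu hl e]]] := proj2 Rpf d I d0; have [_ [v _ ev]] := hu.
    exists (mf (\prod_(a <- l) a)%:P).
      exists [seq mf a%:P | a <- l]; last by rewrite big_map -rmorph_prod -rmorph_prod.
      by move=> _ /mapP [a /hl ha ->]; exists a%:P => //; exists a.
    exists (v%:P * q) => //.
    rewrite rmorphM -eq e /mf /= !map_polyC /= rmorphM !polyCM /= mulrC.
    rewrite [RHS](_ : _ = p * ((frac u)%:P * (frac v)%:P) * (frac (\prod_(a <- l) a))%:P);
      last by ring.
    by rewrite -polyCM -rmorphM ev rmorph1 mulr1 mulrC.
- by move=> _ [_ [a pa ->] ->]; apply/prime_image => //; exact: prime_constant.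
- rewrite (raddf_eq0 _ mf_inj) in p0.
  have [l [q [hl -> nq]]] := primitive_part Rpf p0.
  exists (mf (\prod_(a <- l) a)%:P), (mf q); split.
  + exists [seq mf a%:P | a <- l]; last by rewrite big_map -rmorph_prod -rmorph_prod.
    by move=> _ /mapP [a /hl ha ->]; exists a%:P => //; exists a.
  + by exists q.
  + by rewrite rmorphM.
  + by move=> _ [_ [a pa ->] ->] /(divides_image mf_inj) /(nq a pa).
Qed.

End Gauss.

(** * Laurent polynomials *)

Section LaurentSpan.
Variables (F : fieldType) (N : nat).
Implicit Types (x y : 'I_N -> F) (e a b : 'cV[int]_N) (H : 'cV[int]_N -> Prop).
Implicit Types (D : F -> Prop).

Definition monomial x e := \prod_r x r ^ e r 0.

Definition var r : 'cV[int]_N := delta_mx r 0.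

(** The condition [H] on exponents lets one notion cover Laurent and polynomial rings, homogeneous
    parts, and lower bounds on the multiplicity of a variable. Exponents may repeat; [span_sum]
    collects them. *)
Inductive Span D x H : F -> Prop :=
| span0 : Span D x H 0
| span_cons c e f : D c -> H e -> Span D x H f -> Span D x H (c * monomial x e + f).

Definition all_exponents (e : 'cV[int]_N) := True.

Definition free D x :=
  forall (s : seq 'cV[int]_N) (c : 'cV[int]_N -> F), uniq s -> (forall e, D (c e)) ->
    \sum_(e <- s) c e * monomial x e = 0 -> forall e, e \in s -> c e = 0.

Lemma eq_monomial x y e : (forall r, e r 0 != 0 -> x r = y r) -> monomial x e = monomial y e.
Proof.
move=> h; apply: eq_bigr => r _; have [->|/h ->//] := eqVneq (e r 0) 0.
by rewrite !expr0z.
Qed.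

Lemma monomial0 x : monomial x 0 = 1.
Proof. by rewrite /monomial big1 // => r _; rewrite mxE. Qed.

Lemma monomial_var x r : monomial x (var r) = x r.
Proof.
rewrite /monomial (bigD1 r) //= mxE !eqxx big1 ?mulr1 // => i ir.
by rewrite mxE (negbTE ir).
Qed.

Section NonZero.
Variable x : 'I_N -> F.
Hypothesis x0 : forall r, x r != 0.

Lemma monomialD e e' : monomial x (e + e') = monomial x e * monomial x e'.
Proof.
by rewrite -big_split; apply: eq_bigr => r _; rewrite mxE expfzDr.
Qed.

Lemma monomialN e : monomial x (- e) = (monomial x e)^-1.
Proof. by rewrite /monomial -prodfV; apply: eq_bigr => r _; rewrite mxE invr_expz. Qed.

Lemma monomial_neq0 e : monomial x e != 0.
Proof. by apply/prodf_neq0 => r _; rewrite expfz_neq0. Qed.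

Lemma monomialMn e k : monomial x (e *+ k) = monomial x e ^+ k.
Proof.
elim: k => [|k IH]; first by rewrite mulr0n monomial0 expr0.
by rewrite mulrS monomialD IH exprS.
Qed.

End NonZero.

Section Span.
Variables (D : F -> Prop) (x : 'I_N -> F).
Hypothesis Dring : is_subring D.
Hypothesis x0 : forall r, x r != 0.
Let D0 := subring0 Dring.
Let D1 := subring1 Dring.
Local Notation span := (Span D x).
Local Notation mon := (monomial x).

Lemma span_mono H H' f : (forall e, H e -> H' e) -> span H f -> span H' f.
Proof. by move=> h; elim=> [|c e g dc he _ IH]; constructor; auto. Qed.

Lemma span_monomial H c e : D c -> H e -> span H (c * mon e).
Proof. by move=> dc he; rewrite -[X in span H X]addr0; constructor => //; exact: span0. Qed.

Lemma span_monomial1 H e : H e -> span H (mon e).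
Proof. by move=> he; rewrite -[mon e]mul1r; exact: span_monomial. Qed.

Lemma spanD H f g : span H f -> span H g -> span H (f + g).
Proof. by elim=> [|c e h dc he _ IH] sg; rewrite ?add0r // -addrA; constructor; auto. Qed.

Lemma spanN H f : span H f -> span H (- f).
Proof.
elim=> [|c e h dc he _ IH]; first by rewrite oppr0; exact: span0.
by rewrite opprD -mulNr; constructor => //; exact: subringN.
Qed.

Lemma spanM H H' H'' f g : (forall e e', H e -> H' e' -> H'' (e + e')) ->
  span H f -> span H' g -> span H'' (f * g).
Proof.
move=> h; elim=> [|c e f' dc he _ IH] sg; first by rewrite mul0r; exact: span0.
rewrite mulrDl; apply: spanD; last exact: IH.
elim: sg => [|c' e' g' dc' he' _ IH']; first by rewrite mulr0; exact: span0.
rewrite mulrDr; apply: spanD => //.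
by rewrite mulrACA -monomialD //; apply: span_monomial; [exact: subringM | exact: h].
Qed.

Lemma span_subring H : H 0 -> (forall e e', H e -> H e' -> H (e + e')) ->
  is_subring (span H).
Proof.
move=> h0 hD; split; first by rewrite -(monomial0 x); exact: span_monomial1.
move=> f g sf sg; split; last exact: spanM sf sg.
by apply: spanD => //; exact: spanN.
Qed.

Lemma span_sub (Q : F -> Prop) H f : is_subring Q -> (forall c, D c -> Q c) ->
  (forall e, H e -> Q (mon e)) -> span H f -> Q f.
Proof.
move=> Qr DQ HQ; elim=> [|c e g dc he _ IH]; first exact: subring0.
by apply: subringD => //; apply: subringM; auto.
Qed.

Lemma span_sum H f : span H f -> exists (s : seq 'cV[int]_N) (c : 'cV[int]_N -> F),
  [/\ uniq s, forall e, D (c e), forall e, e \in s -> H e & f = \sum_(e <- s) c e * mon e].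
Proof.
elim=> [|c e g dc he _ [s [d [us dd hs ->]]]].
  by exists [::], (fun _ => 0); rewrite big_nil; split.
case: (boolP (e \in s)) => es.
  exists s, (fun e' => if e' == e then c + d e else d e'); split=> //.
    by move=> e'; case: eqP => _ //; exact: subringD.
  rewrite !(bigD1_seq e) //= eqxx mulrDl -addrA; congr (_ + (_ + _)).
  by apply: eq_bigr => e' /negbTE ->.
exists (e :: s), (fun e' => if e' == e then c else d e'); split=> //=.
- by rewrite es.
- by move=> e'; case: eqP.
- by move=> e'; rewrite inE => /orP [/eqP ->|/hs].
- rewrite big_cons eqxx; congr (_ + _); apply: eq_big_seq => e' es'.
  by case: eqP es' es => // -> ->.
Qed.

End Span.

Section Free.
Variables (D : F -> Prop) (x : 'I_N -> F).
Hypothesis Dring : is_subring D.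
Hypothesis x0 : forall r, x r != 0.
Hypothesis xfree : free D x.
Local Notation span := (Span D x).
Local Notation mon := (monomial x).

Lemma sum_span D' H (s : seq 'cV[int]_N) (c : 'cV[int]_N -> F) :
  (forall e, D' (c e)) -> (forall e, e \in s -> c e != 0 -> H e) ->
  Span D' x H (\sum_(e <- s) c e * mon e).
Proof.
move=> dc; elim: s => [|e s IH] h; first by rewrite big_nil; constructor.
have h' e' : e' \in s -> c e' != 0 -> H e' by move=> es; apply: h; rewrite inE es orbT.
rewrite big_cons; have [->|ce] := eqVneq (c e) 0; first by rewrite mul0r add0r; exact: IH.
by constructor; [exact: dc | apply: h => //; rewrite inE eqxx | exact: IH].
Qed.

Lemma sum_extend (s S : seq 'cV[int]_N) (g : 'cV[int]_N -> F) :
  uniq s -> uniq S -> {subset s <= S} ->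
  \sum_(e <- S) (if e \in s then g e else 0) = \sum_(e <- s) g e.
Proof.
move=> us uS sub; rewrite -big_mkcond -big_filter; apply: perm_big.
apply: uniq_perm => //; first exact: filter_uniq.
by move=> e; rewrite mem_filter; case: (boolP (e \in s)) => // /sub.
Qed.

(** By freeness the two expansions have the same coefficients, so that conditions on exponents and
    on coefficients combine. With D' the integers, this shows that the coefficients of a known
    expansion are integral. *)
Lemma span_inter D' H H' f : is_subring D' -> (forall c, D' c -> D c) ->
  span H f -> Span D' x H' f ->
  Span D' x (fun e => H e /\ H' e) f.
Proof.
move=> D'ring D'D /(span_sum Dring) [s [c [us dc hs ef]]].
move=> /(span_sum D'ring) [s' [c' [us' dc' hs' ef']]].
pose S := undup (s ++ s').
(* The difference of the two coefficients, an absent exponent counting as 0. *)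
pose C e := (if e \in s then c e else 0) - (if e \in s' then c' e else 0).
have sumS : \sum_(e <- S) C e * mon e = 0.
  rewrite (eq_bigr (fun e => (if e \in s then c e * mon e else 0)
      + - (if e \in s' then c' e * mon e else 0))); last first.
    move=> e _; rewrite /C mulrBl; congr (_ - _).
      by case: ifP => _ //; rewrite mul0r.
    by case: ifP => _ //; rewrite mul0r.
  rewrite big_split sumrN /= !sum_extend ?undup_uniq // -?ef -?ef' ?subrr //.
    by move=> e es; rewrite mem_undup mem_cat es orbT.
  by move=> e es; rewrite mem_undup mem_cat es.
have DC e : D (C e).
  apply: subringB => //; case: ifP => _; rewrite ?subring0 //; try exact: subring0.
  exact: D'D.
have h := xfree (undup_uniq _) DC sumS.
rewrite ef'; apply: sum_span => // e es' ce; split; last exact: hs'.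
apply: hs; apply: contraNT ce => es; have : C e = 0.
  by apply: h; rewrite mem_undup mem_cat es' orbT.
by rewrite /C (negbTE es) es' sub0r => /eqP; rewrite oppr_eq0.
Qed.

Lemma span_disjoint H H' f g : (forall e, H e -> H' e -> False) ->
  span H f -> span H' g -> f = g -> f = 0.
Proof.
move=> h sf sg efg; rewrite -efg in sg.
have := span_inter Dring (fun c dc => dc) sf sg.
by elim=> // c e k _ [he he'] _ _; case: (h e).
Qed.

End Free.

End LaurentSpan.

(** * Rings of fractions R[1/q] *)

Section Fractions.
Variable F : fieldType.
Implicit Types (R : F -> Prop) (p q f : F).

Definition fractions R q f := exists k : nat, R (f * q ^+ k).

Lemma fractions_sub R q f : R f -> fractions R q f.
Proof. by move=> rf; exists 0%N; rewrite expr0 mulr1. Qed.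

Lemma fractions_subring R q : is_subring R -> R q -> is_subring (fractions R q).
Proof.
move=> Rr rq; split; first by apply: fractions_sub; exact: subring1.
move=> f g [k rf] [l rg]; split; exists (k + l)%N; rewrite exprD.
  rewrite mulrBl mulrA (mulrC (q ^+ k)) mulrA.
  by apply: subringB => //; apply: subringM => //; exact: subringX.
by rewrite mulrACA; exact: subringM.
Qed.

Lemma fractions_inv R q : is_subring R -> q != 0 -> fractions R q q^-1.
Proof. by move=> Rr q0; exists 1%N; rewrite mulVf //; exact: subring1. Qed.

(* A denominator that is both a power of p and a power of q is trivial. *)
Lemma fractions_inter R p q f : is_subring R -> prime_in R p -> R q ->
  ~ divides_in R p q -> fractions R p f -> fractions R q f -> R f.
Proof.
move=> Rr pp rq npq [k rk] [l rl]; have [rp p0 np hp] := pp.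
elim: k rk => [|k IH] rk; first by rewrite expr0 mulr1 in rk.
apply: IH; have rq' := subringX Rr l rq.
have : divides_in R p (f * p ^+ k.+1 * q ^+ l).
  exists (f * q ^+ l * p ^+ k); last by rewrite exprS; ring.
  by apply: subringM => //; exact: subringX.
case/(hp _ _ rk rq') => [[g rg e]|/(prime_not_dividesX Rr pp rq npq) //].
by rewrite (_ : f * p ^+ k = g) //; apply: (mulfI p0); rewrite -e exprS; ring.
Qed.

Lemma fractions_localization R q : is_subring R -> R q -> q != 0 ->
  localization_of R (fractions R q) (fun s => exists k, s = q ^+ k).
Proof.
move=> Rr rq q0; split=> //.
- exact: fractions_subring.
- exact: fractions_sub.
- move=> _ [k ->]; have rk := subringX Rr k rq; split=> //; split; first exact: fractions_sub.
  by exists (q ^+ k)^-1; rewrite ?divff ?expf_neq0 //; exists k; rewrite mulVf ?expf_neq0 //;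
    exact: subring1.
- by move=> f [k rk]; exists (q ^+ k); [exists k|].
Qed.

Lemma prime_mul_invertible R u p : is_subring R -> invertible_in R u ->
  prime_in R p -> prime_in R (u * p).
Proof.
move=> Rr iu [rp p0 np hp]; have u0 := invertible_neq0 iu.
have [ru [v rv euv]] := iu.
have aux x : divides_in R (u * p) x <-> divides_in R p x.
  split=> [[q rq ->]|[q rq ->]].
    by exists (u * q); [exact: subringM | ring].
  exists (v * q); first exact: subringM.
  rewrite [RHS](_ : _ = u * v * (p * q)); last by ring.
  by rewrite euv mul1r.
split; [exact: subringM | by rewrite mulf_neq0 | | ].
  by rewrite mulrC => /(invertible_factor Rr rp ru).
by move=> a b ra rb; rewrite !aux; exact: hp.
Qed.

End Fractions.

(** * Polynomials in one transcendental element *)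

Section OneVariable.
Variable F : fieldType.
Implicit Types (c : F) (p q : {poly F}).
Variables (W : F -> Prop) (y : F).
Hypothesis Wring : is_subring W.

Definition polys f := exists2 p : {poly F}, (forall i, W p`_i) & f = p.[y].

Definition transcendental := forall p : {poly F}, (forall i, W p`_i) -> p.[y] = 0 -> p = 0.

Let overW (p : {poly F}) := forall i, W p`_i.

Let overM p q : overW p -> overW q -> overW (p * q).
Proof.
by move=> wp wq i; rewrite coefM; apply: subring_sum => // j _; exact: subringM.
Qed.

Let overB p q : overW p -> overW q -> overW (p - q).
Proof. by move=> wp wq i; rewrite coefB; exact: subringB. Qed.

Let overC c : W c -> overW c%:P.
Proof. by move=> wc i; rewrite coefC; case: eqP => _ //; exact: subring0. Qed.

Let overX : overW 'X.
Proof. by move=> i; rewrite coefX; exact: subring_nat. Qed.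

Lemma polys_const c : W c -> polys c.
Proof. by move=> wc; exists c%:P; [exact: overC | rewrite hornerC]. Qed.

Lemma polys_var : polys y.
Proof. by exists 'X; [exact: overX | rewrite hornerX]. Qed.

Lemma polys_subring : is_subring polys.
Proof.
split; first by apply: polys_const; exact: subring1.
move=> _ _ [p wp ->] [q wq ->]; split.
  by exists (p - q); [exact: overB | rewrite hornerD hornerN].
by exists (p * q); [exact: overM | rewrite hornerM].
Qed.

Lemma horner_over c p : W c -> overW p -> W p.[c].
Proof.
move=> wc wp; rewrite horner_coef; apply: subring_sum => // i _.
by apply: subringM => //; exact: subringX.
Qed.

(** Horner's scheme: X - c is monic, so the quotient keeps its coefficients in [W]. *)
Lemma factor_over c p : W c -> overW p -> exists2 q, overW q & p = q * ('X - c%:P) + p.[c]%:P.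
Proof.
move=> wc; elim/poly_ind: p => [|p d IH] wp.
  exists 0; first by move=> i; rewrite coef0; exact: subring0.
  by rewrite mul0r horner0 add0r.
have [|q wq eq] := IH; first by move=> i; have := wp i.+1; rewrite coefD coefMX coefC addr0.
exists (q * 'X + p.[c]%:P).
  move=> i; rewrite coefD coefMX coefC; case: i => [|i] /=; rewrite ?add0r ?addr0 //.
  apply: horner_over => // i; by have := wp i.+1; rewrite coefD coefMX coefC addr0.
rewrite hornerMXaddC polyCD polyCM {1}eq; ring.
Qed.

Hypothesis ytrans : transcendental.

Lemma transcendental_inj p q : overW p -> overW q -> p.[y] = q.[y] -> p = q.
Proof.
move=> wp wq e; apply/eqP; rewrite -subr_eq0; apply/eqP/ytrans; first exact: overB.
by rewrite hornerD hornerN e subrr.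
Qed.

Lemma divides_linear c p : W c -> overW p -> divides_in polys (y - c) p.[y] <-> p.[c] = 0.
Proof.
move=> wc wp; split=> [[_ [q wq ->] e]|e].
  have -> : p = ('X - c%:P) * q.
    apply: transcendental_inj => //; first by apply: overM => //; apply: overB;
      [exact: overX|exact: overC].
    by rewrite hornerM hornerXsubC.
  by rewrite hornerM hornerXsubC subrr mul0r.
have [q wq eq] := factor_over wc wp; exists q.[y]; first by exists q.
by rewrite eq e addr0 hornerM hornerXsubC mulrC.
Qed.

(** Divisibility by y - c is vanishing at c, and the values at c lie in a field. *)
Lemma prime_linear c : W c -> prime_in polys (y - c).
Proof.
move=> wc; have wXc : overW ('X - c%:P) by apply: overB; [exact: overX|exact: overC].
have eXc : y - c = ('X - c%:P).[y] by rewrite hornerXsubC.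
split.
- by exists ('X - c%:P).
- apply/negP => /eqP h; have : 'X - c%:P = 0 by apply: ytrans; rewrite // -eXc.
  by apply/eqP; rewrite polyXsubC_eq0.
- move=> [_ [q rq e]]; have : divides_in polys (y - c) (1%:P : {poly F}).[y].
    by exists q => //; rewrite hornerC -e.
  rewrite divides_linear //; last by apply: overC; exact: subring1.
  by apply/eqP; rewrite hornerC oner_eq0.
- move=> _ _ [p wp ->] [q wq ->]; rewrite -hornerM !divides_linear //; last exact: overM.
  by rewrite hornerM => /eqP; rewrite mulf_eq0 => /orP [] /eqP; [left|right].
Qed.

End OneVariable.

Lemma pred_ext (T : Type) (P Q : T -> Prop) : (forall x, P x <-> Q x) -> P = Q.
Proof.
by move=> h; apply: functional_extensionality => x; apply: propositional_extensionality.
Qed.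

(** * Gradings of a Laurent ring by an integer weight *)

Section Grading.
Variables (F : fieldType) (N : nat) (D : F -> Prop) (x : 'I_N -> F).
Hypothesis Dring : is_subring D.
Hypothesis x0 : forall r, x r != 0.
Hypothesis xfree : free D x.
Variables (l : 'cV[int]_N -> int) (a : 'cV[int]_N).
Hypothesis lD : {morph l : e e' / e + e'}.
Hypothesis la : l a = 1.
Local Notation mon := (monomial x).
Let y := mon a.
Let W := Span D x (fun e => l e = 0).
Local Notation nonneg := (Span D x (fun e => 0 <= l e)).
Local Notation laurent := (Span D x (@all_exponents N)).

Let l0 : l 0 = 0.
Proof. by apply: (addrI (l 0)); rewrite -lD !addr0. Qed.

Let lN e : l (- e) = - l e.
Proof. by apply: (addrI (l e)); rewrite -lD !subrr. Qed.

Let lMn k e : l (e *+ k) = l e *+ k.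
Proof. by elim: k => [|k IH]; rewrite ?mulr0n // !mulrS lD IH. Qed.

Let Wring : is_subring W.
Proof. by apply: span_subring => // e e' he he'; rewrite lD he he'. Qed.

Let nnring : is_subring nonneg.
Proof. by apply: span_subring; rewrite ?l0 // => e e' he he'; rewrite lD addr_ge0. Qed.

Lemma laurent_subring : is_subring laurent.
Proof. exact: span_subring. Qed.

Let D_W c : D c -> W c.
Proof. by move=> dc; rewrite -[c]mulr1 -(monomial0 x); apply: span_monomial. Qed.

Let y0 : y != 0. Proof. exact: monomial_neq0. Qed.

(** Since a has weight 1, subtracting l e copies of a from e leaves an exponent of weight 0. *)
Lemma nonneg_polys : nonneg = polys W y.
Proof.
apply: pred_ext => f; split.
  apply: span_sub => [|c dc|e le]; first exact: polys_subring.
    by apply: polys_const => //; exact: D_W.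
  have -> : e = (e - a *+ `|l e|%N) + a *+ `|l e|%N by rewrite subrK.
  rewrite monomialD // monomialMn //; apply: subringM; first exact: polys_subring.
    apply: polys_const => //; apply: span_monomial1 => //.
    by rewrite lD lN lMn la natz abszE ger0_norm // subrr.
  by apply: subringX; [exact: polys_subring | exact: polys_var].
move=> [p wp ->]; rewrite horner_coef; apply: subring_sum => // i _.
apply: subringM => //; first by apply: span_mono (wp i) => // e ->.
by apply: subringX => //; apply: span_monomial1 => //; rewrite la.
Qed.

(** The i-th term of [p.[y]] is homogeneous of weight i, so terms of different degrees cannot
    cancel. *)
Lemma monomial_transcendental : transcendental W y.
Proof.
move=> p wp ep; apply/polyP => i; rewrite coef0.
case: (ltnP i (size p)) => hi; last by rewrite nth_default.
have layer j H : H j%:Z -> Span D x (fun e => H (l e)) (p`_j * y ^+ j).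
  move=> hj; apply: (spanM _ _ _ (wp j)); first exact: Dring.
  - exact: x0.
  - move=> e e' he he'; rewrite lD he add0r; exact: he'.
  - rewrite /y -monomialMn //; apply: span_monomial1 => //.
    by rewrite lMn la natz.
have z : p`_i * y ^+ i = 0.
  apply: (span_disjoint Dring xfree (H := fun e => l e = i%:Z) (H' := fun e => l e != i%:Z)).
  - by move=> e ->; rewrite eqxx.
  - exact: (layer i (fun k => k = i%:Z)).
  - have : Span D x (fun e => l e != i%:Z) (- \sum_(j < size p | j != i :> nat) p`_j * y ^+ j).
      apply: spanN => //; apply: big_ind; [constructor | exact: spanD | ].
      by move=> j ji; apply: (layer j (fun k => k != i%:Z)).
    exact.
  - apply/eqP; rewrite -addr_eq0; move: ep.
    by rewrite horner_coef (bigD1 (Ordinal hi)) //= => ->.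
by move/eqP: z; rewrite mulf_eq0 expf_eq0 (negbTE y0) andbF orbF => /eqP.
Qed.

Lemma prime_linear_nonneg c : W c -> prime_in nonneg (y - c).
Proof. by move=> wc; rewrite nonneg_polys; apply: prime_linear => //;
  exact: monomial_transcendental. Qed.

Lemma laurent_fractions : laurent = fractions nonneg y.
Proof.
have y_nn : nonneg y by apply: span_monomial1 => //; rewrite la.
apply: pred_ext => f; split.
  apply: span_sub => [|c dc|e _].
  - exact: fractions_subring.
  - by apply: fractions_sub; apply: span_mono (D_W dc) => // e ->.
  - exists `|l e|%N; rewrite /y -monomialMn // -monomialD //; apply: span_monomial1 => //.
    by rewrite lD lMn la natz; lia.
move=> [k sk]; rewrite (_ : f = (f * y ^+ k) * mon (- (a *+ k))); last first.
  by rewrite monomialN // monomialMn // mulfK // expf_neq0.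
apply: subringM; first exact: laurent_subring.
  by apply: span_mono sk.
exact: span_monomial1.
Qed.

(** 1 + y is y - c for c = -1, hence prime in W[y]. It divides no power of y, because (-1)^k is not
    0, and so it stays prime when y is inverted. *)
Lemma prime_binomial : prime_in laurent (1 + y).
Proof.
have y_nn : nonneg y by apply: span_monomial1 => //; rewrite la.
have w1 : W (-1) by apply: subringN => //; exact: subring1.
rewrite laurent_fractions.
apply: (prime_localization (fractions_localization nnring y_nn y0)).
  by rewrite addrC -[X in y + X]opprK; exact: prime_linear_nonneg.
move=> _ [k ->]; have wX i : W ('X^k : {poly F})`_i by rewrite coefXn; exact: subring_nat.
rewrite addrC -[X in y + X]opprK nonneg_polys.
have -> : y ^+ k = ('X^k).[y] by rewrite hornerXn.
rewrite divides_linear //; last exact: monomial_transcendental.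
by rewrite hornerXn => /eqP; rewrite expf_eq0 oppr_eq0 oner_eq0 andbF.
Qed.

(* Evaluating at y = -1 leaves 1 + (-1)^(l e) times a monomial. *)
Lemma binomial_not_divides e : divides_in laurent (1 + y) (1 + mon e) -> e = a *~ l e.
Proof.
rewrite laurent_fractions => [] [g [k gk] eg].
pose h : 'cV[int]_N := e - a *~ l e.
have lMz z : l (a *~ z) = z.
  by case: z => n; rewrite ?NegzE ?mulrNz ?lN -pmulrn lMn la natz.
have lh : l h = 0 by rewrite lD lN lMz subrr.
(* The power y^m clears the denominator y^k of the quotient and makes the exponent m + l e
   non-negative. *)
pose m := (k + `|l e|)%N; pose j := `|(m%:Z + l e)%R|%N.
have jE : j%:Z = m%:Z + l e by rewrite /j abszE ger0_norm // /m; lia.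
have wh : W (mon h) by exact: span_monomial1.
pose p : {poly F} := 'X^m + mon h *: 'X^j.
have wp i : W p`_i.
  rewrite coefD coefZ !coefXn; apply: subringD => //; first exact: subring_nat.
  by apply: subringM => //; exact: subring_nat.
have ep : p.[y] = (1 + mon e) * y ^+ m.
  rewrite hornerD hornerZ !hornerXn mulrDl mul1r; congr (_ + _).
  rewrite /y -!monomialMn // -!monomialD //; congr (monomial x _).
  by rewrite /h !pmulrn jE mulrzDr addrACA addNr addr0.
have : divides_in (polys W y) (y - (-1)) p.[y].
  exists (g * y ^+ m); last by rewrite ep eg opprK; ring.
  rewrite -nonneg_polys /m exprD mulrA; apply: subringM => //.
  by rewrite -monomialMn //; apply: span_monomial1 => //; rewrite lMn la natz.
rewrite divides_linear //; [|exact: monomial_transcendental|by apply: subringN => //;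
  exact: subring1].
rewrite hornerD hornerZ !hornerXn => e0.
apply/eqP; rewrite -subr_eq0; apply/negPn/negP => h0.
have sgnD i : D ((-1) ^+ i) by apply: subringX => //; apply: subringN => //; exact: subring1.
have : mon h * (-1) ^+ j = 0.
  apply: (span_disjoint Dring xfree (H := fun e => e = h) (H' := fun e =>
    e = 0) (g := - (-1) ^+ m)).
  - by move=> e' -> h0'; rewrite /h in h0'; rewrite h0' eqxx in h0.
  - by rewrite mulrC; apply: span_monomial.
  - rewrite -[- _]mulr1 -[X in _ * X](monomial0 x); apply: span_monomial => //.
    by apply: subringN => //; exact: sgnD.
  - by apply/eqP; rewrite -addr_eq0 addrC e0.
by apply/eqP; rewrite mulf_neq0 ?monomial_neq0 // expf_neq0 // oppr_eq0 oner_eq0.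
Qed.

(** Cleared of denominators, f and its inverse become polynomials p and q in y whose product is a
    power of X; hence p is a monomial. *)
Lemma invertible_homogeneous f : invertible_in laurent f ->
  exists s, Span D x (fun e => l e = s) f.
Proof.
rewrite laurent_fractions nonneg_polys => [] [[k [p wp ep]] [g [m [q wq eq]] efg]].
have : p * q = 'X^(k + m).
  apply: (transcendental_inj Wring monomial_transcendental).
  - by move=> i; rewrite coefM; apply: subring_sum => // j _; exact: subringM.
  - by move=> i; rewrite coefXn; exact: subring_nat.
  by rewrite hornerM -ep -eq hornerXn exprD mulrACA efg mul1r.
move=> epq; have : p %| ('X - 0%:P) ^+ (k + m) by rewrite subr0 -epq dvdp_mulr.
move=> /dvdp_exp_XsubCP [j _]; rewrite subr0 => /eqpf_eq [c c0 ec].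
exists (j%:Z - k%:Z).
(* The divisors of a power of X were found over the whole field F; that c lies in [W] is read off
   the coefficients of p. *)
have wc : W c by have := wp j; rewrite ec coefZ coefXn eqxx mulr1.
have -> : f = c * mon (a *+ j - a *+ k).
  rewrite monomialD // monomialN // !monomialMn // -/y mulrA.
  apply: (mulIf (expf_neq0 k y0)); rewrite ep ec hornerZ hornerXn mulfVK //.
  by rewrite expf_neq0.
have sm : Span D x (fun e => l e = j%:Z - k%:Z) (mon (a *+ j - a *+ k)).
  by apply: span_monomial1 => //; rewrite lD lN !lMn la !natz.
by apply: (spanM Dring x0 _ wc sm) => e e' he he'; rewrite lD he he' add0r.
Qed.

End Grading.

Definition pos_part N (a : 'cV[int]_N) : 'cV[int]_N := \col_r Num.max (a r 0) 0.

(* mxE leaves the entries at convertible but distinct types, which lia does not identify. *)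
Section Entries.
Variable N : nat.
Implicit Types (a b : 'cV[int]_N) (r : 'I_N).

Lemma entryD a b r : (a + b) r 0 = a r 0 + b r 0. Proof. exact: mxE. Qed.
Lemma entryN a r : (- a) r 0 = - a r 0. Proof. exact: mxE. Qed.
Lemma entry0 r : (0 : 'cV[int]_N) r 0 = 0. Proof. exact: mxE. Qed.
Lemma entryMn a k r : (a *+ k) r 0 = a r 0 * k%:Z.
Proof. by rewrite mulmxnE -mulr_natr natz. Qed.
Lemma entry_var r r' : var r r' 0 = (r' == r)%:Z.
Proof. by rewrite mxE eqxx andbT natz. Qed.
Lemma entry_pos a r : pos_part a r 0 = Num.max (a r 0) 0. Proof. exact: mxE. Qed.

End Entries.

Ltac entries := rewrite ?(entryD, entryN, entry0, entryMn, entry_var, entry_pos).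

(** * Units, primes and factoriality of a Laurent ring *)

Section LaurentRing.
Variables (F : fieldType) (N : nat) (D : F -> Prop) (x : 'I_N -> F).
Hypothesis Dring : is_subring D.
Hypothesis x0 : forall r, x r != 0.
Hypothesis xfree : free D x.
Local Notation mon := (monomial x).
Local Notation laurent := (Span D x (@all_exponents N)).

Lemma coordD r : {morph (fun e : 'cV[int]_N => e r 0) : e e' / e + e'}.
Proof. by move=> e e'; rewrite mxE. Qed.

Lemma coord_var (r : 'I_N) : var r r 0 = 1.
Proof. by rewrite mxE !eqxx. Qed.

Lemma span_single e f : Span D x (fun e' => e' = e) f -> exists2 c, D c & f = c * mon e.
Proof.
elim=> [|c e' g dc -> _ [c' dc' ->]]; first by exists 0; rewrite ?mul0r //; exact: subring0.
by exists (c + c'); rewrite ?mulrDl //; exact: subringD.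
Qed.

(** Homogeneity for each of the N coordinate weights leaves a single exponent. The inverse has the
    same shape, and freeness forces the two exponents to be opposite. *)
Lemma laurent_invertible f : invertible_in laurent f ->
  exists e c, invertible_in D c /\ f = c * mon e.
Proof.
have single g : invertible_in laurent g -> exists e c, D c /\ g = c * mon e.
  move=> ig.
  have [e0 he0] : exists e0 : 'cV[int]_N,
      Span D x (fun e => forall r, r \in enum 'I_N -> e r 0 = e0 r 0) g.
    elim: (enum 'I_N) => [|r rs [e0 he0]].
      by exists 0; apply: span_mono (proj1 ig).
    have [s hs] := invertible_homogeneous Dring x0 xfree (coordD r) (coord_var r) ig.
    exists (\col_i (if i == r then s else e0 i 0)).
    apply: span_mono (span_inter Dring xfree Dring (fun c dc => dc) he0 hs) => e [h1 h2] i.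
    by rewrite mxE inE; case: eqP => [->|_ /h1].
  have /span_single [c dc ->] : Span D x (fun e => e = e0) g.
    apply: span_mono he0 => e h; apply/colP => i; apply: h; exact: mem_enum.
  by exists e0, c.
move=> inv_f; have [e [c [dc ef]]] := single f inv_f; exists e, c; split=> //; split=> //.
have [lf [g lg efg]] := inv_f.
have [e' [c' [dc' eg]]] : exists e c, D c /\ g = c * mon e.
  by apply: single; split=> //; exists f; rewrite // mulrC.
exists c' => //; have e1 : c * c' * mon (e + e') = 1.
  by rewrite monomialD // mulrACA -ef -eg.
suff h : e + e' = 0 by rewrite h monomial0 mulr1 in e1.
apply/eqP/negPn/negP => h.
suff : c * c' * mon (e + e') = 0 by apply/eqP; rewrite e1 oner_eq0.
apply: (span_disjoint Dring xfree (H := fun a => a = e + e') (H' := fun a =>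
  a = 0) (g := 1)) => //.
- by move=> a -> /eqP; rewrite (negbTE h).
- by apply: span_monomial => //; exact: subringM.
- by rewrite -(monomial0 x); exact: span_monomial1.
Qed.

Lemma prime_var r : prime_in (Span D x (fun e => 0 <= e r 0)) (x r).
Proof.
rewrite -[x r]subr0 -[X in X - 0](monomial_var x r).
apply: (prime_linear_nonneg Dring x0 xfree (coordD r) (coord_var r)).
constructor.
Qed.

(** The Bezout form of gcd 1: w is the weight of value 1 at a that the gradings require. *)
Definition primitive_vector (a : 'cV[int]_N) := exists w : 'I_N -> int, \sum_r w r * a r 0 = 1.

(** For a column of the extended exchange matrix, with the Z_i among the variables, this is the
    exchange binomial ([exchange_binomialE]). *)
Definition binomial a := mon (pos_part a) + mon (pos_part (- a)).

Lemma binomialN a : binomial (- a) = binomial a.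
Proof. by rewrite /binomial opprK addrC. Qed.

Lemma binomialE a : binomial a = mon (pos_part (- a)) * (1 + mon a).
Proof.
rewrite mulrDr mulr1 addrC -monomialD //; congr (monomial x _ + _).
by apply/colP => r; entries; lia.
Qed.

Lemma monomial_invertible e : invertible_in laurent (mon e).
Proof.
split; first exact: span_monomial1.
exists (mon (- e)); first exact: span_monomial1.
by rewrite monomialN // divff // monomial_neq0.
Qed.

Section Primitive.
Variable a : 'cV[int]_N.
Variable w : 'I_N -> int.
Hypothesis wa : \sum_r w r * a r 0 = 1.

Let weightD : {morph (fun e : 'cV[int]_N => \sum_r w r * e r 0) : e e' / e + e'}.
Proof. by move=> e e'; rewrite -big_split; apply: eq_bigr => r _; rewrite mxE mulrDr. Qed.

Lemma binomial_prime : prime_in laurent (binomial a).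
Proof.
rewrite binomialE; apply: prime_mul_invertible; first exact: laurent_subring.
  exact: monomial_invertible.
exact: (prime_binomial Dring x0 xfree weightD wa).
Qed.

Lemma binomial_divides b : divides_in laurent (binomial a) (binomial b) ->
  exists k : int, b = a *~ k.
Proof.
have Lr := laurent_subring Dring x0.
move=> [q dq e]; exists (\sum_r w r * b r 0).
apply: (binomial_not_divides Dring x0 xfree weightD wa).
exists (mon (pos_part (- a)) * q * mon (- pos_part (- b))).
  by apply: subringM => //; [apply: subringM => //|]; exact: span_monomial1.
have := e; rewrite !binomialE => {}e.
apply: (mulfI (monomial_neq0 x0 (pos_part (- b)))); rewrite e monomialN //.
have := monomial_neq0 x0 (pos_part (- b)); set u := mon (pos_part _) => u0.
by field.
Qed.

End Primitive.

Section Factorial.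
Variables (K : idomainType) (phi : {rmorphism K -> F}).
Hypothesis phi_inj : injective phi.
Hypothesis phiD : forall c, D c <-> exists k, c = phi k.
Hypothesis Kpf : prime_factorial (fun _ : K => True).

Let Hle k (e : 'cV[int]_N) := (forall r, 0 <= e r 0) /\ (forall r : 'I_N, (k <= r)%N ->
  e r 0 = 0).

Let Hle0 k : Hle k 0. Proof. by split=> r; rewrite mxE. Qed.
Let HleD k e e' : Hle k e -> Hle k e' -> Hle k (e + e').
Proof.
move=> [h1 h2] [h1' h2']; split=> r; rewrite mxE; first by rewrite addr_ge0.
by move=> kr; rewrite h2 // h2'.
Qed.

(** [poly_prime_factorial] speaks of a polynomial ring as a type, so the polynomials in the first k
    variables are modelled by a type, built as [{poly R}] one variable at a time. *)
Lemma span_nonneg_model k : (k <= N)%N ->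
  exists (R : idomainType) (psi : {rmorphism R -> F}),
    [/\ injective psi, prime_factorial (fun _ : R => True)
      & forall f, Span D x (Hle k) f <-> exists r, f = psi r].
Proof.
elim: k => [|k IH] hk.
  exists K, phi; split=> // f; rewrite -phiD; split; last first.
    by move=> df; rewrite -[f]mulr1 -(monomial0 x); exact: span_monomial.
  elim=> [|c e g dc [_ h] _ dg]; first exact: subring0.
  suff -> : e = 0 by rewrite monomial0 mulr1; exact: subringD.
  by apply/colP => r; rewrite h // mxE.
have [R [psi [inj Rpf hR]]] := IH (ltnW hk).
pose r0 := Ordinal hk; pose y := x r0.
pose psi' : {rmorphism {poly R} -> F} := horner_morph (fun z => mulrC y (psi z)).
have psi'E p : psi' p = (map_poly psi p).[y] by [].
have ytrans : transcendental (Span D x (Hle k)) y.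
  move=> p hp; rewrite /y -(monomial_var x r0).
  apply: (monomial_transcendental Dring x0 xfree (coordD r0) (coord_var r0)) => i.
  by apply: span_mono (hp i) => e [_]; apply; exact: leqnn.
have psi'_polys f : (exists p, f = psi' p) <-> polys (Span D x (Hle k)) y f.
  split=> [[p ->]|[p hp ->]].
    by exists (map_poly psi p) => // i; rewrite coef_map; apply/hR; exists p`_i.
  have /(_ _)/hR hp' := hp.
  have [c hc] : exists c : nat -> R, forall i, p`_i = psi (c i).
    by exists (fun i => proj1_sig (constructive_indefinite_description _ (hp' i))) => i;
      case: constructive_indefinite_description.
  exists (\poly_(i < size p) c i); rewrite psi'E; congr (_.[y]); apply/polyP => i.
  rewrite coef_map coef_poly; case: ltnP => h; first exact: hc.
  by rewrite nth_default //; apply/esym/rmorph0.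
exists {poly R}, psi'; split.
- have inj0 p : psi' p = 0 -> p = 0.
    move=> e; apply: (map_inj_poly inj (rmorph0 _)); rewrite rmorph0.
    by apply: ytrans => // i; rewrite coef_map; apply/hR; exists p`_i.
  by move=> p q e; apply/eqP; rewrite -subr_eq0; apply/eqP/inj0; rewrite rmorphB e subrr.
- exact: poly_prime_factorial.
- move=> f; rewrite psi'_polys.
  have sk : is_subring (Span D x (Hle k)) by apply: span_subring => //; exact: HleD.
  split.
    apply: span_sub => [|c dc|e [h1 h2]]; first exact: polys_subring.
      by apply: polys_const => //; rewrite -[c]mulr1 -(monomial0 x); exact: span_monomial.
    have -> : e = (e - var r0 *+ `|(e r0 0)%R|%N) + var r0 *+ `|(e r0 0)%R|%N by rewrite subrK.
    rewrite monomialD // monomialMn // monomial_var; apply: subringM;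
      first exact: polys_subring.
      apply: polys_const => //; apply: span_monomial1 => //.
      have h3 r : (e - var r0 *+ `|(e r0 0)%R|%N) r 0 = if r == r0 then 0 else e r 0.
        have := h1 r0; entries; case: eqP => [->|_] /=; lia.
      split=> r; rewrite h3; case: eqP => // /eqP r0r kr; apply: h2.
      by rewrite ltn_neqAle kr andbT; apply: contra r0r => /eqP e1; apply/eqP/val_inj.
    by apply: subringX; [exact: polys_subring|exact: polys_var].
  move=> [p hp ->]; rewrite horner_coef.
  have sk' : is_subring (Span D x (Hle k.+1)) by apply: span_subring => //; exact: HleD.
  apply: subring_sum => // i _; apply: subringM => //.
    by apply: span_mono (hp i) => e [h1 h2]; split=> // r /ltnW; exact: h2.
  apply: subringX => //; rewrite /y -(monomial_var x r0); apply: span_monomial1 => //.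
  split=> r; rewrite entry_var; first by case: eqP.
  by case: eqP => //= ->; rewrite ltnn.
Qed.

Lemma laurent_prime_factorial : prime_factorial laurent.
Proof.
have [R [psi [inj Rpf hR]]] := span_nonneg_model (leqnn N).
have pfN : prime_factorial (Span D x (Hle N)).
  rewrite (_ : Span D x (Hle N) = image_of psi (fun _ => True)).
    exact/(prime_factorial_image inj).
  by apply: pred_ext => f; rewrite hR; split=> [[r ->]|[r _ ->]]; exists r.
apply: (@prime_factorial_localization _ (Span D x (Hle N)) _ (fun s =>
  exists2 e, Hle N e & s = mon e)) => //.
split.
- by apply: span_subring => //; exact: HleD.
- exact: laurent_subring.
- by move=> f; apply: span_mono.
- move=> _ [e he ->]; split; first exact: span_monomial1.
  exact: monomial_invertible.
- move=> f; elim=> [|c e g dc _ _ [_ [e' he' ->] hg]].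
    by exists 1; [exists 0; rewrite ?monomial0|rewrite mul0r; constructor].
  exists (mon (pos_part (- e) + e')).
    exists (pos_part (- e) + e') => //; apply: HleD => //; split=> r.
      by entries; lia.
    by rewrite leqNgt ltn_ord.
  have sk : is_subring (Span D x (Hle N)) by apply: span_subring => //; exact: HleD.
  rewrite mulrDl; apply: subringD => //.
    rewrite -mulrA -monomialD //; apply: span_monomial => //; split=> r.
      by have [/(_ r)] := he'; entries; lia.
    by rewrite leqNgt ltn_ord.
  rewrite addrC monomialD // mulrA; apply: subringM => //; apply: span_monomial1 => //.
  by split=> r; [entries; lia | rewrite leqNgt ltn_ord].
Qed.

End Factorial.
End LaurentRing.

(** * Exchanges *)

Section Exchange.
Variables (F : fieldType) (N : nat).
Implicit Types (x y : 'I_N -> F) (a c e : 'cV[int]_N).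

(** [c k 0 = 0] keeps the k-th variable out of the binomial, which thus has the same value in x and
    in y; this makes the relation symmetric. *)
Definition exchange (k : 'I_N) c x y :=
  [/\ c k 0 = 0, forall r, r != k -> y r = x r & y k * x k = binomial x c].

Lemma eq_binomial k c x y : c k 0 = 0 -> (forall r, r != k -> y r = x r) ->
  binomial x c = binomial y c.
Proof.
move=> ck xy; congr (_ + _); apply: eq_monomial => r; entries.
  by move=> h; rewrite xy //; apply: contraNneq h => ->; rewrite ck.
by move=> h; rewrite xy //; apply: contraNneq h => ->; rewrite ck.
Qed.

Lemma exchange_sym k c x y : exchange k c x y -> exchange k c y x.
Proof.
move=> [ck xy e]; split=> // [r rk|]; first by rewrite xy //.
by rewrite mulrC e; exact: eq_binomial ck xy.
Qed.

Definition reflect_at (k : 'I_N) e : 'cV[int]_N := \col_r (if r == k then - e r 0 else e r 0).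

Lemma entry_reflect k e r : reflect_at k e r 0 = if r == k then - e r 0 else e r 0.
Proof. exact: mxE. Qed.

(** The substitution y_k = P / x_k, with P the exchange binomial. *)
Lemma monomial_exchange k c x y e : (forall r, x r != 0) -> exchange k c x y ->
  monomial y e = binomial x c ^ (e k 0) * monomial x (reflect_at k e).
Proof.
move=> x0 [_ xy ek]; rewrite /monomial (bigD1 k) //= [in RHS](bigD1 k) //= mulrA.
congr (_ * _); last first.
  by apply: eq_bigr => r rk; rewrite entry_reflect (negbTE rk) xy.
by rewrite entry_reflect eqxx -ek expfzMl -mulrA -expfzDr // subrr expr0z mulr1.
Qed.

Section Starfish.
Variable D : F -> Prop.
Hypothesis Dring : is_subring D.
Local Notation laurent x := (Span D x (@all_exponents N)).

Section Adjacent.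
Variables (k : 'I_N) (c : 'cV[int]_N) (x y : 'I_N -> F).
Hypothesis x0 : forall r, x r != 0.
Hypothesis y0 : forall r, y r != 0.
Hypothesis xfree : free D x.
Hypothesis xy : exchange k c x y.
Local Notation P := (binomial x c).

Lemma exchange_binomial_neq0 : P != 0.
Proof. by case: xy => _ _ <-; rewrite mulf_neq0. Qed.

Lemma exchange_binomial_span (H : 'cV[int]_N -> Prop) : H (pos_part c) ->
  H (pos_part (- c)) -> Span D x H P.
Proof. by move=> h1 h2; apply: spanD => //; exact: span_monomial1. Qed.

Let ck : c k 0 = 0. Proof. by case: xy. Qed.

Let PX_span (m : nat) : Span D x (fun e => e k 0 = 0) (P ^+ m).
Proof.
apply: subringX; first by apply: span_subring => // [|e e' he he']; entries; rewrite ?he ?he'.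
by apply: exchange_binomial_span; rewrite entry_pos ?entryN ck.
Qed.

(** A positive power of y_k is a power of P times a negative power of x_k, and P does not involve
    x_k. *)
Lemma span_pos_exchange f : Span D y (fun e => 0 < e k 0) f -> Span D x (fun e => e k 0 < 0) f.
Proof.
elim=> [|d e g dd he _ IH]; first by constructor.
apply: spanD => //; rewrite (monomial_exchange e x0 xy) mulrCA.
have -> : P ^ e k 0 = P ^+ `|(e k 0)%R|%N by rewrite exprnP abszE gtr0_norm.
have hm : Span D x (fun e => e k 0 < 0) (d * monomial x (reflect_at k e)).
  by apply: span_monomial => //; rewrite entry_reflect eqxx oppr_lt0.
by apply: (spanM Dring x0 _ (PX_span _) hm) => e1 e2 h1 h2; rewrite entryD h1 add0r.
Qed.

(** Negative powers of y_k put P into the denominator; as there are finitely many terms, one power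
    of P clears them all. *)
Lemma span_npos_exchange f : Span D y (fun e => e k 0 <= 0) f ->
  exists m : nat, Span D x (fun e => 0 <= e k 0) (f * P ^+ m).
Proof.
have nn (m : nat) : Span D x (fun e => 0 <= e k 0) (P ^+ m).
  by apply: span_mono (PX_span m) => e ->.
pose nonneg (e : 'cV[int]_N) : Prop := 0 <= e k 0.
have addnn e e' : nonneg e -> nonneg e' -> nonneg (e + e').
  by rewrite /nonneg entryD; exact: addr_ge0.
elim=> [|d e g dd he _ [m hm]]; first by exists 0%N; rewrite mul0r; constructor.
exists (`|(e k 0)%R|%N + m)%N; rewrite mulrDl; apply: spanD; last first.
  by rewrite exprD mulrCA; exact: (spanM Dring x0 addnn (nn _) hm).
rewrite exprD mulrA.
suff hs : Span D x (fun e => 0 <= e k 0) (d * monomial y e * P ^+ `|(e k 0)%R|%N).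
  exact: (spanM Dring x0 addnn hs (nn m)).
have -> : d * monomial y e * P ^+ `|(e k 0)%R|%N = d * monomial x (reflect_at k e).
  rewrite (monomial_exchange e x0 xy) -!mulrA; congr (_ * _).
  rewrite mulrCA -[RHS]mulr1; congr (_ * _).
  rewrite exprnP abszE ler0_norm // -expfzDr ?exchange_binomial_neq0 //.
  by rewrite addrN expr0z.
by apply: span_monomial => //; rewrite entry_reflect eqxx oppr_ge0.
Qed.

Lemma span_split (z : 'I_N -> F) (H : 'cV[int]_N -> bool) f : laurent z f ->
  exists g h, [/\ Span D z H g, Span D z (fun e => ~~ H e) h & f = g + h].
Proof.
elim=> [|d e f' dd _ _ [g [h [hg hh ->]]]].
  by exists 0, 0; rewrite addr0; split=> //; constructor.
case: (boolP (H e)) => he; last first.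
  exists g, (d * monomial z e + h); split=> //; first by constructor.
  by rewrite addrCA.
exists (d * monomial z e + g), h; split=> //; first by constructor.
by rewrite addrA.
Qed.

(* In both rings, split f by the sign of the exponent of the exchanged variable:
   the two parts that are singular at x k coincide, as they do after
   multiplication by a power of P. *)
Lemma laurent_inter f : laurent x f -> laurent y f -> exists g h,
  [/\ Span D x (fun e => 0 <= e k 0) g, Span D y (fun e => 0 <= e k 0) h & f = g + h].
Proof.
move=> /(span_split (fun e => 0 <= e k 0)) [g [h [hg hh ef]]].
move=> /(span_split (fun e => e k 0 <= 0)) [g' [h' [hg' hh' ef']]].
have pos_h' : Span D y (fun e => 0 < e k 0) h'.
  by apply: span_mono hh' => e; rewrite ltNge.
exists g, h'; split=> //; first by apply: span_mono pos_h' => e /ltW.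
rewrite ef; congr (_ + _); apply/eqP; rewrite -subr_eq0; apply/eqP.
have [m hm] := span_npos_exchange hg'.
have Pm0 : P ^+ m != 0 by rewrite expf_neq0 // exchange_binomial_neq0.
apply: (mulIf Pm0); rewrite mul0r.
apply: (span_disjoint Dring xfree (H := fun e => e k 0 < 0) (H' := fun e => 0 <= e k 0)
  (g := g' * P ^+ m - g * P ^+ m)).
- by move=> e h1 h2; lia.
- have hhh' : Span D x (fun e => e k 0 < 0) (h - h').
    apply: spanD => //; first by apply: span_mono hh => e; rewrite ltNge.
    by apply: spanN => //; exact: span_pos_exchange.
  by apply: (spanM Dring x0 _ hhh' (PX_span m)) => e e' h1 h2; rewrite entryD h2 addr0.
- apply: spanD => //; apply: spanN => //; apply: (spanM Dring x0 _ hg (PX_span m)).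
  by move=> e e' h1 h2; rewrite entryD h2 addr0.
- rewrite -mulrBl; congr (_ * _).
  have e2 : g + h = g' + h' by rewrite -ef ef'.
  transitivity (g + h - g - h'); first by ring.
  by rewrite e2; ring.
Qed.

End Adjacent.

End Starfish.
End Exchange.

(** * The starfish lemma along one edge of the tree *)

Section StarfishStep.
Variables (F : fieldType) (N : nat) (D : F -> Prop).
Hypothesis Dring : is_subring D.
Implicit Types (a b c e : 'cV[int]_N).
Local Notation laurent x := (Span D x (@all_exponents N)).

(* Matrix mutation in direction k, column-wise: c is the k-th column, a another
   one, and a' the mutation of a. *)
Definition mutated_column (k : 'I_N) c a a' :=
  a' k 0 = - a k 0 /\
  forall r, r != k ->
    a' r 0 = a r 0 + a k 0 * Num.max (if 0 <= a k 0 then c r 0 else - c r 0) 0.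

Section Step.
Variables (j k : 'I_N) (x x1 x2 : 'I_N -> F) (a a' c : 'cV[int]_N).
Hypothesis jk : j != k.
Hypothesis x_neq0 : forall r, x r != 0.
Hypothesis x1_neq0 : forall r, x1 r != 0.
Hypothesis x2_neq0 : forall r, x2 r != 0.
Hypothesis exch1 : exchange k c x x1.
Hypothesis exch2 : exchange j a' x1 x2.
Local Notation P := (binomial x2 a').

Let Rring := laurent_subring Dring x2_neq0.

Let ck : c k 0 = 0. Proof. by case: exch1. Qed.
Let aj' : a' j 0 = 0. Proof. by case: exch2. Qed.

Let P1 : binomial x1 a' = P.
Proof. by case: exch2 => h1 h2 _; exact: eq_binomial h1 h2. Qed.

Lemma monomial_step e : e j 0 = 0 -> e k 0 = 0 -> monomial x e = monomial x2 e.
Proof.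
move=> ej ek; apply: eq_monomial => r er.
have rk : r != k by apply: contraNneq er => ->; rewrite ek.
have rj : r != j by apply: contraNneq er => ->; rewrite ej.
by case: exch1 => _ h1 _; case: exch2 => _ h2 _; rewrite h2 // h1.
Qed.

Let monomial_12 e : e j 0 = 0 -> monomial x1 e = monomial x2 e.
Proof.
move=> ej; apply: eq_monomial => r er.
have rj : r != j by apply: contraNneq er => ->; rewrite ej.
by case: exch2 => _ h2 _; rewrite h2.
Qed.

Let mon2 e : laurent x2 (monomial x2 e). Proof. exact: span_monomial1. Qed.

Let P_span : laurent x2 P.
Proof. by apply: spanD => //. Qed.

Let monomial1_nonneg e : 0 <= e j 0 ->
  exists2 r, laurent x2 r & monomial x1 e = P ^+ `|(e j 0)%R|%N * r.
Proof.
move=> ej; exists (monomial x2 (reflect_at j e)) => //.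
rewrite (monomial_exchange e x2_neq0 (exchange_sym exch2)); congr (_ * _).
by rewrite exprnP abszE ger0_norm.
Qed.

Let monomial1_pos e : 0 < e j 0 -> divides_in (laurent x2) P (monomial x1 e).
Proof.
move=> ej; have [r hr ->] := monomial1_nonneg (ltW ej).
have -> : `|(e j 0)%R|%N = (`|(e j 0)%R|%N.-1).+1 by lia.
exists (P ^+ (`|(e j 0)%R|%N.-1) * r); last by rewrite exprS mulrA.
by apply: subringM => //; exact: subringX.
Qed.

(* monomial x a = monomial x2 a' * (1 + m) ^ b, where m is divisible by x1 j and
   thus by P; as 1 + monomial x2 a' is P up to a unit, P divides 1 + monomial x a. *)
Lemma binomial_congruence : a j 0 = 0 -> 0 < a k 0 -> c j 0 < 0 -> mutated_column k c a a' ->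
  divides_in (laurent x2) P (binomial x a).
Proof.
move=> aj ak cj [ak' ar'].
pose m := monomial x1 (- c).
have [m' hm' em] : divides_in (laurent x2) P m.
  by apply: monomial1_pos; rewrite entryN oppr_gt0.
have hm : laurent x2 m by rewrite em; exact: subringM.
have [b eb] : exists b : nat, a k 0 = b%:Z by exists `|(a k 0)%R|%N; lia.
have [t ht et] : exists2 t, laurent x2 t & (1 + m) ^+ b = 1 + m * t.
  elim: (b) => [|i [t ht et]]; first by exists 0; [constructor|rewrite expr0 mulr0 addr0].
  exists (1 + t + m * t); last by rewrite exprS et; ring.
  apply: subringD => //; last exact: subringM.
  by apply: subringD => //; exact: subring1.
have ea : monomial x a = monomial x2 a' * (1 + m * t).
  rewrite (monomial_exchange a x1_neq0 (exchange_sym exch1)) -binomialN binomialE // opprK.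
  rewrite eb -exprnP exprMn -et mulrAC; congr (_ * _).
  rewrite -monomialMn // -monomialD // -monomial_12 //; congr (monomial x1 _).
  apply/colP => r; rewrite entryD entryMn entry_pos entry_reflect.
  case: (eqVneq r k) => [->|rk]; first by rewrite ck maxxx mul0r add0r ak'.
  by rewrite ar' // eb /= ; lia.
rewrite [binomial x a]binomialE // ea monomial_step; first last.
- by rewrite entry_pos entryN; lia.
- by rewrite entry_pos entryN aj.
have e1 : 1 + monomial x2 a' = P * monomial x2 (- pos_part (- a')).
  by rewrite binomialE // monomialN // mulrAC divff ?mul1r // monomial_neq0.
exists (monomial x2 (pos_part (- a)) * (monomial x2 (- pos_part (- a')) + monomial x2 a' * m'
  * t)).
  apply: subringM => //; apply: subringD => //; apply: subringM => //.
  exact: subringM.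
rewrite (_ : 1 + _ = 1 + monomial x2 a' + monomial x2 a' * m * t); last by ring.
by rewrite e1 em; ring.
Qed.

End Step.

(** Reduces a negative k-th entry to a positive one, as a binomial does not see the sign of its
    exponent vector. *)
Lemma mutated_columnN k c a a' : a k 0 != 0 -> mutated_column k c a a' ->
  mutated_column k (- c) (- a) (- a').
Proof.
move=> ak [h1 h2]; split=> [|r rk]; first by rewrite !entryN h1.
by rewrite !entryN h2 //; case: (lerP 0 (a k 0)); case: (lerP 0 (- a k 0)); lia.
Qed.

Lemma mutated_column0 k c a a' : a k 0 = 0 -> mutated_column k c a a' -> a' = a.
Proof.
move=> ak [h1 h2]; apply/colP => r; case: (eqVneq r k) => [->|rk].
  by rewrite h1 ak oppr0.
by rewrite h2 // ak mul0r addr0.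
Qed.

Lemma exchangeN k c (x y : 'I_N -> F) : exchange k c x y -> exchange k (- c) x y.
Proof. by move=> [h1 h2 h3]; split=> //; [rewrite entryN h1 oppr0 | rewrite binomialN]. Qed.

Section Starfish.
Variables (j k : 'I_N) (x xj x1 x2 : 'I_N -> F) (a a' c : 'cV[int]_N).
Hypothesis jk : j != k.
Hypothesis x_neq0 : forall r, x r != 0.
Hypothesis xj_neq0 : forall r, xj r != 0.
Hypothesis x1_neq0 : forall r, x1 r != 0.
Hypothesis x2_neq0 : forall r, x2 r != 0.
Hypothesis x_free : free D x.
Hypothesis x2_free : free D x2.
Hypothesis exch1 : exchange k c x x1.
Hypothesis exch2 : exchange j a' x1 x2.
Hypothesis exchj : exchange j a x xj.
Hypothesis mutation : mutated_column k c a a'.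
Hypothesis sign_skew : a k 0 = 0 /\ c j 0 = 0 \/ a k 0 * c j 0 < 0.
Hypothesis a'_primitive : primitive_vector a'.
Hypothesis a'_indep : c j 0 = 0 -> forall z : int, c <> a' *~ z.
Local Notation P := (binomial x2 a').
Local Notation R := (laurent x2).

Let Rring := laurent_subring Dring x2_neq0.
Let ck : c k 0 = 0. Proof. by case: exch1. Qed.
Let aj' : a' j 0 = 0. Proof. by case: exch2. Qed.
Let aj : a j 0 = 0. Proof. by case: exchj. Qed.
Let P1 : binomial x1 a' = P.
Proof. by case: exch2 => h1 h2 _; exact: eq_binomial h1 h2. Qed.
Let mon2 e : R (monomial x2 e). Proof. exact: span_monomial1. Qed.
Let P_prime : prime_in R P.
Proof. by case: a'_primitive => w hw; exact: binomial_prime hw. Qed.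
Let P_span : R P. Proof. by case: P_prime. Qed.

(** If a_k = 0, mutation at k leaves the column alone and the two binomials agree. Otherwise
    [binomial_congruence] applies, after a change of all signs when a_k < 0. *)
Lemma exchange_numerator_divides : divides_in R P (binomial x a).
Proof.
case: sign_skew => [[ak cj]|acj].
  have aa := mutated_column0 ak mutation; exists 1; first exact: subring1.
  rewrite mulr1 aa /binomial; congr (_ + _); apply: (monomial_step exch1 exch2).
  - by rewrite entry_pos aj.
  - by rewrite entry_pos ak.
  - by rewrite entry_pos entryN aj.
  - by rewrite entry_pos entryN ak.
case: (ltrP 0 (a k 0)) => ak.
  by apply: (binomial_congruence jk x_neq0 x1_neq0 x2_neq0 exch1 exch2) => //; nia.
have {}ak : a k 0 < 0.
  by rewrite lt_neqAle ak andbT; apply/eqP => h; rewrite h mul0r in acj.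
rewrite -binomialN -[binomial x a]binomialN.
apply: (binomial_congruence jk x_neq0 x1_neq0 x2_neq0 (exchangeN exch1) (exchangeN exch2)) =>
  //.
- by rewrite entryN aj.
- by rewrite entryN oppr_gt0.
- by rewrite entryN oppr_lt0 -(nmulr_rlt0 _ ak).
- by apply: mutated_columnN => //; apply/eqP => h; rewrite h mul0r in acj.
Qed.

Let x1E : x1 j = P * monomial x2 (- var j).
Proof.
case: exch2 => _ _; rewrite P1 => <-.
by rewrite monomialN // monomial_var mulrAC divff ?mul1r.
Qed.

Let xE : x j = x1 j. Proof. by case: exch1 => _ h _; rewrite h. Qed.

Lemma old_variable_span : R (x j).
Proof. by rewrite xE x1E; exact: subringM. Qed.

(** xj_j is [binomial x a] divided by x_j = P / x2_j, so the point is that P divides this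
    numerator. *)
Lemma exchanged_variable_span : R (xj j).
Proof.
have [g hg eg] := exchange_numerator_divides.
have [_ _ exj] := exchj.
have -> : xj j = g * x2 j; last by apply: subringM => //; rewrite -(monomial_var x2).
apply: (mulIf (x_neq0 j)); rewrite exj eg mulrAC -[x2 j](monomial_var x2) xE x1E.
rewrite monomialN // mulrA -[RHS]mulrA.
by field; exact: monomial_neq0.
Qed.

(** If c_j is not 0, exactly one term contains x1_j, and with it P, while the other is a unit. If
    c_j = 0, P divides the binomial only if c is a multiple of a', which [a'_indep] excludes. *)
Let binomial_c : R (binomial x c) /\ ~ divides_in R P (binomial x c).
Proof.
have [_ h1 _] := exch1; rewrite (eq_binomial ck h1).
have strict c' : c' j 0 < 0 -> R (binomial x1 c') /\ ~ divides_in R P (binomial x1 c').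
  move=> cj.
  have e1 : monomial x1 (pos_part c') = monomial x2 (pos_part c').
    apply: eq_monomial => r; rewrite entry_pos => h.
    by have [_ h2 _] := exch2; rewrite h2 //; apply: contraNneq h => ->; lia.
  have [q hq e2] : divides_in R P (monomial x1 (pos_part (- c'))).
    rewrite (monomial_exchange _ x2_neq0 (exchange_sym exch2)).
    rewrite entry_pos entryN (_ : Num.max (- c' j 0) 0 = (`|(c' j 0)%R|%N.-1).+1%:Z);
      last by lia.
    rewrite -exprnP exprS; exists (P ^+ `|(c' j 0)%R|%N.-1 * monomial x2 (reflect_at j
      (pos_part (- c')))).
      by apply: subringM => //; exact: subringX.
    by rewrite mulrA.
  rewrite /binomial e1 e2; split.
    by apply: subringD => //; exact: subringM.
  move=> [q' hq' e].
  have : divides_in R P (monomial x2 (pos_part c')).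
    by exists (q' - q); [exact: subringB | rewrite mulrBr -e addrK].
  move=> /(divides_invertible Rring P_span) /(_ (monomial_invertible Dring x2_neq0 _)).
  by case: P_prime.
case: (ltrgtP (c j 0) 0) => cj.
- exact: strict.
- by rewrite -binomialN; apply: strict; rewrite entryN oppr_lt0.
- have [_ h2 _] := exch2; rewrite (eq_binomial cj h2); split.
    by apply: subringD.
  have [w hw] := a'_primitive.
  by move=> /(binomial_divides Dring x2_neq0 x2_free hw) [z /(a'_indep cj)].
Qed.

Let x2k : x2 k = x1 k. Proof. by case: exch2 => _ h _; rewrite h // eq_sym. Qed.

Let xkE : x k = binomial x c * monomial x2 (- var k).
Proof.
case: exch1 => _ _ <-; rewrite -x2k monomialN // monomial_var.
by rewrite mulrAC divff ?mul1r.
Qed.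

Let xk_span : R (x k). Proof. by rewrite xkE; apply: subringM => //; case: binomial_c. Qed.

Let xk_ndiv : ~ divides_in R P (x k).
Proof.
move=> [q hq e]; apply: (proj2 binomial_c); exists (q * x2 k).
  by apply: subringM => //; rewrite -(monomial_var x2).
by case: exch1 => _ _ <-; rewrite -x2k e; ring.
Qed.

(** Used for y = x and y = xj. The j-th variable is never inverted and the variables other than the
    j-th and k-th are units of R, so x_k is the only denominator. *)
Let fractions_gen y f : (forall r, r != j -> r != k -> y r = x2 r) -> y k = x k -> R (y j) ->
  Span D y (fun e => 0 <= e j 0) f -> fractions R (x k) f.
Proof.
move=> hy yk yj.
have fr := fractions_subring Rring xk_span.
apply: span_sub => // [d dd|e ej].
  by apply: fractions_sub; rewrite -[d]mulr1 -(monomial0 x2); exact: span_monomial.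
apply: subring_prod => // r _.
case: (eqVneq r j) => [->|rj].
  have -> : y j ^ e j 0 = y j ^+ `|(e j 0)%R|%N by rewrite exprnP abszE ger0_norm.
  by apply: subringX => //; exact: fractions_sub.
case: (eqVneq r k) => [->|rk].
  rewrite yk; case: (e k 0) => n; first by rewrite -exprnP; apply: subringX => //;
    exact: fractions_sub.
  by rewrite NegzE -exprz_inv -exprnP; apply: subringX => //; exact: fractions_inv.
apply: fractions_sub; rewrite hy //.
rewrite (_ : x2 r ^ e r 0 = monomial x2 (\col_i (if i == r then e r 0 else 0))) //.
rewrite /monomial (bigD1 r) //= mxE eqxx big1 ?mulr1 // => i ir.
by rewrite mxE (negbTE ir) expr0z.
Qed.

(* P is a prime of laurent x2 that does not divide x k; f becomes an element of
   laurent x2 both after inverting P, by means of x1, and after inverting x k, by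
   means of x and xj. *)
Lemma starfish_step f : laurent x f -> laurent xj f -> laurent x1 f -> laurent x2 f.
Proof.
move=> fx fxj fx1.
have Pfr := fractions_subring Rring P_span.
have P0 : P != 0 by case: P_prime.
have fP : fractions R P f.
  apply: span_sub fx1 => // [d dd|e _].
    by apply: fractions_sub; rewrite -[d]mulr1 -(monomial0 x2); exact: span_monomial.
  rewrite (monomial_exchange e x2_neq0 (exchange_sym exch2)).
  apply: subringM => //; last exact: fractions_sub.
  case: (e j 0) => n; first by rewrite -exprnP; apply: subringX => //; exact: fractions_sub.
  by rewrite NegzE -exprz_inv -exprnP; apply: subringX => //; exact: fractions_inv.
apply: (fractions_inter Rring P_prime xk_span xk_ndiv fP).
have [g [h [hg hh ->]]] := laurent_inter Dring x_neq0 xj_neq0 x_free exchj fx fxj.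
have hx r : r != j -> r != k -> x r = x2 r.
  by move=> rj rk; case: exch1 => _ h1 _; case: exch2 => _ h2 _; rewrite h2 // h1.
apply: subringD; first exact: fractions_subring.
  exact: fractions_gen hx _ old_variable_span hg.
apply: fractions_gen hh => //.
- by move=> r rj rk; case: exchj => _ h1 _; rewrite h1 // hx.
- by case: exchj => _ h1 _; rewrite h1 // eq_sym.
- exact: exchanged_variable_span.
Qed.

End Starfish.

(** * Multiplicity of a frozen variable under an exchange *)

Section FrozenValuation.
Variables (k z : 'I_N) (x y : 'I_N -> F) (c : 'cV[int]_N).
Hypothesis zk : z != k.
Hypothesis x_neq0 : forall r, x r != 0.
Hypothesis y_neq0 : forall r, y r != 0.
Hypothesis y_free : free D y.
Hypothesis exch : exchange k c x y.
Local Notation R := (Span D y (fun e => 0 <= e z 0)).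

(* y_z does not divide the exchange binomial, so its multiplicity in an element
   is the same in both Laurent rings. *)
Lemma frozen_valuation (s : int) f : laurent y f ->
  Span D x (fun e => s <= e z 0) f -> Span D y (fun e => s <= e z 0) f.
Proof.
move=> fy fx.
have Rring : is_subring R.
  by apply: span_subring => // [|e e' h h']; entries => //; exact: addr_ge0.
pose P := binomial y c.
have [ck h1 e1] := exch.
have P0 : P != 0 by rewrite /P -(eq_binomial ck h1) -e1 mulf_neq0.
have hP : R P.
  by apply: spanD => //; apply: span_monomial1 => //; entries; lia.
have yz_prime := prime_var Dring y_neq0 y_free z.
have ndiv : ~ divides_in R (y z) P.
  move=> [q hq e].
  have hq' : Span D y (fun e => 1 <= e z 0) P.
    rewrite e; have hy : Span D y (fun e => e z 0 = 1) (y z).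
      by rewrite -(monomial_var y z); apply: span_monomial1 => //; entries; rewrite eqxx.
    by apply: (spanM Dring y_neq0 _ hy hq) => e2 e3 h2 h3; rewrite entryD h2 lerDl.
  (* If z occurs in the binomial, one term has z-exponent 0 and the other a positive one, so the sum
     is not divisible by y_z. *)
  have strict c' : 0 < c' z 0 -> binomial y c' = P -> False.
    move=> cz ec; suff : monomial y (pos_part (- c')) = 0.
      by apply/eqP; exact: monomial_neq0.
    apply: (span_disjoint Dring y_free (H := fun e => e z 0 = 0) (H' := fun e => 1 <= e z 0)
      (g := P - monomial y (pos_part c'))).
    - by move=> e2 ->.
    - by apply: span_monomial1 => //; entries; lia.
    - by apply: spanD => //; apply: spanN => //; apply: span_monomial1 => //; entries; lia.
    - by rewrite -ec /binomial addrC addKr.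
  case: (ltrgtP (c z 0) 0) => cz.
  - by apply: (strict (- c)); rewrite ?binomialN // entryN oppr_gt0.
  - exact: (strict c).
  - suff : P = 0 by apply/eqP.
    apply: (span_disjoint Dring y_free (H := fun e => e z 0 = 0) _ _ hq') => //.
      by move=> e2 ->.
    by apply: spanD => //; apply: span_monomial1 => //; entries; rewrite cz.
(* Multiplication by y_z^(-s) reduces the bound s to the bound 0. *)
pose e0 : 'cV[int]_N := \col_i (if i == z then - s else 0).
have e0z : e0 z 0 = - s by rewrite mxE eqxx.
have e0xy : monomial x e0 = monomial y e0.
  by apply: eq_monomial => r; rewrite mxE; case: (eqVneq r z) => [-> _|_]; rewrite ?eqxx // h1.
have Pfr := fractions_subring Rring hP.
have f0P : fractions R P (f * monomial y e0).
  have : Span D x (fun e => 0 <= e z 0) (f * monomial y e0).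
    have he0 : Span D x (fun e => e z 0 = - s) (monomial y e0).
      by rewrite -e0xy; exact: span_monomial1.
    by apply: (spanM Dring x_neq0 _ fx he0) => e2 e3 h2 h3; rewrite entryD h3 subr_ge0.
  apply: span_sub => // [d dd|e ez].
    by apply: fractions_sub; rewrite -[d]mulr1 -(monomial0 y); apply: span_monomial => //;
      rewrite entry0.
  rewrite (monomial_exchange e y_neq0 (exchange_sym exch)) -/P; apply: subringM => //.
    case: (e k 0) => n; first by rewrite -exprnP; apply: subringX => //; exact: fractions_sub.
    by rewrite NegzE -exprz_inv -exprnP; apply: subringX => //; exact: fractions_inv.
  by apply: fractions_sub; apply: span_monomial1 => //; rewrite entry_reflect (negbTE zk).
(* Inverting y_z in R gives the whole Laurent ring. *)
have f0z : fractions R (y z) (f * monomial y e0).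
  have := laurent_fractions Dring y_neq0 (coordD z) (coord_var z).
  rewrite monomial_var => <-; apply: subringM => //; first exact: laurent_subring.
  exact: span_monomial1.
have h0 := fractions_inter Rring yz_prime hP ndiv f0z f0P.
have -> : f = f * monomial y e0 * monomial y (- e0).
  by rewrite monomialN // mulfK // monomial_neq0.
have he0 : Span D y (fun e => e z 0 = s) (monomial y (- e0)).
  by apply: span_monomial1 => //; rewrite entryN e0z opprK.
by apply: (spanM Dring y_neq0 _ h0 he0) => e2 e3 h2 h3; rewrite entryD h3 lerDr.
Qed.

End FrozenValuation.

End StarfishStep.

(** * Seeds *)

Section AdjoinRings.
Variables (F : fieldType) (S : F -> Prop).
Hypothesis Sring : is_subring S.
Variables (k : nat) (x : 'I_k -> F).
Implicit Types (p q : {mpoly F[k]}) (Q : F -> Prop).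

Lemma adjoin_sub Q f : is_subring Q -> (forall c, S c -> Q c) -> (forall i, Q (x i)) ->
  adjoin S x f -> Q f.
Proof.
move=> Qr SQ Qx [p sp ->]; rewrite mevalE; apply: subring_sum => // e _.
apply: subringM => //; first exact: SQ.
by apply: subring_prod => // i _; exact: subringX.
Qed.

Lemma adjoin_const c : S c -> adjoin S x c.
Proof.
move=> sc; exists c%:MP; last by rewrite mevalC.
move=> e; rewrite mcoeffC; apply: subringM => //; exact: subring_nat.
Qed.

Lemma adjoin_var i : adjoin S x (x i).
Proof.
exists 'X_i; last by rewrite mevalXU.
by move=> e; rewrite mcoeffX; exact: subring_nat.
Qed.

Lemma adjoin_subring : is_subring (adjoin S x).
Proof.
split; first by apply: adjoin_const; exact: subring1.
move=> _ _ [p sp ->] [q sq ->]; split.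
  by exists (p - q); [move=> e; rewrite mcoeffB; exact: subringB | rewrite mevalB].
exists (p * q); last by rewrite mevalM.
by move=> e; rewrite mcoeffM; apply: subring_sum => // i _; exact: subringM.
Qed.

Lemma adjoin_laurent_sub Q f : is_subring Q -> (forall c, S c -> Q c) ->
  (forall i, Q (x i)) -> (forall i, Q (x i)^-1) -> adjoin_laurent S x f -> Q f.
Proof.
move=> Qr SQ Qx Qxi [p sp [e ->]]; apply: subringM => //; first exact: adjoin_sub sp.
rewrite -prodfV; apply: subring_prod => // i _.
by rewrite -exprVn; exact: subringX.
Qed.

Lemma adjoin_laurent_adjoin f : adjoin S x f -> adjoin_laurent S x f.
Proof. by exists f => //; exists (fun _ => 0%N); rewrite big1 ?divr1. Qed.

Hypothesis x_neq0 : forall i, x i != 0.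

Lemma adjoin_laurent_inv i : adjoin_laurent S x (x i)^-1.
Proof.
exists 1; first by apply: subring1; exact: adjoin_subring.
exists (fun r => (r == i) : nat); rewrite (bigD1 i) //= eqxx expr1 big1 ?mulr1 ?div1r //.
by move=> r /negbTE ->.
Qed.

Lemma adjoin_laurent_subring : is_subring (adjoin_laurent S x).
Proof.
have ar := adjoin_subring.
have ax (e : 'I_k -> nat) : adjoin S x (\prod_i x i ^+ e i).
  by apply: subring_prod => // i _; apply: subringX => //; exact: adjoin_var.
have x0 (e : 'I_k -> nat) : \prod_i x i ^+ e i != 0.
  by apply/prodf_neq0 => i _; rewrite expf_neq0.
have xD (e e' : 'I_k -> nat) : \prod_i x i ^+ (e i + e' i) =
  \prod_i x i ^+ e i * \prod_i x i ^+ e' i.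
  by rewrite -big_split; apply: eq_bigr => i _; rewrite exprD.
split; first by apply: adjoin_laurent_adjoin; exact: subring1.
move=> _ _ [p sp [e ->]] [q sq [e' ->]]; split.
  exists (p * \prod_i x i ^+ e' i - q * \prod_i x i ^+ e i).
    by apply: subringB => //; exact: subringM.
  by exists (fun i => e i + e' i)%N; rewrite xD; field; rewrite !x0.
exists (p * q); first exact: subringM.
by exists (fun i => e i + e' i)%N; rewrite xD; field; rewrite !x0.
Qed.

(** Multiplication by a large common power of all variables turns the finitely many integer
    exponents, injectively, into exponents of a polynomial. *)
Lemma free_monomials : (forall p, (forall e, S p@_e) -> p.@[x] = 0 -> p = 0) -> free S x.
Proof.
move=> alg s c us Sc e0.
have [M hM] : exists M : nat, forall e, e \in s -> forall i, 0 <= (e : 'cV[int]_k) i 0 + M%:Z.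
  elim: (s) => [|e s' [M hM]]; first by exists 0%N.
  exists (M + \sum_i `|(e i 0)%R|)%N => e'; rewrite inE => /orP [/eqP ->|/hM h] i.
    have hB : (`|(e i 0)%R| <= M + \sum_i `|(e i 0)%R|)%N by rewrite (bigD1 i) //= addnCA
      leq_addr.
    by rewrite -(opprK (e i 0)) addrC subr_ge0 (le_trans (ler_norm _)) // normrN -abszE lez_nat.
  by rewrite PoszD addrA addr_ge0.
pose mn (e : 'cV[int]_k) : 'X_{1..k} := [multinom `|(e i 0 + M%:Z)%R|%N | i < k].
pose p : {mpoly F[k]} := \sum_(e <- s) c e *: 'X_[mn e].
have mn_inj e e' : e \in s -> e' \in s -> mn e = mn e' -> e = e'.
  move=> es es' h; apply/colP => i; have := congr1 (fun m : 'X_{1..k} => m i) h.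
  by rewrite !mnmE => /(congr1 Posz); rewrite !abszE !ger0_norm ?hM // => /addIr.
have coefp u : p@_u = \sum_(e <- s) c e * (mn e == u)%:R.
  by rewrite /p raddf_sum; apply: eq_bigr => e _; rewrite /= mcoeffZ mcoeffX.
have p0 : p = 0.
  apply: alg.
    by move=> u; rewrite coefp; apply: subring_sum => // e _; apply: subringM => //;
      exact: subring_nat.
  rewrite /p raddf_sum /= (eq_big_seq (fun e => \prod_i x i ^+ M * (c e * monomial x e))).
    by rewrite -big_distrr /= e0 mulr0.
  move=> e es; rewrite mevalZ mevalX mulrCA; congr (_ * _).
  rewrite -big_split; apply: eq_bigr => i _ /=.
  rewrite mnmE exprnP abszE ger0_norm ?hM // exprnP mulrC -expfzDr //.
move=> e es; have := coefp (mn e); rewrite p0 mcoeff0 (bigD1_seq e) //= eqxx mulr1.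
rewrite big_seq_cond big1 ?addr0 // => e' /andP [es' ne].
case: eqP => [/(mn_inj e' e es' es) h|_]; last by rewrite mulr0.
by rewrite h eqxx in ne.
Qed.

End AdjoinRings.

Lemma monomial_in (F : fieldType) (Q : F -> Prop) k (x : 'I_k -> F) (e : 'cV[int]_k) :
  is_subring Q -> (forall r, 0 < e r 0 -> Q (x r)) -> (forall r, e r 0 < 0 -> Q (x r)^-1) ->
  Q (monomial x e).
Proof.
move=> Qr Q1 Q2; apply: subring_prod => // r _.
case: (ltrgtP (e r 0) 0) => h; last by rewrite h expr0z; exact: subring1.
  have -> : x r ^ e r 0 = (x r)^-1 ^+ `|(e r 0)%R|%N.
    by rewrite exprnP abszE ltr0_norm // exprz_inv opprK.
  by apply: subringX => //; exact: Q2.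
have -> : x r ^ e r 0 = x r ^+ `|(e r 0)%R|%N by rewrite exprnP abszE gtr0_norm.
by apply: subringX => //; exact: Q1.
Qed.

Section TwoBlocks.
Variables (F : fieldType) (S : F -> Prop) (n m : nat) (A : 'I_n -> F) (Z : 'I_m -> F).
Hypothesis Sring : is_subring S.
Hypothesis A_neq0 : forall i, A i != 0.
Hypothesis Z_neq0 : forall z, Z z != 0.

Definition two_blocks (r : 'I_(n + m)) : F :=
  match split r with inl i => A i | inr z => Z z end.

Lemma two_blocks_l i : two_blocks (lshift m i) = A i.
Proof. by rewrite /two_blocks (unsplitK (inl i)). Qed.

Lemma two_blocks_r z : two_blocks (rshift n z) = Z z.
Proof. by rewrite /two_blocks (unsplitK (inr z)). Qed.

Lemma two_blocks_neq0 r : two_blocks r != 0.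
Proof. by rewrite /two_blocks; case: split. Qed.

Lemma monomial_two_blocks e :
  monomial two_blocks e = monomial A (usubmx e) * monomial Z (dsubmx e).
Proof.
rewrite /monomial big_split_ord; congr (_ * _); apply: eq_bigr => i _.
  by rewrite two_blocks_l mxE.
by rewrite two_blocks_r mxE.
Qed.

Let SZ := adjoin S Z.
Let SZL := adjoin_laurent S Z.
Let SZring : is_subring SZ. Proof. exact: adjoin_subring. Qed.
Let SZLring : is_subring SZL. Proof. exact: adjoin_laurent_subring. Qed.
Let SZL_S c : S c -> SZL c.
Proof. by move=> sc; apply: adjoin_laurent_adjoin; exact: adjoin_const. Qed.
Let SZL_var z : SZL (Z z).
Proof. by apply: adjoin_laurent_adjoin; exact: adjoin_var. Qed.
Let SZL_inv z : SZL (Z z)^-1.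
Proof. exact: adjoin_laurent_inv. Qed.

(** Grouping the terms by their A-part gives a relation over the Laurent polynomials in Z. Freeness
    of A kills each group, and freeness of Z then kills its coefficients. *)
Lemma free_two_blocks : free SZL A -> free S Z -> free S two_blocks.
Proof.
move=> freeA freeZ s c us sc e0.
pose ss := undup [seq usubmx e | e <- s].
pose g (a : 'cV[int]_n) := \sum_(e <- s | usubmx e == a) c e * monomial Z (dsubmx e).
have SZLg a : SZL (g a).
  apply: subring_sum => // e _; apply: subringM => //; first exact: SZL_S.
  exact: monomial_in.
have g0 a : a \in ss -> g a = 0.
  apply: (freeA _ _ (undup_uniq _) SZLg); rewrite -[RHS]e0.
  rewrite (eq_bigr (fun a => \sum_(e <- s) if usubmx e == a then
     c e * monomial Z (dsubmx e) * monomial A a else 0)); last first.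
    by move=> a' _; rewrite /g big_distrl /= big_mkcond.
  rewrite exchange_big /=; apply: eq_big_seq => e es.
  rewrite (bigD1_seq (usubmx e)) ?undup_uniq ?mem_undup ?map_f //= eqxx big1 ?addr0.
    by rewrite -mulrA monomial_two_blocks [X in _ * X]mulrC.
  by move=> a' /negbTE; rewrite eq_sym => ->.
move=> e es; have := g0 (usubmx e); rewrite mem_undup map_f // => /(_ isT) => hg.
pose s' := [seq dsubmx e' | e' <- [seq e' <- s | usubmx e' == usubmx e]].
pose c' b := c (col_mx (usubmx e) b).
have us' : uniq s'.
  rewrite map_inj_in_uniq ?filter_uniq // => e1 e2; rewrite !mem_filter.
  move=> /andP [/eqP h1 _] /andP [/eqP h2 _] h.
  by rewrite -(vsubmxK e1) -(vsubmxK e2) h1 h2 h.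
have -> : c e = c' (dsubmx e) by rewrite /c' vsubmxK.
apply: (freeZ s' c' us' (fun b => sc _)).
  rewrite /s' big_map big_filter -[RHS]hg; apply: eq_bigr => e' /eqP h.
  by rewrite /c' -h vsubmxK.
by apply/mapP; exists e => //; rewrite mem_filter eqxx.
Qed.

Section Exponents.
Variables (H : 'cV[int]_(n + m) -> Prop) (Q : F -> Prop).
Hypothesis Qring : is_subring Q.

(** A variable or its inverse has to lie in [Q] only if some exponent in [H] has the corresponding
    sign there, so one lemma serves polynomials and Laurent polynomials. *)
Lemma span_two_blocks_sub f : (forall c, S c -> Q c) ->
  (forall e i, H e -> 0 < e (lshift m i) 0 -> Q (A i)) ->
  (forall e i, H e -> e (lshift m i) 0 < 0 -> Q (A i)^-1) ->
  (forall e z, H e -> 0 < e (rshift n z) 0 -> Q (Z z)) ->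
  (forall e z, H e -> e (rshift n z) 0 < 0 -> Q (Z z)^-1) ->
  Span S two_blocks H f -> Q f.
Proof.
move=> QS QA QA' QZ QZ'; apply: span_sub => // e he.
by apply: monomial_in => // r; case: (split_ordP r) => i ->;
  rewrite ?two_blocks_l ?two_blocks_r; eauto.
Qed.

End Exponents.

Section Variables.
Variable H : 'cV[int]_(n + m) -> Prop.
Hypothesis HD : forall e e', H e -> H e' -> H (e + e').
Hypothesis H0 : H 0.
Let Hring : is_subring (Span S two_blocks H).
Proof. exact: (span_subring Sring two_blocks_neq0 H0 HD). Qed.

Lemma span_const c : S c -> Span S two_blocks H c.
Proof. by move=> sc; rewrite -[c]mulr1 -(monomial0 two_blocks); exact: span_monomial. Qed.

Lemma span_two_blocks_l i : H (var (lshift m i)) -> Span S two_blocks H (A i).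
Proof. by move=> h; rewrite -two_blocks_l -monomial_var; exact: span_monomial1. Qed.

Lemma span_two_blocks_r z : H (var (rshift n z)) -> Span S two_blocks H (Z z).
Proof. by move=> h; rewrite -two_blocks_r -monomial_var; exact: span_monomial1. Qed.

Lemma span_two_blocks_lV i : H (- var (lshift m i)) -> Span S two_blocks H (A i)^-1.
Proof.
move=> h; rewrite -two_blocks_l -(monomial_var two_blocks) -monomialN.
exact: span_monomial1.
Qed.

Lemma span_two_blocks_rV z : H (- var (rshift n z)) -> Span S two_blocks H (Z z)^-1.
Proof.
move=> h; rewrite -two_blocks_r -(monomial_var two_blocks) -monomialN.
exact: span_monomial1.
Qed.

End Variables.

Lemma adjoin_two_blocks : adjoin SZ A = Span S two_blocks (fun e => forall r, 0 <= e r 0).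
Proof.
pose H (e : 'cV[int]_(n + m)) := forall r, 0 <= e r 0.
have HD e e' : H e -> H e' -> H (e + e') by move=> h h' r; entries; exact: addr_ge0.
have H0 : H 0 by move=> r; entries.
have Hring := span_subring Sring two_blocks_neq0 H0 HD.
have Hvar r : H (var r) by move=> r'; entries.
apply: pred_ext => f; split.
  apply: adjoin_sub => // [c|i]; last by apply: span_two_blocks_l; exact: Hvar.
  apply: adjoin_sub => // [d sd|z]; last by apply: span_two_blocks_r; exact: Hvar.
  exact: span_const.
apply: span_two_blocks_sub; first exact: adjoin_subring.
- by move=> c sc; apply: adjoin_const => //; exact: adjoin_const.
- by move=> e i _ _; exact: adjoin_var.
- by move=> e i /(_ (lshift m i)); rewrite leNgt => /negbTE ->.
- by move=> e z _ _; apply: adjoin_const => //; exact: adjoin_var.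
- by move=> e z /(_ (rshift n z)); rewrite leNgt => /negbTE ->.
Qed.

Lemma adjoin_laurent_coefficients :
  adjoin SZL A = Span S two_blocks (fun e => forall i, 0 <= e (lshift m i) 0).
Proof.
pose H (e : 'cV[int]_(n + m)) := forall i, 0 <= e (lshift m i) 0.
have HD e e' : H e -> H e' -> H (e + e') by move=> h h' r; entries; exact: addr_ge0.
have H0 : H 0 by move=> r; entries.
have Hring := span_subring Sring two_blocks_neq0 H0 HD.
have Hvar r : H (var r) by move=> r'; entries.
have HvarN z : H (- var (rshift n z)) by move=> i; entries; rewrite eq_lrshift.
apply: pred_ext => f; split.
  apply: adjoin_sub => // [c|i]; last by apply: span_two_blocks_l; exact: Hvar.
  apply: adjoin_laurent_sub => // [d sd|z|z]; last by apply: span_two_blocks_rV; exact: HvarN.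
    exact: span_const.
  by apply: span_two_blocks_r; exact: Hvar.
apply: span_two_blocks_sub; first exact: adjoin_subring.
- by move=> c sc; apply: adjoin_const => //; exact: SZL_S.
- by move=> e i _ _; exact: adjoin_var.
- by move=> e i /(_ i); rewrite leNgt => /negbTE ->.
- by move=> e z _ _; apply: adjoin_const => //; exact: SZL_var.
- by move=> e z _ _; apply: adjoin_const => //; exact: SZL_inv.
Qed.

Lemma adjoin_laurent_two_blocks :
  adjoin_laurent SZL A = Span S two_blocks (@all_exponents _).
Proof.
have Hring := laurent_subring Sring two_blocks_neq0.
have Hvar r : all_exponents (var r : 'cV[int]_(n + m)) by [].
have HvarN z : all_exponents (- var (rshift n z) : 'cV[int]_(n + m)) by [].
apply: pred_ext => f; split.
  apply: adjoin_laurent_sub => // [c|i|i];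
    [|exact: span_two_blocks_l|exact: span_two_blocks_lV].
  apply: adjoin_laurent_sub => // [d sd|z|z]; last by apply: span_two_blocks_rV; exact: HvarN.
    exact: span_const.
  by apply: span_two_blocks_r; exact: Hvar.
apply: span_two_blocks_sub; first exact: adjoin_laurent_subring.
- by move=> c sc; apply: adjoin_laurent_adjoin; apply: adjoin_const => //; exact: SZL_S.
- by move=> e i _ _; apply: adjoin_laurent_adjoin; exact: adjoin_var.
- by move=> e i _ _; exact: adjoin_laurent_inv.
- by move=> e z _ _; apply: adjoin_laurent_adjoin; apply: adjoin_const => //; exact: SZL_var.
- by move=> e z _ _; apply: adjoin_laurent_adjoin; apply: adjoin_const => //; exact: SZL_inv.
Qed.

End TwoBlocks.

(** * Seeds in the ambient field *)

Section Ambient.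
Variables (K : idomainType) (m n : nat).
Local Notation F := (ambient K m n).
Local Notation scal := (@is_scalar K m n).
Local Notation KPr := (@KP K m n).

Definition scalar : {rmorphism K -> F} :=
  (@FracField.tofrac _ \o @mpolyC n _) \o @mpolyC m K.

Lemma scalarE c : scalar_embed m n c = scalar c. Proof. by []. Qed.

Lemma scalar_inj : injective scalar.
Proof. by move=> a b /eqP; rewrite tofrac_eq !mpolyC_eq => /eqP. Qed.

Lemma is_scalar_subring : is_subring scal.
Proof.
split; first by exists 1; rewrite scalarE rmorph1.
move=> _ _ [a ->] [b ->]; split.
  by exists (a - b); rewrite !scalarE rmorphB.
by exists (a * b); rewrite !scalarE rmorphM.
Qed.

Lemma Zvar_neq0 (i : 'I_m) : Zvar K n i != 0.
Proof.
by rewrite tofrac_eq0 mpolyC_eq0; apply/eqP => /(congr1 (mcoeff U_(i)%MM)) /eqP;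
  rewrite mcoeffXU eqxx mcoeff0 oner_eq0.
Qed.

(** The scalar coefficients of p are lifted to K by choice; the value of p is then the image of a
    polynomial over K under an injective embedding. *)
Lemma Zvar_independent (p : {mpoly F[m]}) : (forall e, scal p@_e) ->
  p.@[fun i => Zvar K n i] = 0 -> p = 0.
Proof.
move=> sp; have [c hc] : exists c : 'X_{1..m} -> K, forall e, p@_e = scalar (c e).
  exists (fun e => proj1_sig (constructive_indefinite_description _ (sp e))) => e.
  by case: constructive_indefinite_description.
pose emb : {rmorphism {mpoly K[m]} -> F} := @FracField.tofrac _ \o @mpolyC n _.
have -> : p.@[fun i => Zvar K n i] = emb (\sum_(e <- msupp p) c e *: 'X_[e]).
  rewrite mevalE rmorph_sum; apply: eq_bigr => e _ /=.
  rewrite -mul_mpolyC mpolyCM tofracM hc; congr (_ * _).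
  by rewrite mpolyXE_id !rmorph_prod; apply: eq_bigr => i _; rewrite !rmorphXn.
move=> /eqP; rewrite tofrac_eq0 mpolyC_eq0 => /eqP h.
apply/mpolyP => e; rewrite mcoeff0.
case: (boolP (e \in msupp p)) => [es|/memN_msupp_eq0 //].
rewrite hc; move/(congr1 (mcoeff e)): h;
  rewrite raddf_sum /= mcoeff0 (bigD1_seq e) ?msupp_uniq //=.
rewrite mcoeffZ mcoeffX eqxx mulr1 big1 ?addr0 => [->|e' ne]; first exact: rmorph0.
by rewrite mcoeffZ mcoeffX (negbTE ne) mulr0.
Qed.

Lemma KP_subring : is_subring KPr.
Proof. by apply: adjoin_laurent_subring => [|i];
  [exact: is_scalar_subring | exact: Zvar_neq0]. Qed.

Implicit Types (t : seed K m n).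

Definition zvar : 'I_m -> F := @Zvar K m n.

(* The cluster variables followed by Z_1, ..., Z_m, in the order of the rows of
   the extended exchange matrix. *)
Definition generators t : 'I_(n + m) -> F := two_blocks (cluster t) zvar.

Definition exchange_column t (k : 'I_n) : 'cV[int]_(n + m) := col k (extended_exchange_matrix
  t).

Lemma column_cluster t k i : exchange_column t k (lshift m i) 0 = exchange_matrix t i k.
Proof. by rewrite mxE col_mxEu. Qed.

Lemma column_Z t k z : exchange_column t k (rshift n z) 0 = coefficients t k 0 z.
Proof. by rewrite mxE col_mxEd mxE. Qed.

Section FreeSeed.
Variable t : seed K m n.
Hypothesis tseed : is_Aseed t.

Lemma cluster_neq0 i : cluster t i != 0.
Proof.
have [_ [alg _]] := tseed; apply/eqP => ci.
have : ('X_i : {mpoly F[n]}) = 0.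
  apply: alg; last by rewrite mevalXU.
  by move=> e; rewrite mcoeffX; apply: subring_nat; exact: KP_subring.
move/(congr1 (mcoeff U_(i)%MM)) => /eqP; rewrite mcoeffXU eqxx mcoeff0.
by rewrite oner_eq0.
Qed.

Lemma generators_neq0 r : generators t r != 0.
Proof. by apply: two_blocks_neq0; [exact: cluster_neq0 | exact: Zvar_neq0]. Qed.

Lemma generators_free : free scal (generators t).
Proof.
have [_ [alg _]] := tseed.
apply: free_two_blocks; [exact: is_scalar_subring | exact: Zvar_neq0 | |].
  exact: (free_monomials KP_subring cluster_neq0 alg).
exact: (free_monomials is_scalar_subring Zvar_neq0 Zvar_independent).
Qed.

Lemma laurent_ring_span : laurent_ring t = Span scal (generators t) (@all_exponents _).
Proof.
exact: (adjoin_laurent_two_blocks is_scalar_subring cluster_neq0 Zvar_neq0).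
Qed.

Lemma adjoin_KP_span :
  adjoin KPr (cluster t) = Span scal (generators t) (fun e => forall i, 0 <= e (lshift m i) 0).
Proof.
exact: (adjoin_laurent_coefficients is_scalar_subring cluster_neq0 Zvar_neq0).
Qed.

Lemma adjoin_KZ_span :
  adjoin (@KZ K m n) (cluster t) = Span scal (generators t) (fun e => forall r, 0 <= e r 0).
Proof.
exact: (adjoin_two_blocks is_scalar_subring cluster_neq0 Zvar_neq0).
Qed.

End FreeSeed.

End Ambient.

(** * Mutation of seeds *)

Section Mutation.
Variables (K : idomainType) (m n : nat).
Local Notation F := (ambient K m n).
Implicit Types (t : seed K m n) (k : 'I_n).

(** [tplus 0 (X k)] has the entries min(0, c); its difference from X_k, and its opposite, have the
    entries max(c, 0) and max(-c, 0). *)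
Lemma exchange_binomialE t k : exchange_binomial t k =
  binomial (generators t) (exchange_column t k).
Proof.
rewrite /binomial !monomial_two_blocks.
have pos (b : 'I_n -> int) (A : 'I_n -> F) :
    \prod_(j | 0 < b j) A j ^ b j = \prod_j A j ^ Num.max (b j) 0.
  rewrite big_mkcond; apply: eq_bigr => j _; case: (ltrP 0 (b j)) => // h.
case: t => B X A; rewrite /exchange_binomial; congr (_ + _); rewrite mulrC; congr (_ * _).
- rewrite pos; apply: eq_bigr => j _; by rewrite mxE entry_pos column_cluster.
- apply: eq_bigr => z _; congr (_ ^ _); rewrite [RHS]mxE entry_pos column_Z /= !mxE.
  by move: (X k 0 z) => w; lia.
- rewrite (eq_bigl (fun j => 0 < - B j k)) => [|j]; last by rewrite oppr_gt0.
  by rewrite (pos (fun j => - B j k)); apply: eq_bigr => j _;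
    rewrite mxE entry_pos entryN column_cluster.
- apply: eq_bigr => z _; congr (_ ^ _); rewrite [RHS]mxE entry_pos entryN column_Z /= !mxE.
  by move: (X k 0 z) => w; lia.
Qed.

Lemma skew_entries (B : 'M[int]_n) : skew_symmetrizable B ->
  exists2 s : 'I_n -> int, forall i, 0 < s i & forall i j, s i * B i j = - (s j * B j i).
Proof.
move=> [s spos /matrixP e]; exists (fun i => s 0 i) => // i j.
by have := e j i; rewrite [LHS]mxE [RHS]mxE !mul_diag_mx !mxE.
Qed.

Lemma skew_diag (B : 'M[int]_n) k : skew_symmetrizable B -> B k k = 0.
Proof.
move=> /skew_entries [s spos e]; have := e k k; have := spos k; nia.
Qed.

Lemma mutate_exchange t k : is_Aseed t ->
  exchange (lshift m k) (exchange_column t k) (generators t) (generators (mutate k t)).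
Proof.
move=> ts; split.
- by rewrite column_cluster; apply: skew_diag; case: ts.
- move=> r; case: (split_ordP r) => i -> h; rewrite /generators ?two_blocks_l ?two_blocks_r //.
  case: (t) h => B X A /=; rewrite ffunE (inj_eq (@lshift_inj _ _)) => /negbTE ->.
  by [].
- rewrite -exchange_binomialE /generators !two_blocks_l.
  have := cluster_neq0 ts k; case: (t) => B X A /= h.
  by rewrite ffunE eqxx mulrAC mulVf // mul1r.
Qed.

Lemma mutate_column_same t k : is_Aseed t ->
  exchange_column (mutate k t) k = - exchange_column t k.
Proof.
move=> ts; apply/colP => r; rewrite entryN; case: (split_ordP r) => i ->.
  by rewrite !column_cluster; case: (t) => B X A /=; rewrite mxE eqxx orbT.
by rewrite !column_Z; case: (t) => B X A /=; rewrite ffunE eqxx mxE.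
Qed.

(** For tropical coefficients the rule for X_j is matrix mutation of the rows of C; in both blocks
    the agreement is a case distinction on signs. *)
Lemma mutate_column t k j : is_Aseed t -> j != k ->
  mutated_column (lshift m k) (exchange_column t k) (exchange_column t j)
    (exchange_column (mutate k t) j).
Proof.
move=> ts jk; split.
  by rewrite !column_cluster; case: (t) => B X A /=; rewrite mxE eqxx.
move=> r; case: (split_ordP r) => i -> h.
  rewrite !column_cluster; move: h; rewrite (inj_eq (@lshift_inj _ _)) => ik.
  case: (t) => B X A /=; rewrite mxE (negbTE ik) (negbTE jk) /=; congr (_ + _).
  by move: (B i k) (B k j) => u v; case: (lerP 0 v); case: (ltrgtP u 0); nia.
rewrite !column_cluster !column_Z; case: (t) => B X A /=; rewrite ffunE (negbTE jk).
have mulz (u : 'rV[int]_m) (w : int) : (u *~ w) 0 i = u 0 i * w.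
  case: w => l; first by rewrite -pmulrn mulmxnE -mulr_natr natz.
  by rewrite NegzE mulrNz mxE -pmulrn mulmxnE -mulr_natr natz mulrN.
rewrite mxE [in LHS]mxE !mulz !mxE -addrA; congr (_ + _).
by move: (X k 0 i) (B k j) => u v; case: (lerP 0 v); case: (ltrgtP u 0); nia.
Qed.

(* The hypotheses on the initial seed, in a form invariant under mutation. *)
Definition good t := [/\ is_Aseed t, forall k, primitive_vector (exchange_column t k)
  & forall v : 'I_n -> int, (forall r, \sum_j exchange_column t j r 0 * v j = 0) ->
      forall j, v j = 0].

Lemma primitive_good t k : primitive t -> primitive_vector (exchange_column t k).
Proof.
move=> pt; have := pt k.
have bezout (s : seq 'I_(n + m)) (a : 'I_(n + m) -> int) :
    exists w : 'I_(n + m) -> int, \sum_r w r * a r = (\big[gcdn/0%N]_(r <- s) `|a r|%N)%:Z.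
  elim: s => [|r s [w IH]].
    by exists (fun _ => 0); rewrite big_nil big1 // => r _; rewrite mul0r.
  have [u [v e]] := Bezoutz (a r) (\big[gcdn/0%N]_(r <- s) `|a r|%N)%:Z.
  exists (fun i => (if i == r then u else 0) + v * w i).
  rewrite big_cons -[RHS]e -IH big_distrr /= (bigD1 r) //= [in RHS](bigD1 r) //= eqxx.
  rewrite mulrDl -addrA -mulrA; congr (_ + (_ + _)).
  by apply: eq_bigr => i /negbTE ->; rewrite add0r mulrA.
move=> h; have [w hw] := bezout (index_enum _) (fun r => exchange_column t k r 0).
exists w; rewrite hw; congr Posz; rewrite -[RHS]h.
by apply: eq_bigr => r _; rewrite /exchange_column mxE.
Qed.

Lemma full_rank_good t (v : 'I_n -> int) : full_rank t ->
  (forall r, \sum_j exchange_column t j r 0 * v j = 0) -> forall j, v j = 0.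
Proof.
rewrite /full_rank => rk hv; set A := map_mx _ _ in rk.
have /row_fullP [B hB] : row_full A by rewrite /row_full rk.
have : A *m (\col_j (v j)%:~R : 'cV[rat]_n) = 0.
  apply/colP => r; rewrite [RHS]mxE.
  transitivity ((\sum_j exchange_column t j r 0 * v j)%:~R : rat); last by rewrite hv.
  rewrite mxE rmorph_sum.
  by apply: eq_bigr => j _; rewrite !mxE rmorphM.
move/(congr1 (mulmx B)); rewrite mulmxA hB mul1mx mulmx0 => /colP h j.
by have := h j; rewrite !mxE => /eqP; rewrite intr_eq0 => /eqP.
Qed.

(** Mutation is invertible over the integers: a_r = a'_r + d_r a'_k for r other than k, so a weight
    of value 1 at a induces one at a'. *)
Lemma mutated_primitive N (k : 'I_N) (c a a' : 'cV[int]_N) : mutated_column k c a a' ->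
  primitive_vector a -> primitive_vector a'.
Proof.
move=> [h1 h2] [w hw].
pose d r := Num.max (if 0 <= a k 0 then c r 0 else - c r 0) 0.
have ha r : r != k -> a r 0 = a' r 0 + d r * a' k 0.
  by move=> rk; rewrite h2 // h1 -/(d r); move: (d r) (a k 0) (a r 0) => *; lia.
pose S := \sum_(i | i != k) w i * d i.
exists (fun r => if r == k then S - w k else w r).
rewrite -[RHS]hw (bigD1 k) //= [in RHS](bigD1 k) //= eqxx.
have -> : \sum_(r | r != k) (if r == k then S - w k else w r) * a' r 0 =
  \sum_(r | r != k) w r * a' r 0.
  by apply: eq_bigr => r /negbTE ->.
have -> : \sum_(r | r != k) w r * a r 0 = \sum_(r | r != k) w r * a' r 0 + S * a' k 0.
  rewrite /S big_distrl -big_split; apply: eq_bigr => r rk /=.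
  by rewrite ha //; ring.
by rewrite h1; ring.
Qed.

(** For the rank, a relation v between the mutated columns yields a relation u between the old ones.
    Row k says that the sum of the b_j v_j vanishes, which removes the terms in max(c_r, 0); the
    terms in c_r are collected in u_k. *)
Lemma mutate_good t k : good t -> is_Aseed (mutate k t) -> good (mutate k t).
Proof.
move=> [ts pt rt] ts'; split=> // [j|v hv].
  case: (eqVneq j k) => [->|jk]; last exact: mutated_primitive (mutate_column ts jk) (pt j).
  have [w hw] := pt k; exists (fun r => - w r); rewrite -[RHS]hw mutate_column_same //.
  by apply: eq_bigr => r _; rewrite entryN mulrNN.
pose b j := exchange_column t j (lshift m k) 0.
pose c r := exchange_column t k r 0.
have bk : b k = 0 by rewrite /b column_cluster; apply: skew_diag; case: ts.
have colE j r : j != k -> r != lshift m k ->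
    exchange_column (mutate k t) j r 0 =
    exchange_column t j r 0 + b j * Num.max (c r) 0 + Num.max (- b j) 0 * c r.
  move=> jk rk; have [_ h] := mutate_column ts jk; rewrite h // -/(b j) -/(c r) -addrA;
    congr (_ + _).
  by move: (b j) (c r) => u w; case: (lerP 0 u); case: (ltrgtP w 0); nia.
have T0 : \sum_(j | j != k) b j * v j = 0.
  have := hv (lshift m k); rewrite (bigD1 k) //= mutate_column_same // entryN -/(b k) bk
    oppr0 mul0r add0r.
  rewrite (eq_bigr (fun j => - (b j * v j))) ?sumrN => [/eqP|j jk];
    first by rewrite oppr_eq0 => /eqP.
  by have [-> _] := mutate_column ts jk; rewrite mulNr.
pose u j := if j == k then \sum_(i | i != k) Num.max (- b i) 0 * v i - v k else v j.
have u0 : forall j, u j = 0.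
  apply: rt => r; rewrite (bigD1 k) //= [u k]/u eqxx.
  have -> : \sum_(j | j != k) exchange_column t j r 0 * u j
      = \sum_(j | j != k) exchange_column t j r 0 * v j.
    by apply: eq_bigr => j /negbTE h; rewrite /u h.
  case: (eqVneq r (lshift m k)) => [->|rk]; first by rewrite -/(b k) bk mul0r add0r T0.
  have := hv r; rewrite (bigD1 k) //= mutate_column_same // entryN -/(c r).
  have -> : \sum_(j | j != k) exchange_column (mutate k t) j r 0 * v j
      = \sum_(j | j != k) (exchange_column t j r 0 * v j + (b j * v j * Num.max (c r) 0
         + Num.max (- b j) 0 * v j * c r)).
    by apply: eq_bigr => j jk; rewrite colE //; ring.
  rewrite !big_split /= -!big_distrl /= T0 mul0r add0r => e.
  by rewrite -[RHS]e; ring.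
have vj j : j != k -> v j = 0 by move=> jk; have := u0 j; rewrite /u (negbTE jk).
move=> j; case: (eqVneq j k) => [->|]; last exact: vj.
have := u0 k; rewrite /u eqxx big1 => [|i ik]; last by rewrite vj // mulr0.
by rewrite sub0r => /eqP; rewrite oppr_eq0 => /eqP.
Qed.

End Mutation.

Lemma free_sub (F : fieldType) N (D D' : F -> Prop) (x : 'I_N -> F) :
  (forall c, D c -> D' c) -> free D' x -> free D x.
Proof. by move=> DD' h s c us dc; apply: h => // e; exact: DD'. Qed.

Section Tree.
Variable n : nat.
Implicit Types (t : tree_vertex n) (k : 'I_n).

Lemma tree_edge_sym k t t' : tree_edge k t t' -> tree_edge k t' t.
Proof. by rewrite /tree_edge orbC. Qed.

Lemma tree_neighbor t k : exists t', tree_edge k t t'.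
Proof.
case: t => w hw; case: w hw => [|i w] hw.
  by exists (exist _ [:: k] isT); rewrite /tree_edge /= eqxx.
case: (eqVneq i k) => [ik|ik].
  have hw' : reduced_word w by exact: path_sorted hw.
  by exists (exist _ w hw'); rewrite /tree_edge /= ik eqxx orbT.
have hw' : reduced_word (k :: i :: w) by rewrite /reduced_word /= eq_sym ik.
by exists (exist _ (k :: i :: w) hw'); rewrite /tree_edge /= eqxx.
Qed.

(** The induction may start at any vertex: dropping letters leads from t0 to the empty word, and
    adding letters leads from there to every vertex. *)
Lemma tree_ind (P : tree_vertex n -> Prop) t0 : P t0 ->
  (forall k t t', tree_edge k t t' -> P t -> P t') -> forall t, P t.
Proof.
move=> P0 step; pose root : tree_vertex n := exist _ [::] isT.
have Proot : P root.
  case: t0 P0 => w; elim: w => [|i w IH] hw P0;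
    first by rewrite /root (bool_irrelevance isT hw).
  have hw' : reduced_word w by exact: path_sorted hw.
  apply: (IH hw'); apply: step P0; rewrite /tree_edge; apply/orP; right; exact: eqxx.
case=> w; elim: w => [|i w IH] hw; first by rewrite (bool_irrelevance hw isT).
have hw' : reduced_word w by exact: path_sorted hw.
by apply: (step i _ _ _ (IH hw')); rewrite /tree_edge /= eqxx.
Qed.

End Tree.

(** * Seed patterns and the starfish lemma *)

Section Pattern.
Variables (K : idomainType) (m n : nat) (Sigma : tree_vertex n -> seed K m n).
Hypothesis pattern : is_seed_pattern Sigma.
Variable t0 : tree_vertex n.
Hypothesis good0 : good (Sigma t0).
Local Notation F := (ambient K m n).
Local Notation scal := (@is_scalar K m n).
Local Notation laurent D t := (Span D (generators t) (@all_exponents _)).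

Lemma pattern_seed t : is_Aseed (Sigma t). Proof. by case: pattern. Qed.

Lemma pattern_edge k t t' : tree_edge k t t' -> Sigma t' = mutate k (Sigma t).
Proof. by case: pattern => _; apply. Qed.

Lemma pattern_mutate t k : is_Aseed (mutate k (Sigma t)).
Proof.
by have [t' e] := tree_neighbor t k; rewrite -(pattern_edge e); exact: pattern_seed.
Qed.

Lemma pattern_good t : good (Sigma t).
Proof.
apply: (tree_ind (P := fun t => good (Sigma t)) good0) => k t1 t2 e h.
by rewrite (pattern_edge e); apply: mutate_good => //; exact: pattern_mutate.
Qed.

Lemma pattern_exchange t k : exchange (lshift m k) (exchange_column (Sigma t) k)
  (generators (Sigma t)) (generators (mutate k (Sigma t))).
Proof. by apply: mutate_exchange; exact: pattern_seed. Qed.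

Section Scalars.
Variable D : F -> Prop.
Hypothesis Dring : is_subring D.
Hypothesis Dscal : forall c, D c -> scal c.

Lemma starfish_edge t t' k j f : tree_edge k t t' -> j != k ->
  laurent D (Sigma t) f -> laurent D (mutate j (Sigma t)) f -> laurent D (Sigma t') f ->
  laurent D (mutate j (Sigma t')) f.
Proof.
move=> e jk.
have ts := pattern_seed t; have ts' := pattern_seed t'.
have h2 := pattern_exchange t' j.
have [_ pt' _] := pattern_good t'; have [_ _ rt] := pattern_good t.
have fr u : is_Aseed u -> free D (generators u).
  by move=> us; apply: free_sub Dscal _; exact: generators_free.
have E := pattern_edge e.
have [s spos se] := skew_entries (proj1 ts).
apply: (starfish_step Dring (j := lshift m j) (k := lshift m k)
  (a := exchange_column (Sigma t) j) (a' := exchange_column (Sigma t') j) (c :=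
    exchange_column (Sigma t) k)).
- by rewrite (inj_eq (@lshift_inj _ _)).
- exact: generators_neq0.
- by apply: generators_neq0; exact: pattern_mutate.
- exact: generators_neq0.
- by apply: generators_neq0; exact: pattern_mutate.
- exact: fr.
- by apply: fr; exact: pattern_mutate.
- by rewrite E; exact: pattern_exchange.
- exact: pattern_exchange.
- exact: pattern_exchange.
- by rewrite E; exact: mutate_column.
- rewrite !column_cluster; have := se k j; have := spos k; have := spos j.
  move: (s k) (s j) (exchange_matrix _ k j) (exchange_matrix _ j k) => sk sj u v sj0 sk0 euv.
  case: (ltrgtP u 0) => u0; [right; nia|right; nia|left; split=> //; nia].
- exact: pt'.
- move=> cj z ez.
  have ak : exchange_column (Sigma t) j (lshift m k) 0 = 0.
    rewrite !column_cluster in cj *; have := se k j; have := spos k; rewrite cj mulr0 oppr0.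
    by move=> sk0 /eqP; rewrite mulf_eq0 gt_eqF //= => /eqP.
  have aa := mutated_column0 ak (mutate_column ts jk).
  rewrite E aa in ez.
  (* Here b_jk = 0, so mutation at k does not change column j, and column k being z times column j
     contradicts the independence of the columns. *)
  have := rt (fun i => if i == k then 1 else if i == j then - z else 0) _ k.
  rewrite eqxx => /(_ _) h; suff : (1 : int) = 0 by [].
  apply: h => r; rewrite (bigD1 k) //= eqxx (bigD1 j) //= (negbTE jk) eqxx mulr1 ez.
  rewrite big1 ?addr0; last by move=> i /andP [/negbTE -> /negbTE ->]; rewrite mulr0.
  have mulz (u : 'cV[int]_(n + m)) (w : int) : (u *~ w) r 0 = u r 0 * w.
    case: w => l; first by rewrite -pmulrn mulmxnE -mulr_natr natz.
    by rewrite NegzE mulrNz mxE -pmulrn mulmxnE -mulr_natr natz mulrN.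
  by rewrite mulz mulrN subrr.
Qed.

(** What travels along an edge is membership in the rings of a vertex and of all its neighbours
    together. *)
Lemma upper_bound f : laurent D (Sigma t0) f -> (forall k, laurent D (mutate k (Sigma t0)) f) ->
  forall t, laurent D (Sigma t) f.
Proof.
move=> f0 fk.
suff h t : laurent D (Sigma t) f /\ forall k, laurent D (mutate k (Sigma t)) f.
  by move=> t; case: (h t).
apply: (@tree_ind _ (fun t => laurent D (Sigma t) f /\ forall k,
  laurent D (mutate k (Sigma t)) f) t0).
  by [].
move=> k t1 t2 e [h1 h2]; split=> [|j]; first by rewrite (pattern_edge e).
case: (eqVneq j k) => [->|jk]; first by rewrite -(pattern_edge (tree_edge_sym e)).
by apply: (starfish_edge e jk) => //; rewrite (pattern_edge e).
Qed.

Lemma frozen_valuation_edge t t' k (z : 'I_m) (s : int) f : tree_edge k t t' ->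
  laurent D (Sigma t') f ->
  Span D (generators (Sigma t)) (fun e => s <= e (rshift n z) 0) f ->
  Span D (generators (Sigma t')) (fun e => s <= e (rshift n z) 0) f.
Proof.
move=> e; rewrite (pattern_edge e).
apply: (frozen_valuation Dring (k := lshift m k) (c := exchange_column (Sigma t) k)).
- by rewrite eq_rlshift.
- by apply: generators_neq0; exact: pattern_seed.
- by apply: generators_neq0; exact: pattern_mutate.
- by apply: free_sub Dscal _; apply: generators_free; exact: pattern_mutate.
- exact: pattern_exchange.
Qed.

Lemma frozen_valuation_pattern t t' (z : 'I_m) (s : int) f :
  (forall t, laurent D (Sigma t) f) ->
  Span D (generators (Sigma t)) (fun e => s <= e (rshift n z) 0) f ->
  Span D (generators (Sigma t')) (fun e => s <= e (rshift n z) 0) f.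
Proof.
move=> hf ht; move: t'; apply: (tree_ind (P := fun t =>
  Span D (generators (Sigma t)) (fun e => s <= e (rshift n z) 0) f) ht) => k t1 t2 e h.
by apply: (frozen_valuation_edge e) h.
Qed.

Lemma cluster_laurent_neighbors t k i : laurent D (mutate k (Sigma t)) (cluster (Sigma t) i).
Proof.
have [_ h1 h2] := exchange_sym (pattern_exchange t k).
have x0 := generators_neq0 (pattern_mutate t k).
have R := laurent_subring Dring x0.
rewrite -(two_blocks_l (cluster (Sigma t)) (@zvar K m n)) -/(generators (Sigma t)).
case: (eqVneq i k) => [->|ik].
  have -> : generators (Sigma t) (lshift m k) =
    binomial (generators (mutate k (Sigma t))) (exchange_column (Sigma t) k)
      * monomial (generators (mutate k (Sigma t))) (- var (lshift m k)).
    by rewrite -h2 monomialN monomial_var mulfK.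
  apply: subringM => //; last exact: span_monomial1.
  by apply: spanD => //; exact: span_monomial1.
rewrite h1 ?(inj_eq (@lshift_inj _ _)) // -(monomial_var (generators (mutate k (Sigma t)))).
exact: span_monomial1.
Qed.

End Scalars.

End Pattern.

(** * The upper cluster algebra *)

Section UpperAlgebra.
Variables (K : idomainType) (m n : nat) (Sigma : tree_vertex n -> seed K m n).
Hypothesis pattern : is_seed_pattern Sigma.
Variable t0 : tree_vertex n.
Hypothesis good0 : good (Sigma t0).
Hypothesis K_pf : prime_factorial (fun _ : K => True).
Local Notation F := (ambient K m n).
Local Notation scal := (@is_scalar K m n).
Local Notation laurent t := (Span scal (generators t) (@all_exponents _)).
Local Notation U := (upper_cluster_algebra Sigma).
Local Notation gen t i := (generators (Sigma t) (lshift m i)).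
Let Sr := @is_scalar_subring K m n.
Let ts t : is_Aseed (Sigma t) := pattern_seed pattern t.
Let x0 t := generators_neq0 (ts t).
Let mts t k : is_Aseed (mutate k (Sigma t)) := pattern_mutate pattern t k.
Let mx0 t k := generators_neq0 (mts t k).
Let Lring t := laurent_subring Sr (x0 t).
Let mLring t k := laurent_subring Sr (mx0 t k).

Lemma upper_laurent f : U f <-> forall t, laurent (Sigma t) f.
Proof. by split=> h t; have := h t; rewrite laurent_ring_span. Qed.

Lemma upper_neighbor f t k : U f -> laurent (mutate k (Sigma t)) f.
Proof.
by move=> /upper_laurent h; have [t' e] := tree_neighbor t k; rewrite -(pattern_edge pattern e).
Qed.

Lemma upper_subring : is_subring U.
Proof.
split; first by apply/upper_laurent => t; apply: subring1.
move=> f g /upper_laurent hf /upper_laurent hg; split; apply/upper_laurent => t.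
  by apply: subringB.
by apply: subringM.
Qed.

Lemma upper_of_neighbors t f : laurent (Sigma t) f ->
  (forall k, laurent (mutate k (Sigma t)) f) -> U f.
Proof.
move=> h1 h2; apply/upper_laurent.
exact: (upper_bound pattern (pattern_good pattern good0 t) Sr (fun c dc => dc)).
Qed.

Lemma upper_cluster t i : U (gen t i).
Proof.
apply: (@upper_of_neighbors t) => [|k].
  by rewrite -(monomial_var (generators (Sigma t))); exact: span_monomial1.
by rewrite /generators two_blocks_l; apply: cluster_laurent_neighbors.
Qed.

Lemma gen_neighbor t k : gen t k =
  monomial (generators (mutate k (Sigma t))) (- var (lshift m k))
  * binomial (generators (mutate k (Sigma t))) (exchange_column (Sigma t) k).
Proof.
have [_ h1 h2] := exchange_sym (pattern_exchange pattern t k).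
by rewrite -h2 monomialN monomial_var mulrC mulfK // mx0.
Qed.

Lemma gen_prime_neighbor t k : prime_in (laurent (mutate k (Sigma t))) (gen t k).
Proof.
rewrite gen_neighbor; apply: prime_mul_invertible => //.
  by apply: monomial_invertible.
have [_ pt _] := pattern_good pattern good0 t; have [w hw] := pt k.
by apply: binomial_prime hw => //; exact: generators_free.
Qed.

Lemma laurent_pf t : is_Aseed t -> prime_factorial (laurent t).
Proof.
move=> h; apply: (laurent_prime_factorial Sr (generators_neq0 h) (generators_free h) (phi :=
  scalar K m n)) => //.
exact: scalar_inj.
Qed.

Lemma gen_power_invertible t k j l : j != k ->
  laurent (mutate j (Sigma t)) ((gen t k)^-1 ^+ l).
Proof.
move=> jk; have [_ h1 _] := pattern_exchange pattern t j.
rewrite -h1 ?(inj_eq (@lshift_inj _ _)) // 1?eq_sym //.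
rewrite -(monomial_var (generators (mutate j (Sigma t)))) -monomialN.
by apply: subringX => //; exact: span_monomial1.
Qed.

(* gen t k is invertible in the Laurent rings of t and of its neighbours other
   than the k-th, so that only the k-th one constrains the quotients by gen t k. *)
Lemma upper_quotient t k l f g : U f -> f = gen t k ^+ l * g ->
  laurent (mutate k (Sigma t)) g -> U g.
Proof.
move=> uf efg hg.
have eg : g = f * (gen t k)^-1 ^+ l.
  by rewrite efg mulrC mulrA -exprMn mulVf ?x0 // expr1n mul1r.
apply: (@upper_of_neighbors t) => [|j].
  rewrite eg; apply: subringM => //; first by move/upper_laurent: uf.
  rewrite -(monomial_var (generators (Sigma t))) -monomialN.
  by apply: subringX => //; exact: span_monomial1.
case: (eqVneq j k) => [->//|jk].
rewrite eg; apply: subringM => //; first exact: upper_neighbor.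
exact: gen_power_invertible.
Qed.

Lemma gen_divides t k f : U f ->
  divides_in (laurent (mutate k (Sigma t))) (gen t k) f -> divides_in U (gen t k) f.
Proof.
move=> uf [q hq e]; exists q => //; apply: (@upper_quotient t k 1%N f) => //.
Qed.

(** By [gen_divides], divisibility by [gen t k] in U is decided in the Laurent ring of the k-th
    neighbour. *)
Lemma gen_prime t k : prime_in U (gen t k).
Proof.
have [_ g0 ng hg] := gen_prime_neighbor t k.
split=> //; first exact: upper_cluster.
  move=> [_ [v uv e]]; apply: ng; split; first by apply: upper_neighbor; exact: upper_cluster.
  by exists v => //; exact: upper_neighbor.
move=> a b ua ub [q uq e].
have : divides_in (laurent (mutate k (Sigma t))) (gen t k) (a * b).
  by exists q => //; exact: upper_neighbor.
by case/(hg _ _ (upper_neighbor t k ua) (upper_neighbor t k ub)) => h; [left|right];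
  exact: gen_divides.
Qed.

Lemma gen_multiplicity t k f : U f -> f != 0 ->
  exists l g, [/\ U g, f = gen t k ^+ l * g & ~ divides_in U (gen t k) g].
Proof.
move=> uf f0; have Lpf := (laurent_pf (mts t k)).2 f (upper_neighbor t k uf) f0.
have [l [g [hg e ng]]] := prime_multiplicity (mLring t k) Lpf f0 (gen_prime_neighbor t k).
have ug : U g by exact: upper_quotient uf e hg.
exists l, g; split=> // [[q uq eq]]; apply: ng; exists q => //; exact: upper_neighbor.
Qed.

Definition initial_variable (p : F) := exists k, p = gen t0 k.

Lemma product_ofM s s' : product_of initial_variable s -> product_of initial_variable s' ->
  product_of initial_variable (s * s').
Proof.
move=> [l hl ->] [l' hl' ->]; exists (l ++ l'); last by rewrite big_cat.
by move=> p; rewrite mem_cat => /orP [/hl|/hl'].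
Qed.

Lemma product_of1 : product_of initial_variable 1.
Proof. by exists [::]; rewrite ?big_nil. Qed.

Lemma product_ofX s l : product_of initial_variable s -> product_of initial_variable (s ^+ l).
Proof.
move=> hs; elim: l => [|l IH]; rewrite ?expr0 ?exprS; first exact: product_of1.
exact: product_ofM.
Qed.

Lemma product_of_gen k : product_of initial_variable (gen t0 k).
Proof.
exists [:: gen t0 k]; last by rewrite big_seq1.
by move=> p; rewrite inE => /eqP ->; exists k.
Qed.

Lemma upper_scalar c : scal c -> U c.
Proof. by move=> sc; apply/upper_laurent => t; apply: span_const. Qed.

Lemma upper_Z (z : 'I_m) : U (zvar K n z) /\ U (zvar K n z)^-1.
Proof.
split; apply/upper_laurent => t; rewrite -(two_blocks_r (cluster (Sigma t)));
  rewrite -/(generators (Sigma t)) -(monomial_var (generators (Sigma t))) -?monomialN;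
  exact: span_monomial1.
Qed.

(** Only cluster variables have to be cleared from denominators, since the Z_i are invertible in
    U. *)
Lemma upper_clear f : laurent (Sigma t0) f ->
  exists2 s, product_of initial_variable s & U (f * s).
Proof.
have Ur := upper_subring.
elim=> [|c e g sc _ _ [s hs us]].
  by exists 1; [exact: product_of1 | rewrite mul0r; exact: subring0].
pose e' : 'cV[int]_(n + m) := col_mx (\col_i `|e (lshift m i) 0|) 0.
have me' : monomial (generators (Sigma t0)) e' = \prod_i gen t0 i ^+ `|(e (lshift m i) 0)%R|%N.
  rewrite monomial_two_blocks col_mxKu col_mxKd monomial0 mulr1; apply: eq_bigr => i _.
  by rewrite mxE exprnP abszE /generators two_blocks_l.
have pe' : product_of initial_variable (monomial (generators (Sigma t0)) e').
  rewrite me'; apply: big_ind => [||i _]; [exact: product_of1|exact: product_ofM|].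
  by apply: product_ofX; exact: product_of_gen.
exists (monomial (generators (Sigma t0)) e' * s); first exact: product_ofM.
rewrite mulrDl; apply: (subringD Ur).
  rewrite mulrA; apply: (subringM Ur).
    rewrite -mulrA -monomialD; last exact: x0.
    apply: (subringM Ur); first exact: upper_scalar.
    apply: monomial_in => // r; case: (split_ordP r) => i -> h.
    - exact: upper_cluster.
    - by rewrite /generators two_blocks_r; case: (upper_Z i).
    - move: h; rewrite entryD col_mxEu mxE.
      by move: (e (lshift m i) 0) => w; lia.
    - by rewrite /generators two_blocks_r; case: (upper_Z i).
  case: hs => l hl ->; rewrite big_seq; apply: (subring_prod Ur) => p /hl [k ->].
  exact: upper_cluster.
rewrite mulrCA; apply: (subringM Ur) => //.
rewrite me'; apply: (subring_prod Ur) => i _; apply: (subringX Ur); exact: upper_cluster.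
Qed.

Lemma upper_localization : localization_of U (laurent (Sigma t0)) (product_of initial_variable).
Proof.
split.
- exact: upper_subring.
- exact: Lring.
- by move=> f /upper_laurent.
- move=> _ [l hl ->]; split.
    rewrite big_seq; apply: subring_prod => [|p /hl [k ->]]; first exact: upper_subring.
    exact: upper_cluster.
  rewrite big_seq; apply: big_ind => [||p /hl [k ->]].
  + by apply: invertible1.
  + by move=> u v; apply: invertibleM.
  + rewrite -(monomial_var (generators (Sigma t0))); exact: monomial_invertible.
- exact: upper_clear.
Qed.

Lemma upper_prime_factorial : prime_factorial U.
Proof.
have Ur := upper_subring.
apply: nagata upper_localization _ _ (laurent_pf (ts t0)).
  by move=> _ [k ->]; exact: gen_prime.
move=> f uf f0.
(* One initial variable is extracted at a time; those extracted before still do not divide, as the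
   new cofactor divides the old one. *)
have [s [g [hs ug e ng]]] : exists s g, [/\ product_of initial_variable s, U g, f = s * g
    & forall k, k \in enum 'I_n -> ~ divides_in U (gen t0 k) g].
  elim: (enum 'I_n) => [|k ks [s [g [hs ug e ng]]]].
    by exists 1, f; split; rewrite ?mul1r //; exact: product_of1.
  have g0 : g != 0 by apply: contraNneq f0 => g0; rewrite e g0 mulr0.
  have [l [h [uh eh nh]]] := gen_multiplicity t0 k ug g0.
  exists (s * gen t0 k ^+ l), h; split=> //.
  - by apply: product_ofM => //; apply: product_ofX; exact: product_of_gen.
  - by rewrite e eh mulrA.
  - move=> i; rewrite inE => /orP [/eqP -> //|iks] d; apply: (ng i iks).
    rewrite eh; apply: (divides_mull Ur) => //; apply: (subringX Ur); exact: upper_cluster.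
by exists s, g; split=> // _ [k ->]; apply: ng; exact: mem_enum.
Qed.

(** In the ring of t0 a unit is c x^e. If e_i > 0, its expansion at the i-th neighbour contains a
    prime exchange binomial and is not a unit; the same for the inverse excludes e_i < 0. *)
Lemma upper_invertible u : invertible_in U u -> exists e c,
  [/\ invertible_in scal c, u = c * monomial (generators (Sigma t0)) e
    & forall i, e (lshift m i) 0 = 0].
Proof.
have inv_neighbor v k : invertible_in U v -> invertible_in (laurent (mutate k (Sigma t0))) v.
  by move=> [uv [w uw e]]; split; [|exists w => //]; exact: upper_neighbor.
have npos c e i : scal c -> invertible_in U (c * monomial (generators (Sigma t0)) e) ->
  e (lshift m i) 0 <= 0.
  move=> sc /(inv_neighbor _ i); rewrite leNgt => inv; apply/negP => ei.
  have h := exchange_sym (pattern_exchange pattern t0 i).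
  move: inv; rewrite (monomial_exchange e (mx0 t0 i) h).
  have [_ pt _] := pattern_good pattern good0 t0; have [w hw] := pt i.
  have pP := binomial_prime Sr (mx0 t0 i) (generators_free (mts t0 i)) hw.
  have [hP _ nP _] := pP.
  have -> : e (lshift m i) 0 = (`|(e (lshift m i) 0)%R|%N.-1).+1%:Z.
    by move: (e (lshift m i) 0) ei => z; lia.
  rewrite -exprnP exprS -!mulrA mulrCA => /(invertible_factor (mLring t0 i) hP) inv.
  apply: nP; apply: inv => //; apply: subringM => //; first by apply: span_const.
  by apply: subringM; [|exact: subringX|exact: span_monomial1].
move=> iu; have [uu [v uv euv]] := iu.
have iuL : invertible_in (laurent (Sigma t0)) u.
  by split; [|exists v => //]; move/upper_laurent: (uu); move/upper_laurent: (uv).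
have [e [c [ic eu]]] := laurent_invertible Sr (x0 t0) (generators_free (ts t0)) iuL.
exists e, c; split=> // i; apply/eqP; rewrite eq_le; apply/andP; split.
  by apply: (npos c); rewrite -?eu //; case: ic.
have [sc [c' sc' ec]] := ic.
rewrite -oppr_le0 -entryN; apply: (npos c') => //.
have -> : c' * monomial (generators (Sigma t0)) (- e) = v.
  rewrite monomialN; apply: (mulfI (invertible_neq0 iuL)); rewrite euv eu.
  by rewrite mulrACA ec mul1r divff // monomial_neq0.
by split=> //; exists u; rewrite // mulrC.
Qed.

End UpperAlgebra.

(** * Positivity *)

Section Positivity.
Variables (F : fieldType) (N : nat) (D : F -> Prop) (x : 'I_N -> F).
Hypothesis Dring : is_subring D.
Hypothesis x0 : forall r, x r != 0.
Hypothesis xfree : free D x.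
Hypothesis char0 : forall k : nat, k.+1%:R != 0 :> F.

Inductive positive : F -> Prop :=
| positive1 e : positive (monomial x e)
| positiveS e f : positive f -> positive (monomial x e + f).

Lemma positiveD f g : positive f -> positive g -> positive (f + g).
Proof. by move=> pf pg; elim: pf => [e|e f' _ IH]; rewrite -?addrA; constructor. Qed.

Lemma positiveM f g : positive f -> positive g -> positive (f * g).
Proof.
have pM e h : positive h -> positive (monomial x e * h).
  elim=> [e'|e' h' _ IH]; first by rewrite -monomialD //; constructor.
  by rewrite mulrDr -monomialD //; constructor.
move=> pf pg; elim: pf => [e|e f' _ IH]; first exact: pM.
by rewrite mulrDl; apply: positiveD => //; exact: pM.
Qed.

(** Collecting equal monomials gives coefficients that are positive integers, non-zero in
    characteristic 0. *)
Lemma positive_neq0 f : positive f -> f != 0.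
Proof.
move=> pf; have [s [c [us [e es] ef]]] : exists (s : seq 'cV[int]_N) (c : 'cV[int]_N -> nat),
    [/\ uniq s, exists e, e \in s & f = \sum_(e <- s) (c e).+1%:R * monomial x e].
  elim: pf => [e|e f' _ [s [c [us [e0 es0] ->]]]].
    exists [:: e], (fun _ => 0%N); rewrite big_seq1 mul1r; split=> //.
    by exists e; rewrite inE.
  case: (boolP (e \in s)) => es.
    exists s, (fun e' => if e' == e then (c e).+1 else c e'); split=> //; first by exists e.
    rewrite !(bigD1_seq e) //= eqxx addrA; congr (_ + _).
      by rewrite -[X in X + _]mul1r -mulrDl -[in LHS](natrD _ 1).
    by apply: eq_bigr => e' /negbTE ->.
  exists (e :: s), (fun e' => if e' == e then 0%N else c e'); split.
  - by rewrite /= es.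
  - by exists e; rewrite inE eqxx.
  - rewrite big_cons eqxx mul1r; congr (_ + _); apply: eq_big_seq => e' es'.
    by case: eqP es' es => // -> ->.
apply/eqP => f0; have := char0 (c e); rewrite (_ : (c e).+1%:R = 0) ?eqxx //.
apply: (xfree us (c := fun e => (c e).+1%:R)) => // [e'|]; first exact: subring_nat.
by rewrite -ef.
Qed.

Definition subtraction_free f := exists p q, [/\ positive p, positive q & f * q = p].

Lemma subtraction_free_monomial e : subtraction_free (monomial x e).
Proof.
exists (monomial x e), (monomial x 0); split; try exact: positive1.
by rewrite monomial0 mulr1.
Qed.

Lemma subtraction_freeM f g : subtraction_free f -> subtraction_free g ->
  subtraction_free (f * g).
Proof.
move=> [p [q [pp pq e]]] [p' [q' [pp' pq' e']]].
exists (p * p'), (q * q'); split; try exact: positiveM.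
by rewrite mulrACA e e'.
Qed.

Lemma subtraction_freeD f g : subtraction_free f -> subtraction_free g ->
  subtraction_free (f + g).
Proof.
move=> [p [q [pp pq e]]] [p' [q' [pp' pq' e']]].
exists (p * q' + p' * q), (q * q'); split; try exact: positiveM.
  by apply: positiveD; exact: positiveM.
by rewrite -e -e'; ring.
Qed.

Lemma subtraction_freeV f : subtraction_free f -> subtraction_free f^-1.
Proof.
move=> [p [q [pp pq e]]]; exists q, p; split=> //.
have p0 := positive_neq0 pp; have f0 : f != 0.
  by apply: contraNneq p0 => f0; rewrite -e f0 mul0r.
by rewrite -e mulKf.
Qed.

Lemma subtraction_free1 : subtraction_free 1.
Proof. by rewrite -(monomial0 x); exact: subtraction_free_monomial. Qed.

Lemma subtraction_free_expz f (z : int) : subtraction_free f -> subtraction_free (f ^ z).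
Proof.
have nat_case g (k : nat) : subtraction_free g -> subtraction_free (g ^+ k).
  move=> sg; elim: k => [|k IH]; rewrite ?expr0 ?exprS; first exact: subtraction_free1.
  exact: subtraction_freeM.
case: z => k sf; first by rewrite -exprnP; exact: nat_case.
by rewrite NegzE -exprz_inv -exprnP; apply: nat_case; exact: subtraction_freeV.
Qed.

(** f = p / q and - f = p' / q' would make the positive element p q' + p' q vanish. *)
Lemma subtraction_free_opp f : subtraction_free f -> ~ subtraction_free (- f).
Proof.
move=> [p [q [pp pq e]]] [p' [q' [pp' pq' e']]].
have := positive_neq0 (positiveD (positiveM pp pq') (positiveM pp' pq)).
by rewrite -e -e' [X in X != 0](_ : _ = 0) ?eqxx //; ring.
Qed.

End Positivity.

Lemma scaled_cancel (F : fieldType) (c c' u g h : F) : c * c' = 1 -> u != 0 ->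
  h = c * (u * g) -> g = c' * (h * u^-1).
Proof.
move=> ec u0 ->; rewrite [RHS](_ : _ = c * c' * g); last by field.
by rewrite ec mul1r.
Qed.

Section SpanIntersections.
Variables (F : fieldType) (N : nat) (D : F -> Prop) (x : 'I_N -> F).
Hypothesis Dring : is_subring D.
Hypothesis x0 : forall r, x r != 0.
Hypothesis xfree : free D x.

Lemma span_bigcap (T : finType) (H0 : 'cV[int]_N -> Prop) (H : T -> 'cV[int]_N -> Prop) f :
  Span D x H0 f -> (forall i, Span D x (H i) f) -> Span D x (fun e =>
    H0 e /\ forall i, H i e) f.
Proof.
move=> h0 h; have : Span D x (fun e => H0 e /\ forall i, i \in enum T -> H i e) f.
  elim: (enum T) => [|i s IH]; first by apply: span_mono h0 => e he; split.
  apply: span_mono (span_inter Dring xfree Dring (fun c dc => dc) IH (h i)) => e [[he hs] hi].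
  by split=> // j; rewrite inE => /orP [/eqP ->|/hs].
by apply: span_mono => e [he hs]; split=> // i; apply: hs; exact: mem_enum.
Qed.

Lemma span_monomial_inv (H : 'cV[int]_N -> Prop) c e : D c -> c != 0 ->
  Span D x H (c * monomial x e) -> H e.
Proof.
move=> dc c0 hs; apply: NNPP => nh; have : c * monomial x e = 0.
  by apply: (span_disjoint Dring xfree (H := fun e' => e' = e) _ _ hs) => [e' ->||] //;
    exact: span_monomial.
by apply/eqP; rewrite mulf_neq0 // monomial_neq0.
Qed.

End SpanIntersections.

(** * Cluster variables and their numerators *)

Section Main.
Variables (K : idomainType) (m n : nat) (Sigma : tree_vertex n -> seed K m n).
Hypothesis pattern : is_seed_pattern Sigma.
Variable t0 : tree_vertex n.
Hypothesis good0 : good (Sigma t0).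
Hypothesis K_char0 : [pchar K] =i pred0.
Local Notation F := (ambient K m n).
Local Notation scal := (@is_scalar K m n).
Local Notation laurent D t := (Span D (generators t) (@all_exponents _)).
Local Notation U := (upper_cluster_algebra Sigma).
Local Notation gens t := (generators (Sigma t)).
Local Notation gen t i := (generators (Sigma t) (lshift m i)).
Let Sr := @is_scalar_subring K m n.
Let ts t : is_Aseed (Sigma t) := pattern_seed pattern t.
Let x0 t := generators_neq0 (ts t).
Let fr t := generators_free (ts t).
Let Ur := upper_subring pattern.

Definition integers (f : F) := exists z : int, f = z%:~R.

Lemma integers_subring : is_subring integers.
Proof.
split; first by exists 1.
by move=> _ _ [a ->] [b ->]; split; [exists (a - b); rewrite rmorphB|exists (a * b);
  rewrite rmorphM].
Qed.

Lemma integers_scalar c : integers c -> scal c.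
Proof. by move=> [z ->]; exists z%:~R; rewrite scalarE rmorph_int. Qed.

Lemma ambient_char0 k : k.+1%:R != 0 :> F.
Proof.
rewrite -(rmorph_nat (scalar K m n));
  rewrite -(rmorph0 (scalar K m n)) (inj_eq (@scalar_inj K m n)).
by move/pcharf0P: K_char0 => ->.
Qed.

(** Exchange relations contain no subtraction. *)
Lemma cluster_subtraction_free t i : subtraction_free (gens t0) (gen t i).
Proof.
have char := ambient_char0.
suff h : forall r, subtraction_free (gens t0) (gens t r) by [].
apply: (tree_ind (P := fun t => forall r,
  subtraction_free (gens t0) (gens t r)) (t0 := t0)) => [r|k t1 t2 e IH r].
  by rewrite -(monomial_var (gens t0)); exact: subtraction_free_monomial.
have [_ h1 h2] := pattern_exchange pattern t1 k; rewrite (pattern_edge pattern e).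
case: (eqVneq r (lshift m k)) => [->|rk]; last by rewrite h1.
have monSF a : subtraction_free (gens t0) (monomial (gens t1) a).
  apply: big_ind => [||s _].
  - exact: subtraction_free1.
  - by move=> u v; apply: subtraction_freeM.
  - by apply: (subtraction_free_expz Sr) => //; exact: @fr.
have -> : generators (mutate k (Sigma t1)) (lshift m k)
    = binomial (gens t1) (exchange_column (Sigma t1) k) * (gen t1 k)^-1.
  by rewrite -h2 mulfK // x0.
apply: subtraction_freeM => //; first by apply: subtraction_freeD.
by apply: (subtraction_freeV Sr) => //; exact: @fr.
Qed.

(* The Laurent phenomenon, over every D because the starfish argument divides by no
   scalar. *)
Lemma gen_laurent D t t' i : is_subring D -> (forall c, D c -> scal c) ->
  laurent D (Sigma t') (gen t i).
Proof.
move=> Dr Ds; apply: (upper_bound pattern (pattern_good pattern good0 t) Dr Ds) => [|k].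
  by rewrite -(monomial_var (gens t)); exact: span_monomial1.
by rewrite /generators two_blocks_l; apply: cluster_laurent_neighbors.
Qed.

(** With respect to its own seed t the variable has Z-exponent 0, and lower bounds on Z-exponents
    pass between seeds in both directions; [gen_frozen0] is the other one. *)
Lemma gen_frozen t t' i (z : 'I_m) : Span scal (gens t') (fun e =>
  0 <= e (rshift n z) 0) (gen t i).
Proof.
apply: (frozen_valuation_pattern pattern Sr (fun c dc => dc) (t := t)).
  by move=> t1; exact: gen_laurent.
by rewrite -(monomial_var (gens t)); apply: span_monomial1 => //; entries.
Qed.

Lemma gen_frozen0 t t' i (z : 'I_m) : ~ Span scal (gens t') (fun e =>
  1 <= e (rshift n z) 0) (gen t i).
Proof.
move=> h; have : Span scal (gens t) (fun e =>
  1 <= e (rshift n z) 0) (1 * monomial (gens t) (var (lshift m i))).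
  rewrite mul1r monomial_var.
  apply: (frozen_valuation_pattern pattern Sr (fun c dc => dc) (t := t')) h => t1.
  exact: gen_laurent.
move/(span_monomial_inv Sr (x0 t) (@fr t) (subring1 Sr) (oner_neq0 _)).
by entries; rewrite eq_rlshift.
Qed.

(* The unit u is c Z^a. The exponents of the Z's in the expansions of gen t i at
   t0 and of gen t0 k at t give a = 0, and the integrality of the coefficients of
   both expansions gives c = 1 or c = -1; the latter contradicts positivity. *)
Lemma gen_associated t i k u : invertible_in U u -> gen t i = u * gen t0 k ->
  gen t i = gen t0 k.
Proof.
move=> iu e; have [a [c [ic eu a0]]] := upper_invertible pattern good0 iu.
have [sc [c' sc' ec]] := ic.
have c0 : c != 0 := invertible_neq0 ic.
have c'0 : c' != 0.
  by apply: contraNneq (oner_neq0 F) => h; rewrite -ec h mulr0.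
have e1 : gen t i = c * monomial (gens t0) (a + var (lshift m k)).
  by rewrite e eu (monomialD (x0 t0)) (monomial_var (gens t0)) mulrA.
have az (z : 'I_m) : a (rshift n z) 0 = 0.
  apply/eqP; rewrite eq_le; apply/andP; split.
    have e2 : gen t0 k = c' * monomial (gens t) (var (lshift m i) - (a : 'cV[int]_(n + m))).
      rewrite (monomialD (x0 t)) (monomial_var (gens t)).
      have -> : monomial (gens t) (- a) = (monomial (gens t0) a)^-1.
        rewrite -monomialN; apply: eq_monomial => r; case: (split_ordP r) => j ->.
          by rewrite entryN a0 oppr0.
        by rewrite /generators !two_blocks_r.
      apply: (scaled_cancel ec (monomial_neq0 (x0 t0) a)).
      by rewrite e eu mulrA.
    have := gen_frozen t0 t k z; rewrite e2.
    move/(span_monomial_inv Sr (x0 t) (@fr t) sc' c'0).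
    by entries; rewrite eq_rlshift add0r oppr_ge0.
  have := gen_frozen t t0 i z; rewrite e1.
  move/(span_monomial_inv Sr (x0 t0) (@fr t0) sc c0).
  by entries; rewrite eq_rlshift addr0.
have aE : a = 0.
  by apply/colP => r; rewrite entry0; case: (split_ordP r) => j ->.
have e3 : gen t i = c * gen t0 k by rewrite e1 aE add0r monomial_var.
(* Freeness identifies d with the coefficient of the integral Laurent expansion. *)
have int_coef d t1 t2 j l : scal d -> gen t1 j = d * gen t2 l -> integers d.
  move=> sd ed; have h1 : Span scal (gens t2) (fun e => e = var (lshift m l)) (gen t1 j).
    by rewrite ed -(monomial_var (gens t2)); exact: span_monomial.
  have h2 := gen_laurent t1 t2 j integers_subring integers_scalar.
  have h3 := span_inter Sr (@fr t2) integers_subring integers_scalar h1 h2.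
  have [d' id' ed'] : exists2 c, integers c &
    gen t1 j = c * monomial (gens t2) (var (lshift m l)).
    by apply: (span_single integers_subring); apply: span_mono h3 => e' [].
  suff -> : d = d' by [].
  by apply: (mulIf (x0 t2 (lshift m l))); rewrite -ed ed' monomial_var.
have [z1 hz1] : integers c by exact: int_coef e3.
have [z2 hz2] : integers c'.
  by apply: (int_coef c' t0 t k i) => //; rewrite e3 mulrA [c' * c]mulrC ec mul1r.
have z12 : z1 * z2 = 1.
  apply/eqP; rewrite -subr_eq0; apply/negPn/negP => h.
  have : (z1 * z2 - 1)%:~R = 0 :> F by rewrite rmorphB rmorphM /= -hz1 -hz2 ec subrr.
  move: h; case: (z1 * z2 - 1) => l; rewrite ?NegzE.
    by case: l => // l _ /eqP; rewrite -pmulrn (negbTE (ambient_char0 l)).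
  by move=> _ /eqP; rewrite mulrNz oppr_eq0 -pmulrn (negbTE (ambient_char0 l)).
have [z1E|z1E] : z1 = 1 \/ z1 = -1.
  have : (`|z1| * `|z2| == 1)%N by rewrite -abszM z12.
  by rewrite muln_eq1 => /andP [/eqP h _]; move: h; clear; lia.
  by rewrite e3 hz1 z1E mul1r.
case: (subtraction_free_opp Sr (x0 t0) (@fr t0) ambient_char0 (cluster_subtraction_free t0 k)).
have -> : - gen t0 k = gen t i by rewrite e3 hz1 z1E mulN1r.
exact: cluster_subtraction_free.
Qed.

(** In U the variable then divides a product of initial variables, hence, being prime, one of them;
    as that one is irreducible, the two are associated. *)
Lemma gen_invertible t i : invertible_in (laurent scal (Sigma t0)) (gen t i) ->
  exists k, gen t i = gen t0 k.
Proof.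
move=> [_ [g lg eg]].
have [s [l hl es] us] := upper_clear pattern good0 lg.
have pM := gen_prime pattern good0 t i.
have : divides_in U (gen t i) (\prod_(p <- l) p).
  by exists (g * s) => //; rewrite -es mulrA eg mul1r.
case/(prime_divides_prod Ur pM) => [p /hl [k ->]|p /hl [k ->] [r ur er]].
  exact: (upper_cluster pattern good0).
have [_ _ nM _] := pM.
have [_ _ _ /(_ _ _ (upper_cluster pattern good0 t i) ur er) [//|ir]] :=
  prime_irreducible Ur (gen_prime pattern good0 t0 k).
have [_ [v uv erv]] := ir.
exists k; apply: (@gen_associated _ _ _ v).
  by split=> //; exists r; rewrite // mulrC.
by rewrite er mulrCA [v * r]mulrC erv mulr1.
Qed.

(** * Irreducibility of the numerator polynomial *)

Section Numerator.
Variables (t : tree_vertex n) (i : 'I_n) (P : F) (d : 'cV[int]_n).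
Hypothesis not_initial : forall k, gen t i <> gen t0 k.
Hypothesis P_poly : adjoin (@KP K m n) (cluster (Sigma t0)) P.
Hypothesis P_ndiv : forall j, ~ exists2 Q, adjoin (@KP K m n) (cluster (Sigma t0)) Q &
  P = Q * cluster (Sigma t0) j.
Hypothesis P_eq : gen t i = P / \prod_j cluster (Sigma t0) j ^ d j 0.

Let e_d : 'cV[int]_(n + m) := col_mx d 0.

Lemma numeratorE : P = monomial (gens t0) e_d * gen t i.
Proof.
have -> : monomial (gens t0) e_d = \prod_j cluster (Sigma t0) j ^ d j 0.
  by rewrite monomial_two_blocks col_mxKu col_mxKd monomial0 mulr1.
rewrite P_eq mulrC divfK //; apply/prodf_neq0 => j _; rewrite expfz_neq0 //.
exact: cluster_neq0.
Qed.

(** P is a unit times [gen t i], which stays prime when the initial cluster is inverted: otherwise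
    it would divide a product of initial variables and, by [gen_invertible], be initial itself. *)
Lemma numerator_prime : prime_in (laurent scal (Sigma t0)) P.
Proof.
rewrite numeratorE; apply: prime_mul_invertible.
- exact: laurent_subring.
- exact: monomial_invertible.
apply: (prime_localization (upper_localization pattern good0)).
  exact: (gen_prime pattern good0).
move=> s ss dvd; have [_ _ _ hS _] := upper_localization pattern good0.
have [k] : exists k, gen t i = gen t0 k; last exact: not_initial.
apply: gen_invertible; have [_ is_inv] := hS s ss; move: dvd => [q uq eq].
apply: (invertible_factor (laurent_subring Sr (x0 t0)) _ _ (_ : invertible_in _ (gen t i * q))).
- exact: gen_laurent.
- by move/(upper_laurent pattern): uq.
- by rewrite -eq.
Qed.

(** P and [gen t i] differ by a monomial in the cluster variables alone. *)
Lemma numerator_frozen z (s : int) : Span scal (gens t0) (fun e => s <= e (rshift n z) 0) P <->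
  Span scal (gens t0) (fun e => s <= e (rshift n z) 0) (gen t i).
Proof.
have step (a : 'cV[int]_(n + m)) f : a (rshift n z) 0 = 0 -> Span scal (gens t0) (fun e =>
  s <= e (rshift n z) 0) f ->
    Span scal (gens t0) (fun e => s <= e (rshift n z) 0) (monomial (gens t0) a * f).
  move=> az hf; have ha : Span scal (gens t0) (fun e =>
    e (rshift n z) 0 = 0) (monomial (gens t0) a).
    exact: span_monomial1.
  by apply: (spanM Sr (x0 t0) _ ha hf) => e1 e2 h1 h2; rewrite entryD h1 add0r.
have ez : e_d (rshift n z) 0 = 0 by rewrite col_mxEd mxE.
split=> h; last by rewrite numeratorE; exact: step.
have -> : gen t i = monomial (gens t0) (- e_d) * P.
  by rewrite numeratorE monomialN mulKf // monomial_neq0.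
by apply: step => //; rewrite entryN ez oppr0.
Qed.

Lemma numerator_KZ : adjoin (@KZ K m n) (cluster (Sigma t0)) P.
Proof.
rewrite adjoin_KZ_span //; move: P_poly; rewrite adjoin_KP_span // => h.
have hz z : Span scal (gens t0) (fun e => 0 <= e (rshift n z) 0) P.
  by apply/numerator_frozen; exact: gen_frozen.
apply: span_mono (span_bigcap Sr (@fr t0) h hz) => e [h1 h2] r.
by case: (split_ordP r) => j ->.
Qed.

(** One factor of P is a unit of the Laurent ring, thus c x^e, with e non-negative as the factor is
    a polynomial. A positive exponent would make some A_j divide P, against the definition of the
    numerator, or some Z_i, against [gen_frozen0]. *)
Lemma numerator_irreducible : irreducible_in (adjoin (@KZ K m n) (cluster (Sigma t0))) P.
Proof.
have Lr := laurent_subring Sr (x0 t0).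
have KZ_L f : adjoin (@KZ K m n) (cluster (Sigma t0)) f -> laurent scal (Sigma t0) f.
  by rewrite adjoin_KZ_span //; exact: span_mono.
have [_ P0 nP _] := numerator_prime.
have [_ _ _ irr] := prime_irreducible Lr numerator_prime.
split=> //.
- exact: numerator_KZ.
- move=> [hP [v hv e]]; apply: nP; split; first exact: KZ_L.
  by exists v => //; exact: KZ_L.
have unit_case y z : adjoin (@KZ K m n) (cluster (Sigma t0)) y ->
    adjoin (@KZ K m n) (cluster (Sigma t0)) z -> P = y * z ->
    invertible_in (laurent scal (Sigma t0)) y ->
    invertible_in (adjoin (@KZ K m n) (cluster (Sigma t0))) y.
  rewrite adjoin_KZ_span // => hy hz eyz iy.
  have [e [c [ic ey]]] := laurent_invertible Sr (x0 t0) (@fr t0) iy.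
  have [sc [c' sc' ecc]] := ic.
  have c0 := invertible_neq0 ic.
  have e_ge0 : forall r, 0 <= e r 0.
    by move: hy; rewrite ey => /(span_monomial_inv Sr (x0 t0) (@fr t0) sc c0).
  have e0 : e = 0.
    apply/colP => r; rewrite entry0; apply/eqP; rewrite eq_le e_ge0 andbT leNgt; apply/negP.
    case: (split_ordP r) => j -> ej.
      apply: (P_ndiv (j := j)); exists (c * monomial (gens t0) (e - var (lshift m j)) * z).
        rewrite adjoin_KP_span //.
        have h1 : Span scal (gens t0) (fun e => forall i, 0 <= e (lshift m i) 0)
            (c * monomial (gens t0) (e - var (lshift m j))).
          apply: span_monomial => // i'; entries; rewrite (inj_eq (@lshift_inj _ _)).
          by have := e_ge0 (lshift m i'); case: eqP => [->|_]; rewrite ?subr0 //; move: ej;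
            move: (e _ _) => w; lia.
        have h2 : Span scal (gens t0) (fun e => forall i, 0 <= e (lshift m i) 0) z.
          by apply: span_mono hz.
        by apply: (spanM Sr (x0 t0) _ h1 h2) => e1 e2 g1 g2 l; rewrite entryD addr_ge0.
      have -> : cluster (Sigma t0) j = monomial (gens t0) (var (lshift m j)).
        by rewrite monomial_var /generators two_blocks_l.
      rewrite mulrAC -[X in X * z]mulrA -monomialD; last exact: x0.
      by rewrite subrK eyz ey.
    apply: (@gen_frozen0 t t0 i j); apply/numerator_frozen; rewrite eyz.
    have h1 : Span scal (gens t0) (fun e => 1 <= e (rshift n j) 0) y.
      by rewrite ey; apply: span_monomial => //; move: ej; move: (e _ _) => w; lia.
    have h2 : Span scal (gens t0) (fun e => 0 <= e (rshift n j) 0) z.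
      by apply: span_mono hz.
    by apply: (spanM Sr (x0 t0) _ h1 h2) => e1 e2 g1 g2; rewrite entryD; move: g1 g2;
      move: (e1 _ _) (e2 _ _) => w w'; lia.
  split=> //; exists c'; last by rewrite ey e0 monomial0 mulr1.
  by rewrite -[c']mulr1 -(monomial0 (gens t0)); apply: span_monomial => // r; entries.
move=> y z hy hz e; case: (irr y z (KZ_L y hy) (KZ_L z hz) e) => h; [left|right].
  exact: unit_case e h.
by apply: (unit_case z y) => //; rewrite mulrC.
Qed.

End Numerator.

End Main.

Theorem theorem4p13 (K : idomainType) (m n : nat)
    (K_factorial : factorial_domain (fun _ : K => True))
    (K_char0 : [pchar K] =i pred0)
    (Sigma : tree_vertex n -> seed K m n) (Sigma_pattern : is_seed_pattern Sigma)
    (t0 : tree_vertex n)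
    (binomials_not_invertible :
       forall (t : tree_vertex n) (k : 'I_n),
         ~ invertible_in (@KP K m n) (exchange_binomial (Sigma t) k))
    (U_full_rank : full_rank (Sigma t0))
    (U_primitive : primitive (Sigma t0)) :
  factorial_domain (upper_cluster_algebra Sigma) /\
  (forall (M P_M : ambient K m n) (d : 'cV[int]_n),
     is_cluster_variable Sigma M ->
     (forall i : 'I_n, M <> cluster (Sigma t0) i) ->
     is_numerator_dvector (Sigma t0) M P_M d ->
     irreducible_in (adjoin (@KZ K m n) (cluster (Sigma t0))) P_M).
Proof.
have K_pf := factorial_prime_factorial K_factorial.
have good0 : good (Sigma t0).
  split; first exact: pattern_seed.
    by move=> k; exact: primitive_good.
  by move=> v; exact: full_rank_good.
split; first exact/prime_factorial_factorial/(upper_prime_factorial Sigma_pattern good0 K_pf).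
move=> M P d [t [i ->]] not_initial [P_poly P_ndiv P_eq].
have genE u j : generators (Sigma u) (lshift m j) = cluster (Sigma u) j by exact: two_blocks_l.
apply: (numerator_irreducible Sigma_pattern good0 K_char0 (t := t) (i := i) (d := d)) => //.
  by move=> k; rewrite !genE.
by rewrite genE.
Qed.
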